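(* Let $G=\langle f_1,\dots,f_u\rangle$ be a TNR rational semigroup generated by a $u$-tuple of rational maps and let $\mathcal U=\{U_s\}_{s\in S}$ be a nice family of sets for $\tilde f$ (as specified in the context, with properties (A) and (B)). Then the family $$\mathcal S_{\mathcal U}:=\big\{\tilde f_\tau^{-\|\tau\|}:X_{t(\tau)}\to X_{i(\tau)}\big\}_{\tau\in\mathcal D_{\mathcal U}},\qquad X_s:=\overline{U_s},$$ forms a graph directed system. Furthermore: (a) The corresponding incidence matrix $A(\mathcal U)$ is determined by the condition that $A_{\tau\omega}(\mathcal U)=1$ if and only if $t(\tau)=i(\omega)$. (b) The limit set $J_{\mathcal U}$ of the system $\mathcal S_{\mathcal U}$ is contained in $J(\tilde f)$ and contains $U\cap\mathrm{Trans}(\tilde f)$, where $U=\bigcup_{s\in S}U_s$ and $\mathrm{Trans}(\tilde f)$ is the set of points $z\in J(\tilde f)$ such that $\{\tilde f^n(z):n\ge0\}$ is dense in $J(\tilde f)$. (c) The graph directed system $\mathcal S_{\mathcal U}$ is finitely primitive.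
   Context: Let $u\ge 1$, let $f=(f_1,\dots,f_u)$ be a $u$-tuple of non-constant rational maps of $\hat{\mathbb C}$, and $G=\langle f_1,\dots,f_u\rangle$ the semigroup generated under composition. $F(G)$ is the set of points having a neighbourhood on which $G$ is normal, $J(G)=\hat{\mathbb C}\setminus F(G)$. Fundamental Assumption (standing): some $g\in G$ has degree $\ge2$; every Möbius element of $G$ is loxodromic; $F(G)\ne\emptyset$ and, after a Möbius change of coordinates, $\infty\in F(G)$, so $J(G)\subset\mathbb C$. $\Sigma_u=\{1,\dots,u\}^{\mathbb N}$ with shift $\sigma$; for a finite word $\omega=(\omega_1,\dots,\omega_n)$, $|\omega|=n$, $f_\omega=f_{\omega_n}\circ\dots\circ f_{\omega_1}$; $\omega|_n$ is the initial block. Skew product: $\tilde f(\omega,z)=(\sigma(\omega),f_{\omega_1}(z))$ on $\Sigma_u\times\hat{\mathbb C}$; $p_2(\omega,z)=z$. $J_\omega$ is the set of $z$ at which $\{f_{\omega|_n}\}_{n\ge1}$ is not normal in any neighbourhood; $J(\tilde f)=\overline{\bigcup_\omega\{\omega\}\times J_\omega}\subset\Sigma_u\times\mathbb C$. $\Sigma_u\times\mathbb C$ carries the metric $\max\{\vartheta^{|\omega\wedge\tau|},|z-w|\}$ between $(\omega,z)$ and $(\tau,w)$, where $\vartheta\in(0,1)$ is fixed and $|\omega\wedge\tau|$ is the length of the longest common initial block ($\vartheta^\infty=0$). $B_2$ denotes Euclidean balls/neighbourhoods. $\mathrm{Crit}_*(f)=\bigcup_{i}\{c\in\mathrm{Crit}(f_i):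 f_i(c)\in J(G)\}$; $\mathrm{PCV}(G)=\overline{\{g(c):g\in G,\ g'(c)=0\}}$. $G$ (satisfying the Fundamental Assumption) is TNR if (i) each $z\in J(G)$ has a neighbourhood $U$ such that for any sequence $g_n\in G$, any domain $V\subset\hat{\mathbb C}$ and any $\zeta\in U$, $(g_n)$ does not converge to $\zeta$ locally uniformly on $V$; and (ii) $\mathrm{Crit}_*(f)\cap\mathrm{PCV}(G)=\emptyset$. $R_*(G)$ is a fixed number in $\big(0,\tfrac1{16}\min\{\mathrm{dist}(\mathrm{Crit}_*(f),\mathrm{PCV}(G)),\min\{|c_2-c_1|:c_1\neq c_2\text{ critical points of the generators}\}\}\big)$ so small that there are $C,\alpha>0$ such that for all $x\in J(G)$ and finite words $\omega$ each component of $f_\omega^{-1}(B_2(x,R_*(G)))$ is simply connected of diameter $\le Ce^{-\alpha|\omega|}$. Fix $R\in(0,R_*(G))$, $\kappa\in(1,2)$, a finite set $S$ which is aperiodic ($S\cap\bigcup_{g\in G}g(S)=\emptyset$) with $\mathrm{Crit}_*(f)\subset S\subset J(G)\setminus B_2(\mathrm{PCV}(G),8R)$, and $r\in(0,R]$ sufficiently small. For $b\in S$, $\mathrm{HIB}(b)$ is the set of all $\rho=(\tilde\rho,f_\rho^{-1})$ with $\tilde\rho$ a finite word (possibly empty) and $f_\rho^{-1}$ a holomorphic inverse branch of $f_{\tilde\rho}$ on $B_2(b,4R)$; $\|\rho\|=|\tilde\rho|$, $\tilde f_\rho^{-\|\rho\|}(\omega,z)=(\tilde\rho\omega,f_\rho^{-1}(z))$;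 $\mathrm{HIB}_n(b)=\{\rho\in\mathrm{HIB}(b):\|\rho\|=n\}$. A nice family is a collection $\{U_s\}_{s\in S}$ of open subsets of $\Sigma_u\times\mathbb C$, mutually disjoint, with $p_2(U_s)\subset B_2(s,2R)$, such that for all $a,b\in S$, $\rho\in\mathrm{HIB}(b)$ either $U_a\cap\tilde f_\rho^{-\|\rho\|}(U_b)=\emptyset$ or $\tilde f_\rho^{-\|\rho\|}(U_b)\subset U_a$. The family $\mathcal U$ considered also satisfies: (A) $\Sigma_u\times B_2(s,r)\subset U_s\subset\Sigma_u\times B_2(s,\kappa r)$; (B) if $\rho\in\mathrm{HIB}(b)$, $\|\rho\|\ge1$ and $\tilde f_\rho^{-\|\rho\|}(U_b)\subset U_a$, then $|(f_\rho^{-1})'|\le\frac14$ on $B_2(b,2R)$. (Such families exist for all small $r$.) Let $U=\bigcup_sU_s$. For $s\in S$, $n\ge0$: $\mathcal D_n^*(s)=\{\tau\in\mathrm{HIB}_n(s):\tilde f^k(\tilde f_\tau^{-n}(U_s))\cap U=\emptyset\text{ for all }0\le k\le n-1\}$, and for $n\ge1$, $\mathcal D_n(s)=\{\tau\in\mathrm{HIB}_n(s):\tilde f_\tau^{-n}(U_s)\cap U\ne\emptyset\text{ and }\tilde f\circ\tilde f_\tau^{-n}\in\mathcal D_{n-1}^*(s)\}$ (identifying a branch with the map it defines). $\mathcal D_{\mathcal U}=\bigcup_{n\ge1}\bigcup_{s\in S}\mathcal D_n(s)$. For $\tau\in\mathcal D_{\mathcal U}$, $t(\tau)\in S$ is the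 unique element with $\tau\in\mathrm{HIB}(t(\tau))$, and $i(\tau)\in S$ the unique element with $\tilde f_\tau^{-\|\tau\|}(U_{t(\tau)})\subset U_{i(\tau)}$. Graph directed system (in the sense of Mauldin–Urbański): a finite vertex set $S$, a countable edge set $E$, maps $i,t:E\to S$, compact metric spaces $X_s$, and one-to-one contractions $\phi_e:X_{t(e)}\to X_{i(e)}$ with a common Lipschitz constant $<1$, together with an incidence matrix $A:E\times E\to\{0,1\}$ such that $A_{ee'}=1$ implies $t(e)=i(e')$. Its limit set is the set of all points $\bigcap_{n\ge1}\phi_{\omega_1}\circ\dots\circ\phi_{\omega_n}(X_{t(\omega_n)})$ over infinite sequences $\omega$ with $A_{\omega_k\omega_{k+1}}=1$ for all $k$. It is finitely primitive if there is a finite set $\Lambda$ of admissible words of one common length such that for all $e,e'\in E$ there is $\lambda\in\Lambda$ with $e\lambda e'$ admissible. *)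

(* Defs.v *)
From HB Require Import structures.
From mathcomp Require Import all_boot all_order all_algebra.
From mathcomp Require Import all_classical all_reals all_analysis.
From mathcomp.real_closed Require Import complex.

Set Implicit Arguments.
Unset Strict Implicit.
Unset Printing Implicit Defensive.

Import Order.TTheory GRing.Theory Num.Theory.
Import numFieldNormedType.Exports.

Local Open Scope classical_set_scope.
Local Open Scope ring_scope.

(* Real-valued modulus; the generic norm of [R[i]] takes its values in [R[i]]. *)
Definition cmod (R : realType) (z : R[i]) : R := ComplexField.Normc.normc z.

Definition B2 (R : realType) (z : R[i]) (r : R) : set R[i] :=
  [set w | cmod (w - z) < r].

(* Stereographic projection onto the unit sphere of R^3; [None] is infinity. *)
Definition stereo (R : realType) (x : option R[i]) : R * R * R :=
  if x is Some z then
    let n := cmod z ^+ 2 in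
    (2 * complex.Re z / (n + 1), 2 * complex.Im z / (n + 1), (n - 1) / (n + 1))
  else (0, 0, 1).

(* The topology and the uniform structure are pulled back from R^3; the ball
   distance is the sup distance there, bi-Lipschitz to the chordal distance. *)
Definition sphere (R : realType) : Type := option R[i].

HB.instance Definition _ (R : realType) := Choice.on (sphere R).
HB.instance Definition _ (R : realType) :=
  PseudoMetric.copy (sphere R) (initial_topology (@stereo R)).

Section RiemannSphere.
Context {R : realType}.
Local Notation C := R[i].
Local Notation Chat := (sphere R).

Definition fin (x : Chat) : C := if x is Some z then z else 0.

Definition sinv (x : Chat) : Chat :=
  if x is Some z then (if z == 0 then None else Some z^-1) else Some 0.

(* Holomorphic coordinate near [p]: z when p is finite, 1/z when p = oo. *)
Definition coord (p x : Chat) : C :=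
  if p is Some _ then fin x else fin (sinv x).

Definition uncoord (p : Chat) (w : C) : Chat :=
  if p is Some _ then Some w else sinv (Some w).

Definition crit (f : Chat -> Chat) (c : Chat) : Prop :=
  derive1 (fun w : C^o => coord (f c) (f (uncoord c w)) : C^o) (coord c c) = 0.

Definition holomorphic_at (g : C -> Chat) (z : C) : Prop :=
  {for z, continuous (g : C^o -> Chat)} /\
  derivable (fun w : C^o => coord (g z) (g w) : C^o) z 1.

Definition ratdeg (p q : {poly C}) : nat := (maxn (size p) (size q)).-1.

Definition ratmap (p q : {poly C}) (x : Chat) : Chat :=
  match x with
  | Some z => if q.[z] == 0 then None else Some (p.[z] / q.[z])
  | None => let d := ratdeg p q in
            if q`_d == 0 then None else Some (p`_d / q`_d)
  end.

Definition rational_of_degree (f : Chat -> Chat) (d : nat) : Prop :=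
  exists p q : {poly C}, [/\ coprimep p q, ratdeg p q = d & f = ratmap p q].

Definition nonconstant_rational (f : Chat -> Chat) : Prop :=
  exists2 d, (0 < d)%N & rational_of_degree f d.

Definition dilation (l : C) (x : Chat) : Chat :=
  if x is Some z then Some (l * z) else None.

Definition loxodromic (g : Chat -> Chat) : Prop :=
  exists (h : Chat -> Chat) (l : C),
    [/\ rational_of_degree h 1, l != 0, cmod l != 1 & h \o g = dilation l \o h].

Definition locally_uniform_cvg (V : set Chat) (g : nat -> Chat -> Chat)
    (h : Chat -> Chat) : Prop :=
  forall z, V z -> exists2 W, nbhs z W & {uniform W `&` V, g @ \oo --> h}.

Definition normal_on (F : set (Chat -> Chat)) (V : set Chat) : Prop :=
  forall g : nat -> Chat -> Chat, (forall n, F (g n)) ->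
    exists (k : nat -> nat) (h : Chat -> Chat),
      {homo k : m n / (m < n)%N} /\ locally_uniform_cvg V (fun n => g (k n)) h.

Definition normal_at (F : set (Chat -> Chat)) (z : Chat) : Prop :=
  exists V : set Chat, [/\ open V, V z & normal_on F V].

Definition domain (V : set Chat) : Prop := [/\ open V, V !=set0 & connected V].

Definition I01 : set R := [set t | 0 <= t <= 1].

Definition is_path (W : set Chat) (x y : Chat) (g : R -> Chat) : Prop :=
  [/\ {within I01, continuous g}, g @` I01 `<=` W, g 0 = x & g 1 = y].

Definition simply_connected (W : set Chat) : Prop :=
  (forall x y, W x -> W y -> exists g, is_path W x y g) /\
  (forall x g, is_path W x x g -> exists H : R * R -> Chat,
     [/\ {within I01 `*` I01, continuous H},
         H @` (I01 `*` I01) `<=` W,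
         (forall t, I01 t -> H (0, t) = g t),
         (forall t, I01 t -> H (1, t) = x) &
         (forall s, I01 s -> H (s, 0) = x /\ H (s, 1) = x)]).

(* Euclidean distance between the finite parts; [+oo] if one of them is empty. *)
Definition edist (A B : set Chat) : \bar R :=
  ereal_inf [set (cmod (x.1 - x.2))%:E |
             x in [set x : C * C | A (Some x.1) /\ B (Some x.2)]].

Definition enbhd (A : set Chat) (r : R) : set C :=
  [set z | exists2 a : C, A (Some a) & cmod (z - a) < r].

(* In particular a set of Euclidean diameter at most [d] lies in C. *)
Definition ediam_le (A : set Chat) (d : R) : Prop :=
  forall x y, A x -> A y ->
    exists a b : C, [/\ x = Some a, y = Some b & cmod (a - b) <= d].

End RiemannSphere.

Section Words.
Context {u : nat}.

Definition shift (om : nat -> 'I_u) : nat -> 'I_u := fun n => om n.+1.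

Definition wcat (w : seq 'I_u) (om : nat -> 'I_u) : nat -> 'I_u :=
  fun n => nth (om (n - size w)%N) w n.

Definition initial (om : nat -> 'I_u) (n : nat) : seq 'I_u := mkseq om n.

(* theta ^ |om /\ ta|: the first index at which [om] and [ta] differ is the
   length of their longest common initial block. *)
Definition sdist (R : realType) (theta : {itv R & `]0, 1[})
    (om ta : nat -> 'I_u) : R :=
  if pselect (exists n, om n != ta n) is left h
  then (theta%:num) ^+ ex_minn h else 0.

End Words.

Definition SC (R : realType) (u : nat) (theta : {itv R & `]0, 1[}) : Type :=
  ((nat -> 'I_u) * R[i])%type.

Section SCMetric.
Context {R : realType} {u : nat} (theta : {itv R & `]0, 1[}).

Definition sc_dist (x y : SC u theta) : R :=
  Num.max (sdist theta x.1 y.1) (cmod (x.2 - y.2)).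

Let th0 : 0 < theta%:num :> R.
Proof. by []. Qed.

Let th1 : theta%:num < 1 :> R.
Proof. by []. Qed.

Lemma sdist_ge0 (om ta : nat -> 'I_u) : 0 <= sdist theta om ta.
Proof. by rewrite /sdist; case: pselect => // h; rewrite exprn_ge0 // ltW. Qed.

Lemma sdist_leP (om ta : nat -> 'I_u) n :
  reflect (forall k, (k < n)%N -> om k = ta k) (sdist theta om ta <= theta%:num ^+ n).
Proof.
rewrite /sdist; case: pselect => [h|h].
- case: ex_minnP => m hm mmin; rewrite ler_iXn2l //.
  apply: (iffP idP) => [nm k kn|H].
    apply/eqP; apply: contraT => /mmin mk.
    by move: (leq_trans kn (leq_trans nm mk)); rewrite ltnn.
  by rewrite leqNgt; apply/negP => /H/eqP; rewrite (negbTE hm).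
- rewrite exprn_ge0 ?ltW //; apply: (iffP idP) => // _ k _.
  by apply/eqP; apply: contraT => hk; case: h; exists k.
Qed.

Lemma sdistxx (om : nat -> 'I_u) : sdist theta om om = 0.
Proof.
rewrite /sdist; case: pselect => // h; exfalso.
by case: h => n; rewrite eqxx.
Qed.

Lemma sdist_eq0 (om ta : nat -> 'I_u) : sdist theta om ta = 0 -> om = ta.
Proof.
rewrite /sdist; case: pselect => [h /eqP|h _].
  by rewrite expf_eq0 (gt_eqF th0) andbF.
by apply/funext => k; apply/eqP; apply: contraT => hk; case: h; exists k.
Qed.

Lemma sdist_sym (om ta : nat -> 'I_u) : sdist theta om ta = sdist theta ta om.
Proof.
rewrite /sdist; case: pselect => [h|h]; case: pselect => [h'|h'] //.
- congr (_ ^+ _); case: ex_minnP => m hm mm; case: ex_minnP => n hn nn.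
  by apply/eqP; rewrite eqn_leq mm 1?eq_sym // nn // eq_sym.
- by case: h'; case: h => n hn; exists n; rewrite eq_sym.
- by case: h; case: h' => n hn; exists n; rewrite eq_sym.
Qed.

Lemma sdist_ultra (ta om rh : nat -> 'I_u) :
  sdist theta om rh <= Num.max (sdist theta om ta) (sdist theta ta rh).
Proof.
have [->|ne] := pselect (om = ta); first by rewrite le_max lexx orbT.
have [<-|ne'] := pselect (ta = rh); first by rewrite le_max lexx.
have val (a b : nat -> 'I_u) : a <> b ->
    exists m, sdist theta a b = theta%:num ^+ m.
  move=> ab; rewrite /sdist; case: pselect => [h|h]; first by exists (ex_minn h).
  case: ab; apply/funext => k; apply/eqP; apply: contraT => hk.
  by case: h; exists k.
have [m em] := val _ _ ne; have [n en] := val _ _ ne'.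
have /sdist_leP Hm : sdist theta om ta <= theta%:num ^+ m by rewrite em.
have /sdist_leP Hn : sdist theta ta rh <= theta%:num ^+ n by rewrite en.
have : sdist theta om rh <= theta%:num ^+ minn m n.
  apply/sdist_leP => k; rewrite leq_min => /andP[km kn].
  by rewrite Hm // Hn.
rewrite le_max em en; case: (leqP m n) => _ -> //; exact: orbT.
Qed.

Let sc_distxx x : sc_dist x x = 0.
Proof.
by rewrite /sc_dist sdistxx subrr /cmod ComplexField.Normc.normc0 maxxx.
Qed.

Let cmod_ge0 (z : R[i]) : 0 <= cmod z.
Proof. by case: z => a b; exact: sqrtr_ge0. Qed.

Let sc_dist_positivity x y : sc_dist x y = 0 -> x = y.
Proof.
case: x y => [om z] [ta w]; rewrite /sc_dist /= => d0.
have : sdist theta om ta <= 0 by rewrite -d0 le_max lexx.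
have : cmod (z - w) <= 0 by rewrite -d0 le_max lexx orbT.
move=> c0 s0; congr (_, _).
  by apply/sdist_eq0/eqP; rewrite eq_le s0 sdist_ge0.
apply/eqP; rewrite -subr_eq0; apply/eqP/ComplexField.Normc.eq0_normc.
by apply/eqP; rewrite eq_le c0 cmod_ge0.
Qed.

Let sc_dist_sym x y : sc_dist x y = sc_dist y x.
Proof.
by rewrite /sc_dist sdist_sym -(opprB y.2 x.2) /cmod normcN.
Qed.

Let sc_dist_triangle y x z : sc_dist x z <= sc_dist x y + sc_dist y z.
Proof.
rewrite /sc_dist ge_max; apply/andP; split.
  apply: (le_trans (sdist_ultra y.1 _ _)); rewrite ge_max; apply/andP; split.
    by rewrite ler_wpDr ?le_max ?sdist_ge0 ?lexx.
  by rewrite ler_wpDl ?le_max ?sdist_ge0 ?lexx.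
have -> : x.2 - z.2 = (x.2 - y.2) + (y.2 - z.2) by rewrite addrA subrK.
apply: (le_trans (le_normcD _ _)).
by apply: lerD; rewrite le_max lexx orbT.
Qed.

HB.instance Definition _ := Choice.on (SC u theta).
HB.instance Definition _ := isMetric.Build R (SC u theta)
  sc_distxx sc_dist_positivity sc_dist_sym sc_dist_triangle.

End SCMetric.

(* The spaces are given as subsets of one ambient metric space, the maps as
   total functions of which only the restriction to [gds_space (gds_ter e)]
   matters. *)
Record gds_data (R : realType) (T : metricType R) (V E : Type) := GDSData {
  gds_vertex : set V;
  gds_edge : set E;
  gds_ini : E -> V;
  gds_ter : E -> V;
  gds_space : V -> set T;
  gds_map : E -> T -> T;
  gds_inc : E -> E -> bool }.

Section GDS.
Context {R : realType} {T : metricType R} {V E : Type}.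
Variable D : gds_data T V E.

Definition graph_directed_system : Prop :=
  [/\ finite_set (gds_vertex D) /\ countable (gds_edge D),
      forall e, gds_edge D e ->
        gds_vertex D (gds_ini D e) /\ gds_vertex D (gds_ter D e),
      forall v, gds_vertex D v -> compact (gds_space D v),
      forall e, gds_edge D e ->
        gds_map D e @` gds_space D (gds_ter D e) `<=` gds_space D (gds_ini D e)
        /\ set_inj (gds_space D (gds_ter D e)) (gds_map D e) &
      (exists L : R, [/\ 0 <= L, L < 1 & forall e, gds_edge D e ->
         {in gds_space D (gds_ter D e) &, forall x y,
           mdist (gds_map D e x) (gds_map D e y) <= L * mdist x y}])
      /\ (forall e e', gds_edge D e -> gds_edge D e' ->
            gds_inc D e e' -> gds_ter D e = gds_ini D e')].

(* phi_{om 0} o ... o phi_{om (n-1)} *)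
Fixpoint gds_comp (om : nat -> E) (n : nat) : T -> T :=
  if n is n'.+1 then gds_comp om n' \o gds_map D (om n') else id.

Definition gds_limit_set : set T :=
  [set x | exists om : nat -> E,
     [/\ forall k, gds_edge D (om k),
         forall k, gds_inc D (om k) (om k.+1) &
         \bigcap_n (gds_comp om n.+1 @` gds_space D (gds_ter D (om n)))
           = [set x]]].

Definition gds_admissible (w : seq E) : Prop :=
  all (fun e => `[< gds_edge D e >]) w /\ sorted (gds_inc D) w.

Definition finitely_primitive : Prop :=
  exists (Lam : set (seq E)) (n : nat),
    [/\ finite_set Lam,
        forall w, Lam w -> size w = n /\ gds_admissible w &
        forall e e', gds_edge D e -> gds_edge D e' ->
          exists2 w, Lam w & gds_admissible (e :: rcons w e')].

End GDS.

Section Semigroup.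
Context {R : realType} {u : nat}.
Local Notation C := R[i].
Local Notation Chat := (sphere R).
Variable f : 'I_u -> Chat -> Chat.

(* f_w = f_{w_n} o ... o f_{w_1}, the identity for the empty word. *)
Fixpoint fword (w : seq 'I_u) : Chat -> Chat :=
  if w is i :: w' then fword w' \o f i else id.

Definition semigroup : set (Chat -> Chat) :=
  [set fword w | w in [set w | w <> [::]]].

Definition fatou : set Chat := [set z | normal_at semigroup z].

Definition julia : set Chat := ~` fatou.

Definition fundamental_assumption : Prop :=
  [/\ exists2 g, semigroup g &
        exists2 d, (2 <= d)%N & rational_of_degree g d,
      forall g, semigroup g -> rational_of_degree g 1 -> loxodromic g &
      fatou None].

Definition crit_star : set Chat :=
  [set c | exists2 i, crit (f i) c & julia (f i c)].

Definition PCV : set Chat :=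
  closure [set x | exists g c, [/\ semigroup g, crit g c & x = g c]].

Definition TNR : Prop :=
  [/\ fundamental_assumption,
      forall z, julia z -> exists2 N, nbhs z N &
        forall (g : nat -> Chat -> Chat) (V : set Chat) (zeta : Chat),
          (forall n, semigroup (g n)) -> domain V -> N zeta ->
          ~ locally_uniform_cvg V g (cst zeta) &
      crit_star `&` PCV = set0].

Definition critical_gap : \bar R :=
  ereal_inf [set (cmod (x.1 - x.2))%:E |
             x in [set x : C * C | [/\ x.1 != x.2,
                     exists i, crit (f i) (Some x.1) &
                     exists j, crit (f j) (Some x.2)]]].

(* [Rs] is a possible choice of the constant R_*(G). *)
Definition Rstar (Rs : R) : Prop :=
  [/\ 0 < Rs,
      (Rs%:E < (16^-1)%:E * Order.min (edist crit_star PCV) critical_gap)%E &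
      exists K alpha : R, [/\ 0 < K, 0 < alpha &
        forall (x : C) (w : seq 'I_u), julia (Some x) ->
          let P : set Chat := fword w @^-1` (Some @` B2 x Rs) in
          forall y, P y ->
            simply_connected (connected_component P y) /\
            ediam_le (connected_component P y)
              (K * expR (- (alpha * (size w)%:R)))]].

Definition aperiodic (S : set C) : Prop :=
  forall g s, semigroup g -> S s -> ~ (Some @` S) (g (Some s)).

Definition vertex_set (r : R) (S : set C) : Prop :=
  [/\ finite_set S, aperiodic S, crit_star `<=` Some @` S &
      forall s, S s -> julia (Some s) /\ ~ enbhd PCV (8 * r) s].

End Semigroup.

Section Skew.
Context {R : realType} {u : nat} {theta : {itv R & `]0, 1[}}.
Local Notation C := R[i].
Local Notation Chat := (sphere R).
Local Notation Sigma := (nat -> 'I_u).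
Variable f : 'I_u -> Chat -> Chat.

Definition emb (x : SC u theta) : Sigma * Chat := (x.1, Some x.2).

Definition skew (x : Sigma * Chat) : Sigma * Chat :=
  (shift x.1, f (x.1 0%N) x.2).

Definition julia_fiber (om : Sigma) : set Chat :=
  [set z | ~ normal_at [set fword f (initial om n.+1) | n in [set: nat]] z].

Definition julia_skew : set (SC u theta) :=
  closure [set x : SC u theta | julia_fiber x.1 (Some x.2)].

Definition trans : set (SC u theta) :=
  [set x | julia_skew x /\
    julia_skew `<=` closure [set y | exists n, emb y = iter n skew (emb x)]].

(* A branch carries the centre [hib_base] of its domain B_2(b, 4R).  Its values
   are allowed to be infinite. *)
Record hib := Hib {
  hib_base : C;
  hib_word : seq 'I_u;
  hib_inv : C -> Chat }.

Definition hib_lift (rho : hib) (x : SC u theta) : Sigma * Chat :=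
  (wcat (hib_word rho) x.1, hib_inv rho x.2).

(* The Sigma_u x C valued version of [hib_lift]; junk at poles of the branch. *)
Definition hib_map (rho : hib) (x : SC u theta) : SC u theta :=
  (wcat (hib_word rho) x.1, fin (hib_inv rho x.2)).

Variables (rR : R) (S : set C) (U : C -> set (SC u theta)).

(* The last clause fixes the values outside the domain, so that equality of
   records is equality of branches. *)
Definition HIB (b : C) : set hib :=
  [set rho | [/\ hib_base rho = b,
     forall z, B2 b (4 * rR) z -> holomorphic_at (hib_inv rho) z,
     forall z, B2 b (4 * rR) z -> fword f (hib_word rho) (hib_inv rho z) = Some z &
     forall z, ~ B2 b (4 * rR) z -> hib_inv rho z = None]].

Definition HIBn (n : nat) (b : C) : set hib :=
  [set rho | HIB b rho /\ size (hib_word rho) = n].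

Definition nice_family : Prop :=
  [/\ forall s, S s -> open (U s),
      forall a b, S a -> S b -> a <> b -> U a `&` U b = set0,
      forall s x, S s -> U s x -> B2 s (2 * rR) x.2 &
      forall a b rho, S a -> S b -> HIB b rho ->
        (emb @` U a) `&` (hib_lift rho @` U b) = set0 \/
        hib_lift rho @` U b `<=` emb @` U a].

Definition nice_A (kappa r : R) : Prop :=
  forall s, S s ->
    (forall x : SC u theta, B2 s r x.2 -> U s x) /\
    (forall x, U s x -> B2 s (kappa * r) x.2).

(* The bound keeps poles out of B_2(b, 2R): the derivative of the branch is
   unbounded near a pole. *)
Definition nice_B : Prop :=
  forall a b rho, S a -> S b -> HIB b rho -> (1 <= size (hib_word rho))%N ->
    hib_lift rho @` U b `<=` emb @` U a ->
    forall z, B2 b (2 * rR) z ->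
      cmod (derive1 (fun w : C^o => fin (hib_inv rho w) : C^o) z) <= 4^-1.

Definition nice_union : set (SC u theta) := \bigcup_(s in S) U s.

Definition Dstar (n : nat) (s : C) : set hib :=
  [set tau | HIBn n s tau /\ forall k, (k < n)%N ->
     (iter k skew @` (hib_lift tau @` U s)) `&` (emb @` nice_union) = set0].

Definition Dn (n : nat) (s : C) : set hib :=
  [set tau | [/\ HIBn n s tau,
     (hib_lift tau @` U s) `&` (emb @` nice_union) !=set0 &
     exists2 rho, Dstar n.-1 s rho &
       forall x : SC u theta, B2 s (4 * rR) x.2 ->
         skew (hib_lift tau x) = hib_lift rho x]].

Definition D_U : set hib :=
  [set tau | exists n s, [/\ (1 <= n)%N, S s & Dn n s tau]].

Definition ini_rel (tau : hib) : set C :=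
  [set a | S a /\ hib_lift tau @` U (hib_base tau) `<=` emb @` U a].

Definition ini (tau : hib) : C := xget 0 (ini_rel tau).

Definition system (A : hib -> hib -> bool) : gds_data (SC u theta) C hib :=
  GDSData S D_U ini hib_base (fun s => closure (U s)) hib_map A.

End Skew.

Arguments hib R u : clear implicits.

(* Main.v *)
Require Import Defs.
From HB Require Import structures.
From mathcomp Require Import all_boot all_order all_algebra.
From mathcomp Require Import all_classical all_reals all_analysis.
From mathcomp Require Import ring lra zify finmap.
From mathcomp.real_closed Require Import complex.

Set Implicit Arguments.
Unset Strict Implicit.
Unset Printing Implicit Defensive.

Import Order.TTheory GRing.Theory Num.Theory.
Import numFieldNormedType.Exports.
Import Defs.

Local Open Scope classical_set_scope.
Local Open Scope ring_scope.

(** An edge of the system is an inverse branch of the skew product along a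
    first return to U. Read backwards, an orbit that starts in U_a and next
    meets U in U_b is an edge from a to b ([edge_of_orbit]): the branch
    exists because b is far from the postcritical set, niceness makes it map
    the whole of U_b into U_a, and niceness again prevents it from meeting U
    in between. Everything is deduced from this dictionary between orbits
    and edges.

    Contraction. Property (B) bounds the derivative of a branch by 1/4 on
    B(b, 2R), which contains the second coordinates of the closure of U_b. A
    branch that is finite at one point cannot run into a pole along a
    segment, because it stays bounded there ([segment_lipschitz]), so edges
    are contractions of these closures in the second coordinate; in the
    first they contract by theta ([edge_contraction]).

    Limit set. A vertex s lies in J(G), and has an itinerary that keeps it
    there; iteration along it expands small discs to a fixed size, so that s
    belongs to the corresponding fibre Julia set ([jorbit_fiber]). Edges
    pull fibre Julia sets back, and compositions of edges shrink, so the
    limit set is in J(f~) ([limit_set_julia]). Conversely, J(G) is perfect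
    ([julia_perfect]), hence the orbit of a transitive point of U returns to
    U infinitely often, and its successive returns are edges whose
    compositions shrink to the point ([trans_limit_set]).

    Primitivity. Backward orbits of any point of J(G) accumulate on all of
    J(G) ([julia_transitive]), and cutting such an orbit at its visits to U
    gives a chain of edges between any two vertices ([edges_irreducible]).
    For words of one common length it is enough to find a hub: a vertex c
    with an edge to every vertex, itself included, for loops at c then
    adjust the lengths ([edges_finitely_primitive]). In terms of orbits, a
    hub is a vertex c from whose r-neighbourhood every vertex can be reached
    without entering the kappa r-neighbourhood of S on the way. If Crit_* is
    not empty, each of its points c is a hub ([hub_critical]): the orbit of
    c lies in the postcritical set, far from S, and is shadowed until a disc
    at c has grown to a fixed size, from where a vertex is reached at a
    definite distance from S because S is aperiodic ([reach_targets]). If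
    Crit_* is empty, every vertex is a hub ([hub_expanding]): the iterates
    have bounded distortion along orbits in J(G) ([bounded_distortion]),
    J(G) is uniformly perfect ([uniformly_perfect]), and an orbit about to
    come too close to a vertex is diverted, at ever larger scales.

    Tools. The choice of R_* makes preimages of discs around J(G) shrink
    exponentially. This yields shadowing: a point near the end of an orbit
    in J(G) is the end of an orbit close to it ([tracking]). Rational maps
    are handled in charts as quotients of polynomials, whose divided
    differences ([rational_local_form]) control critical points, local
    injectivity and distortion; compactness of the sphere makes all radii
    uniform ([uniform_radius]). Branches of inverses are lifted along
    segments in finitely many steps ([branch_exists]), and an estimate for
    maps omitting a disc takes the place of Montel's theorem
    ([fword_omit_lip]). *)

(** * The modulus and the metric of the sphere *)

Section ComplexModulus.
Context {R : realType}.
Implicit Types z w : R[i].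

Lemma cmod_ge0 z : 0 <= cmod z.
Proof. by case: z => a b; exact: sqrtr_ge0. Qed.

Lemma cmod0 : cmod (0 : R[i]) = 0.
Proof. exact: ComplexField.Normc.normc0. Qed.

Lemma cmod_eq0 z : (cmod z == 0) = (z == 0).
Proof.
apply/eqP/eqP => [|->]; last exact: cmod0.
exact: ComplexField.Normc.eq0_normc.
Qed.

Lemma cmod_gt0 z : (0 < cmod z) = (z != 0).
Proof. by rewrite lt_def cmod_ge0 andbT cmod_eq0. Qed.

Lemma cmodM z w : cmod (z * w) = cmod z * cmod w.
Proof. exact: ComplexField.Normc.normcM. Qed.

Lemma cmodV z : cmod z^-1 = (cmod z)^-1.
Proof. exact: ComplexField.Normc.normcV. Qed.

Lemma cmodN z : cmod (- z) = cmod z.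
Proof. exact: normcN. Qed.

Lemma cmodB z w : cmod (z - w) = cmod (w - z).
Proof. by rewrite -cmodN opprB. Qed.

Lemma cmodD z w : cmod (z + w) <= cmod z + cmod w.
Proof. exact: le_normcD. Qed.

Lemma cmod_triangle v z w : cmod (z - w) <= cmod (z - v) + cmod (v - w).
Proof. by rewrite -[z - w](subrKA v) cmodD. Qed.

Lemma cmod_lowerB z w : cmod z - cmod w <= cmod (z - w).
Proof. by rewrite lerBlDr -[X in cmod X <= _](subrK w z) cmodD. Qed.

Lemma cmodR (a : R) : cmod (a%:C)%C = `|a|.
Proof. by rewrite /cmod /= expr0n /= addr0 sqrtr_sqr. Qed.

Lemma cmod_sqr z : cmod z ^+ 2 = complex.Re z ^+ 2 + complex.Im z ^+ 2.
Proof. by case: z => a b; rewrite /cmod /= sqr_sqrtr // addr_ge0 ?sqr_ge0. Qed.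

Lemma ReB z w : complex.Re (z - w) = complex.Re z - complex.Re w.
Proof. by case: z w => [a b] [c d]. Qed.

Lemma ImB z w : complex.Im (z - w) = complex.Im z - complex.Im w.
Proof. by case: z w => [a b] [c d]. Qed.

Lemma B2_center z (r : R) : 0 < r -> B2 z r z.
Proof. by rewrite /B2 /= subrr cmod0. Qed.

Lemma cmod_norm z : `|z| = (cmod z)%:C%C.
Proof. by rewrite normc_def; case: z. Qed.

(** The norm of the complex line takes complex values, so the radii in its
    topology are complex numbers; real radii suffice. *)
Lemma nbhs_cmodP (z : R[i]^o) (A : set R[i]) :
  nbhs z A <-> exists2 e : R, 0 < e & forall w, cmod (w - z) < e -> A w.
Proof.
split=> [/nbhs_ballP[e /= e0 eA]|[e e0 eA]].
  have [eR e0'] : (e = (complex.Re e)%:C%C) /\ 0 < complex.Re e.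
    by move: e0; case: (e) => a b; rewrite ltcE /= => /andP[/eqP -> ->].
  exists (complex.Re e) => // w ze; apply: eA; rewrite /ball /= cmod_norm eR.
  by rewrite cmodB ltcR.
apply/nbhs_ballP; exists (e%:C)%C; first by rewrite /= ltcR.
by move=> w; rewrite /ball /= cmod_norm ltcR cmodB => /eA.
Qed.

End ComplexModulus.

Section SphereMetric.
Context {R : realType}.
Local Notation C := R[i].
Local Notation Chat := (sphere R).

(** The distance whose balls are those of the sphere. *)
Definition sdst (x y : Chat) : R := `|stereo x - stereo y|.

Lemma sdst_ge0 x y : 0 <= sdst x y. Proof. exact: normr_ge0. Qed.
Lemma sdstC x y : sdst x y = sdst y x. Proof. exact: distrC. Qed.
Lemma sdstxx x : sdst x x = 0. Proof. by rewrite /sdst subrr normr0. Qed.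
Lemma sdst_triangle y x z : sdst x z <= sdst x y + sdst y z.
Proof. exact: ler_distD. Qed.

Lemma sball_def (x : Chat) (e : R) y : ball x e y <-> sdst x y < e.
Proof. by rewrite -[ball x e y]/(ball (stereo x) e (stereo y)) -ball_normE. Qed.

Lemma snbhsP (x : Chat) (A : set Chat) :
  nbhs x A <-> exists2 e : R, 0 < e & forall y, sdst x y < e -> A y.
Proof.
split=> [/nbhs_ballP[e /= e0 eA]|[e e0 eA]].
  by exists e => // y /sball_def/eA.
by apply/nbhs_ballP; exists e => //= y /sball_def/eA.
Qed.

Lemma sdst_lt x y (e : R) : sdst x y < e <->
  [/\ `|(stereo x).1.1 - (stereo y).1.1| < e,
      `|(stereo x).1.2 - (stereo y).1.2| < e &
      `|(stereo x).2 - (stereo y).2| < e].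
Proof.
rewrite /sdst !prod_normE /=.
by split=> [|[a b c]]; rewrite ?gt_max ?a ?b ?c // => /andP[/andP[-> ->] ->].
Qed.

(** The formula for the chordal distance; the estimates for the sup distance
    are read off from it. *)
Lemma stereo_chord (z w : C) :
  ((stereo (Some z)).1.1 - (stereo (Some w)).1.1) ^+ 2 +
  ((stereo (Some z)).1.2 - (stereo (Some w)).1.2) ^+ 2 +
  ((stereo (Some z)).2 - (stereo (Some w)).2) ^+ 2 =
  4 * cmod (z - w) ^+ 2 / ((cmod z ^+ 2 + 1) * (cmod w ^+ 2 + 1)).
Proof.
have := sqr_ge0 (cmod z); have := sqr_ge0 (cmod w).
rewrite /= !cmod_sqr ReB ImB; case: z => a b; case: w => c d /= h1 h2.
by field; apply/andP; split; apply: lt0r_neq0; lra.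
Qed.

Lemma ler_norm_sqr (x d : R) : 0 <= d -> x ^+ 2 <= d ^+ 2 -> `|x| <= d.
Proof. by move=> d0; rewrite -(real_normK (num_real x)) ler_pXn2r ?nnegrE. Qed.

Lemma sdst_le x y (e : R) : sdst x y <= e <->
  [/\ `|(stereo x).1.1 - (stereo y).1.1| <= e,
      `|(stereo x).1.2 - (stereo y).1.2| <= e &
      `|(stereo x).2 - (stereo y).2| <= e].
Proof.
rewrite /sdst !prod_normE /=.
by split=> [|[a b c]]; rewrite ?ge_max ?a ?b ?c // => /andP[/andP[-> ->] ->].
Qed.

Lemma sdst_le_cmod z w : sdst (Some z) (Some w) <= 2 * cmod (z - w).
Proof.
have h0 := cmod_ge0 (z - w).
have key : 4 * cmod (z - w) ^+ 2 / ((cmod z ^+ 2 + 1) * (cmod w ^+ 2 + 1))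
    <= (2 * cmod (z - w)) ^+ 2.
  have h1 := sqr_ge0 (cmod z); have h2 := sqr_ge0 (cmod w).
  have h3 := mulr_ge0 h1 h2; have h4 := sqr_ge0 (cmod (z - w)).
  rewrite ler_pdivrMr; last by nra.
  rewrite exprMn -natrX -[leLHS]mulr1 ler_wpM2l //; first by rewrite mulr_ge0.
  nra.
rewrite -stereo_chord in key.
have s1 := sqr_ge0 ((stereo (Some z)).1.1 - (stereo (Some w)).1.1).
have s2 := sqr_ge0 ((stereo (Some z)).1.2 - (stereo (Some w)).1.2).
have s3 := sqr_ge0 ((stereo (Some z)).2 - (stereo (Some w)).2).
by apply/sdst_le; split; apply: ler_norm_sqr; lra.
Qed.

(** Away from infinity the spherical distance controls the Euclidean one: a
    point close to [Some z] cannot have a third coordinate close to 1, and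
    then the chordal formula applies. *)
Lemma sdst_near (A e : R) (z : C) x : cmod z <= A -> e <= (A ^+ 2 + 1)^-1 ->
  sdst (Some z) x < e ->
  exists2 w, x = Some w & cmod (w - z) <= 2 * (A ^+ 2 + 1) * e.
Proof.
move=> zA eA /sdst_lt[d1 d2 d3].
have e0 : 0 < e by exact: le_lt_trans d1.
have z0 := cmod_ge0 z.
have A0 : 0 <= A by lra.
have A1 : 0 < A ^+ 2 + 1 by nra.
have nA : cmod z ^+ 2 + 1 <= A ^+ 2 + 1 by nra.
have n0 : 0 < cmod z ^+ 2 + 1 by nra.
have eN : e * (cmod z ^+ 2 + 1) <= 1.
  by rewrite -ler_pdivlMr // mul1r (le_trans eA) // lef_pV2 ?posrE.
case: x d1 d2 d3 => [w|] d1 d2 d3; last first.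
  exfalso; move: d3 => /=.
  have -> : (cmod z ^+ 2 - 1) / (cmod z ^+ 2 + 1) - 1 = - (2 / (cmod z ^+ 2 + 1)).
    by field; apply: lt0r_neq0.
  rewrite normrN gtr0_norm ?divr_gt0 // ltr_pdivrMr //; lra.
exists w => //.
have m0 : 0 < cmod w ^+ 2 + 1 by have := sqr_ge0 (cmod w); lra.
have mn : cmod w ^+ 2 + 1 <= 2 * (cmod z ^+ 2 + 1).
  move: d3 => /=.
  have -> : (cmod z ^+ 2 - 1) / (cmod z ^+ 2 + 1) - (cmod w ^+ 2 - 1) / (cmod w ^+ 2 + 1)
     = 2 * ((cmod w ^+ 2 + 1)^-1 - (cmod z ^+ 2 + 1)^-1).
    by field; rewrite !lt0r_neq0.
  rewrite ltr_norml => /andP[d3 _].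
  have eN' : e <= (cmod z ^+ 2 + 1)^-1 by rewrite -[leRHS]mul1r ler_pdivlMr.
  have : (2 * (cmod z ^+ 2 + 1))^-1 <= (cmod w ^+ 2 + 1)^-1.
    rewrite invfM; lra.
  by rewrite lef_pV2 ?posrE // mulr_gt0.
have sq (t : R) : `|t| < e -> t ^+ 2 <= e ^+ 2.
  move=> te; rewrite -(real_normK (num_real t)).
  by rewrite ler_pXn2r ?nnegrE // ltW.
have := stereo_chord z w.
have := sq _ d1; have := sq _ d2; have := sq _ d3.
rewrite cmodB; set N := cmod z ^+ 2 + 1 in nA n0 mn *; set M := cmod w ^+ 2 + 1 in mn m0 *.
move=> h3 h2 h1 h.
have h' : 4 * cmod (w - z) ^+ 2 <= 3 * e ^+ 2 * (N * M).
  by rewrite -ler_pdivrMr ?mulr_gt0 // -h; lra.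
rewrite -(@ler_pXn2r _ 2) ?nnegrE ?cmod_ge0 //; last by rewrite !mulr_ge0 // ltW.
have NM : N * M <= 2 * (A ^+ 2 + 1) ^+ 2.
  apply: (@le_trans _ _ (N * (2 * N))); first by rewrite ler_wpM2l // ltW.
  by rewrite mulrCA ler_wpM2l // -expr2 ler_pXn2r ?nnegrE // ltW.
have : 3 * e ^+ 2 * (N * M) <= 3 * e ^+ 2 * (2 * (A ^+ 2 + 1) ^+ 2).
  by rewrite ler_wpM2l // mulr_ge0 // sqr_ge0.
rewrite !exprMn; have := mulr_ge0 (sqr_ge0 e) (sqr_ge0 (A ^+ 2 + 1)); lra.
Qed.

Lemma sdst_eq0 x y : sdst x y = 0 -> x = y.
Proof.
have fin0 (z : C) t : sdst (Some z) t = 0 -> Some z = t.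
  move=> d0.
  have A1 : 0 < cmod z ^+ 2 + 1 by rewrite ltr_wpDl // sqr_ge0.
  have near_t e : 0 < e -> e <= (cmod z ^+ 2 + 1)^-1 ->
      exists2 w, t = Some w & cmod (w - z) <= 2 * (cmod z ^+ 2 + 1) * e.
    by move=> e0 eA; apply: sdst_near => //; rewrite d0.
  have [||w tw _] := near_t (cmod z ^+ 2 + 1)^-1; rewrite ?invr_gt0 ?lexx //.
  rewrite tw; congr Some; apply/eqP; rewrite eq_sym -subr_eq0 -cmod_eq0.
  rewrite eq_le cmod_ge0 andbT; apply/ler_addgt0Pr => e e0; rewrite add0r.
  have [||w'] := near_t (Num.min (cmod z ^+ 2 + 1)^-1 (e / (2 * (cmod z ^+ 2 + 1)))).
  - by rewrite lt_min invr_gt0 A1 divr_gt0 // mulr_gt0.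
  - by rewrite ge_min lexx.
  rewrite tw => -[<-] /le_trans; apply.
  by rewrite mulrC -ler_pdivlMr ?mulr_gt0 // ge_min lexx orbT.
case: x y => [z|] [w|] //; do ?exact: fin0.
by rewrite sdstC => /fin0.
Qed.

Lemma sinvK : involutive (@sinv R).
Proof.
case=> [z|] /=; last by rewrite eqxx.
by case: ifPn => [/eqP -> //|z0] /=; rewrite invr_eq0 (negbTE z0) invrK.
Qed.

(** Inversion is a half-turn of the sphere, so that it is an isometry and
    the point at infinity needs no separate treatment. *)
Lemma stereo_sinv (x : Chat) :
  stereo (sinv x) = ((stereo x).1.1, - (stereo x).1.2, - (stereo x).2).
Proof.
have stereo0 : stereo (Some 0 : Chat) = (0, 0, -1).
  by rewrite /stereo cmod0 /= expr0n /= add0r mulr0 mul0r sub0r divr1.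
case: x => [z|]; last by rewrite [sinv _]/= stereo0 /= oppr0.
rewrite /sinv; case: ifPn => [/eqP ->|z0]; first by rewrite stereo0 /= oppr0 opprK.
have c0 : cmod z != 0 by rewrite cmod_eq0.
rewrite /stereo cmodV; have := cmod_sqr z.
have [-> ->] : complex.Re z^-1 = complex.Re z / cmod z ^+ 2 /\
               complex.Im z^-1 = - complex.Im z / cmod z ^+ 2.
  by rewrite cmod_sqr; case: (z) => a b /=; rewrite mulNr.
move=> _ /=; move: (complex.Re z) (complex.Im z) (cmod z) c0 => a b n n0.
have n20 : n ^+ 2 + 1 != 0 by rewrite lt0r_neq0 // ltr_wpDl // sqr_ge0.
congr (_, _, _); field; rewrite ?n0 ?n20 //=.
Qed.

Lemma sdst_sinv x y : sdst (sinv x) (sinv y) = sdst x y.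
Proof.
by rewrite /sdst !prod_normE /= !stereo_sinv /= -!opprD !normrN.
Qed.

End SphereMetric.

(** * Compactness of the sphere *)

Section SphereCompact.
Context {R : realType}.
Local Notation C := R[i].
Local Notation Chat := (sphere R).

Lemma stereo_unit (x : Chat) :
  (stereo x).1.1 ^+ 2 + (stereo x).1.2 ^+ 2 + (stereo x).2 ^+ 2 = 1.
Proof.
case: x => [z|] /=; last by rewrite expr0n expr1n /= !add0r.
have n20 : cmod z ^+ 2 + 1 != 0 by rewrite lt0r_neq0 // ltr_wpDl // sqr_ge0.
have -> : (2 * complex.Re z / (cmod z ^+ 2 + 1)) ^+ 2 +
  (2 * complex.Im z / (cmod z ^+ 2 + 1)) ^+ 2 =
  4 * cmod z ^+ 2 / (cmod z ^+ 2 + 1) ^+ 2.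
  by rewrite {3}cmod_sqr; field.
by field.
Qed.

Lemma stereo_surj (p : R * R * R) :
  p.1.1 ^+ 2 + p.1.2 ^+ 2 + p.2 ^+ 2 = 1 -> exists x : Chat, stereo x = p.
Proof.
case: p => -[a b] c /= abc; have [c1|c1] := eqVneq c 1.
  have /eqP : a ^+ 2 + b ^+ 2 = 0 by move: abc; rewrite c1 expr1n; lra.
  rewrite paddr_eq0 ?sqr_ge0 // !sqrf_eq0 => /andP[/eqP -> /eqP ->].
  by exists None; rewrite c1.
have c10 : 1 - c != 0 by rewrite subr_eq0 eq_sym.
exists (Some (a / (1 - c) +i* (b / (1 - c)))%C).
have n2 : cmod (a / (1 - c) +i* (b / (1 - c)))%C ^+ 2 = (1 + c) / (1 - c).
  rewrite cmod_sqr /= !expr_div_n -mulrDl.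
  have -> : a ^+ 2 + b ^+ 2 = (1 - c) * (1 + c) by move: abc; lra.
  by field.
rewrite /stereo n2 /=.
have d : (1 + c) / (1 - c) + 1 = 2 / (1 - c) by field.
by rewrite d; congr (_, _, _); field.
Qed.

Lemma compact_sphere : compact [set: Chat].
Proof.
pose S := [set p : R * R * R | p.1.1 ^+ 2 + p.1.2 ^+ 2 + p.2 ^+ 2 = 1].
have cS : compact S.
  pose I := `[(-1 : R), 1]%classic.
  apply: (@subclosed_compact _ _ (I `*` I `*` I)).
  - have -> : S = (fun p : R * R * R => p.1.1 ^+ 2 + p.1.2 ^+ 2 + p.2 ^+ 2) @^-1` [set 1].
      by [].
    apply: closed_comp; last exact: closed_eq.
    have sqc (g : R * R * R -> R) (p : R * R * R) :
        g x @[x --> p] --> g p -> (g x ^+ 2) @[x --> p] --> (g p) ^+ 2.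
      by move=> gc; exact: (cvg_comp g (fun t : R => t ^+ 2) gc (@exprn_continuous _ 2 (g p))).
    move=> p _.
    have c1 := sqc (fun p => p.1.1) p (cvg_comp _ _ cvg_fst cvg_fst).
    have c2 := sqc (fun p => p.1.2) p (cvg_comp _ _ cvg_fst cvg_snd).
    have c3 := sqc (fun p => p.2) p cvg_snd.
    exact: (cvgD (cvgD (c1 _ _) (c2 _ _)) (c3 _)).
  - by do 2?apply: compact_setX; exact: segment_compact.
  - move=> -[[a b] c]; rewrite /S /= => abc.
    have aux (t : R) : t ^+ 2 <= 1 -> I t.
      move=> t1; rewrite /I /= in_itv /=; nra.
    by have := sqr_ge0 a; have := sqr_ge0 b; have := sqr_ge0 c;
       split; [split|]; apply: aux; lra.
move=> F PF _; have [|p [Sp clp]] := cS (@stereo R @ F) _.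
  by rewrite nbhs_filterE /fmap /=; apply: filterS filterT => x _; exact: stereo_unit.
have [x xp] := stereo_surj Sp; exists x; split => // A B FA Bx.
have [e e0 eB] := (snbhsP x B).1 Bx.
have [_ [[y Ay <-] ypx]] : (@stereo R @` A) `&` ball p e !=set0.
  apply: clp; last exact: nbhsx_ballx.
  by rewrite nbhs_filterE /fmap /=; apply: filterS FA => y Ay; exists y.
by exists y; split => //; apply/eB/sball_def; rewrite -[ball x e y]/(ball (stereo x) e (stereo y)) xp.
Qed.

(** The form in which compactness is mostly used: as smaller radii are also
    good, finitely many local choices leave a positive one. *)
Lemma uniform_radius (K : set Chat) (P : R -> Chat -> Prop) : closed K ->
  (forall e e' x, e' <= e -> P e x -> P e' x) ->
  (forall x, K x -> exists d e : R,
     [/\ 0 < d, 0 < e & forall y, K y -> sdst x y < d -> P e y]) ->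
  exists2 e : R, 0 < e & forall x, K x -> P e x.
Proof.
move=> cK mono loc.
have /compact_near_coveringP/near_covering_withinP cov : compact K.
  exact: (subclosed_compact cK compact_sphere (@subsetT _ K)).
have := cov R 0^'+ (fun e x => P e x) _ => /(_ _)[].
  move=> x Kx; have [d [e [d0 e0 H]]] := loc x Kx.
  exists ([set y | sdst x y < d], [set e' | e' <= e]) => /=; last first.
    by case=> y e' /= [xy e'e] Ky; exact: (mono e e' y e'e (H y Ky xy)).
  split; first by apply/snbhsP; exists d.
  exact: nbhs_right_le.
move=> e0 /= e00 H; exists (e0 / 2); first by rewrite divr_gt0.
apply: H => /=; last by rewrite divr_gt0.
by rewrite sub0r normrN gtr0_norm ?divr_gt0 //; lra.
Qed.

End SphereCompact.

(** * Quotients of polynomials *)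

Section PolynomialEstimates.
Context {R : realType}.
Local Notation C := R[i].
Implicit Types (P Q : {poly C}).

(** Between z0 and z1 a linear factor z - r grows at most by the factor 1 +
    |z1 - z0| / e when its root r is at distance at least e from z0. This
    makes the openness of rational maps quantitative. *)
Lemma root_distance_bound (p : {poly C}) (z0 z1 : C) (e : R) : 0 < e ->
  (forall r, root p r -> e <= cmod (r - z0)) ->
  cmod p.[z1] <= (1 + cmod (z1 - z0) / e) ^+ (size p).-1 * cmod p.[z0].
Proof.
move=> e0; have [-> _|pn0] := eqVneq p 0; first by rewrite !horner0 cmod0 mulr0.
have [s ps] := closed_field_poly_normal p.
move=> far; have sp : (size p).-1 = size s.
  rewrite ps size_scale ?lead_coef_eq0 // size_prod_XsubC //.
have rts r : r \in s -> e <= cmod (r - z0).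
  move=> rs; apply: far; rewrite ps rootZ ?lead_coef_eq0 //.
  by rewrite root_prod_XsubC.
rewrite sp ps !hornerZ !cmodM mulrCA ler_wpM2l ?cmod_ge0 //.
elim: s rts {ps sp} => [_|r s IH rts].
  by rewrite !big_nil !hornerC expr0 mul1r.
rewrite !big_cons !hornerM !cmodM exprS !hornerXsubC mulrACA.
apply: ler_pM; rewrite ?cmod_ge0 //; last first.
  by apply: IH => t ts; apply: rts; rewrite inE ts orbT.
have er : e <= cmod (z0 - r) by rewrite cmodB rts // mem_head.
rewrite mulrDl mul1r (le_trans (cmod_triangle z0 _ _)) // addrC lerD2l.
by rewrite mulrAC ler_pdivlMr // ler_wpM2l // cmod_ge0.
Qed.

Lemma poly_nonroot (p : {poly C}) : p != 0 -> exists z, p.[z] != 0.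
Proof.
move=> p0; apply: contrapT => none.
have /(max_poly_roots p0) : all (root p) [seq i%:R | i <- iota 0 (size p)].
  apply/allP => x _; apply/rootP; apply: contrapT => px.
  by apply: none; exists x; apply/eqP.
rewrite map_inj_uniq ?iota_uniq ?size_map ?size_iota ?ltnn; first by move/(_ isT).
by move=> i j /eqP; rewrite eqr_nat => /eqP.
Qed.

(** The divided difference of a polynomial. As a function of two variables
    it expresses injectivity and distortion directly, which the derivative
    does not. *)
Lemma poly_dq (p : {poly C}) : exists D : C -> C -> C,
  [/\ forall z w, p.[z] - p.[w] = (z - w) * D z w,
      forall z w, D z w = D w z &
      forall A : R, exists2 K : R, 0 <= K & forall z w w',
        cmod z <= A -> cmod w <= A -> cmod w' <= A ->
        cmod (D z w) <= K /\ cmod (D z w - D z w') <= K * cmod (w - w')].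
Proof.
suff [D [HD HL]] : exists D : C -> C -> C,
  (forall z w, p.[z] - p.[w] = (z - w) * D z w) /\
  (forall A : R, exists2 K : R, 0 <= K & forall z w w',
     cmod z <= A -> cmod w <= A -> cmod w' <= A ->
     cmod (D z w) <= K /\ cmod (D z w - D z w') <= K * cmod (w - w')).
  exists D; split => // z w; have [-> //|zw] := eqVneq z w.
  have zw0 : z - w != 0 by rewrite subr_eq0.
  apply: (mulfI zw0); rewrite -HD -[z - w]opprB mulNr -HD opprB //.
elim/poly_ind: p => [|p c [D [HD HL]]].
  exists (fun _ _ => 0); split => [z w|A]; first by rewrite !horner0 subrr mulr0.
  by exists 0 => // z w w' *; rewrite subr0 cmod0 mul0r.
exists (fun z w => p.[z] + w * D z w); split => [z w|A].
  rewrite !hornerMXaddC opprD addrACA subrr addr0.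
  have -> : p.[w] = p.[z] - (z - w) * D z w by rewrite -HD; ring.
  by ring.
have [K K0 HK] := HL A; have K1 : 0 <= 1 + `|A| by rewrite addr_ge0.
exists (cmod p.[0] + K * `|A| + `|A| * K + K) => [|z w w' zA wA w'A].
  by rewrite !addr_ge0 ?cmod_ge0 ?mulr_ge0.
have A0 : 0 <= A by exact: le_trans (cmod_ge0 z) zA.
have [Dzw dD] := HK z w w' zA wA w'A.
have [Dzw' _] := HK z w' w' zA w'A w'A.
have A00 : cmod 0 <= A by rewrite cmod0.
have [Dz0 _] := HK z 0 0 zA A00 A00; rewrite ger0_norm //; split.
  have -> : p.[z] = p.[0] + z * D z 0 by rewrite -{2}[z]subr0 -HD; ring.
  apply: (le_trans (cmodD _ _)).
  apply: (@le_trans _ _ (cmod p.[0] + K * A + A * K)); last by rewrite lerDl.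
  apply: lerD; last by rewrite cmodM ler_pM ?cmod_ge0.
  apply: (le_trans (cmodD _ _)); rewrite lerD2l cmodM mulrC.
  by rewrite ler_pM ?cmod_ge0.
have -> : p.[z] + w * D z w - (p.[z] + w' * D z w') =
   w * (D z w - D z w') + (w - w') * D z w' by ring.
apply: (le_trans (cmodD _ _)); rewrite !cmodM.
apply: (@le_trans _ _ (A * (K * cmod (w - w')) + K * cmod (w - w'))).
  apply: lerD; first by rewrite ler_pM ?cmod_ge0.
  by rewrite mulrC ler_wpM2r ?cmod_ge0.
rewrite mulrA -mulrDl ler_wpM2r ?cmod_ge0 //.
by rewrite lerD2r lerDr addr_ge0 ?cmod_ge0 ?mulr_ge0.
Qed.

End PolynomialEstimates.

Section LocallyLipschitz.
Context {R : realType}.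
Local Notation C := R[i].
Implicit Types (P Q : {poly C}) (g h : C -> C -> C).

(** The regularity of divided differences that survives products and
    quotients. Divided differences being symmetric, the second variable is
    enough. *)
Definition loclip (x : C) g := exists e K : R, [/\ 0 < e, 0 <= K &
  forall z w w', cmod (z - x) < e -> cmod (w - x) < e -> cmod (w' - x) < e ->
    cmod (g z w) <= K /\ cmod (g z w - g z w') <= K * cmod (w - w')].

Lemma loclipM x g h : loclip x g -> loclip x h -> loclip x (fun z w => g z w * h z w).
Proof.
move=> [e [K [e0 K0 gK]]] [e' [L [e'0 L0 hL]]].
exists (Num.min e e'), (K * L + K * L); split => [||z w w'].
- by rewrite lt_min e0.
- by rewrite addr_ge0 ?mulr_ge0.
rewrite !lt_min => /andP[z1 z2] /andP[w1 w2] /andP[w'1 w'2].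
have [a1 a2] := gK _ _ _ z1 w1 w'1; have [b1 b2] := hL _ _ _ z2 w2 w'2.
have [b3 _] := hL _ _ _ z2 w'2 w2; split.
  rewrite cmodM (@le_trans _ _ (K * L)) ?ler_pM ?cmod_ge0 //.
  by rewrite lerDl mulr_ge0.
have -> : g z w * h z w - g z w' * h z w' =
  g z w * (h z w - h z w') + (g z w - g z w') * h z w' by ring.
rewrite (le_trans (cmodD _ _)) // !cmodM mulrDl; apply: lerD.
  by rewrite -mulrA ler_pM ?cmod_ge0.
by rewrite mulrAC ler_pM ?cmod_ge0 // .
Qed.

Lemma loclipB x g h : loclip x g -> loclip x h -> loclip x (fun z w => g z w - h z w).
Proof.
move=> [e [K [e0 K0 gK]]] [e' [L [e'0 L0 hL]]].
exists (Num.min e e'), (K + L); split => [||z w w'].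
- by rewrite lt_min e0.
- by rewrite addr_ge0.
rewrite !lt_min => /andP[z1 z2] /andP[w1 w2] /andP[w'1 w'2].
have [a1 a2] := gK _ _ _ z1 w1 w'1; have [b1 b2] := hL _ _ _ z2 w2 w'2; split.
  by rewrite (le_trans (cmodD _ _)) // cmodN lerD.
have -> : g z w - h z w - (g z w' - h z w') =
  (g z w - g z w') + - (h z w - h z w') by ring.
by rewrite (le_trans (cmodD _ _)) // cmodN mulrDl lerD.
Qed.

Lemma loclip_dq x g : (forall A : R, exists2 K : R, 0 <= K & forall z w w',
   cmod z <= A -> cmod w <= A -> cmod w' <= A ->
   cmod (g z w) <= K /\ cmod (g z w - g z w') <= K * cmod (w - w')) ->
  loclip x g.
Proof.
move=> /(_ (cmod x + 1))[K K0 gK]; exists 1, K; split => // z w w' zx wx w'x.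
have bd t : cmod (t - x) < 1 -> cmod t <= cmod x + 1.
  by move=> tx; have := cmod_lowerB t x; lra.
by apply: gK; exact: bd.
Qed.

Lemma loclip_poly x P : loclip x (fun _ w => P.[w]).
Proof.
have [D [PD _ DK]] := poly_dq P; have [e [K [e0 K0 H]]] := loclip_dq x DK.
exists (Num.min e 1), (cmod P.[x] + K); split => [||z w w'].
- by rewrite lt_min e0 ltr01.
- by rewrite addr_ge0 ?cmod_ge0.
rewrite !lt_min => /andP[z1 z2] /andP[w1 w2] /andP[w'1 w'2].
have xx : cmod (x - x) < e by rewrite subrr cmod0.
split.
  have -> : P.[w] = P.[x] + (w - x) * D w x by rewrite -PD; ring.
  rewrite (le_trans (cmodD _ _)) // lerD2l cmodM -[leRHS]mul1r.
  by rewrite ler_pM ?cmod_ge0 ?(ltW w2) //; have [] := H w x x w1 xx xx.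
rewrite PD cmodM mulrC ler_wpM2r ?cmod_ge0 //.
have [/le_trans -> //] := H w w' w' w1 w'1 w'1.
by rewrite lerDr cmod_ge0.
Qed.

Lemma loclipV x P : P.[x] != 0 ->
  loclip x (fun _ w => (P.[w])^-1) /\
  exists2 e : R, 0 < e & forall w, cmod (w - x) < e -> P.[w] != 0.
Proof.
rewrite -cmod_gt0 => Px; have [e [K [e0 K0 H]]] := loclip_poly x P.
have xx : cmod (x - x) < e by rewrite subrr cmod0.
pose m := cmod P.[x] / 2; have m0 : 0 < m by rewrite divr_gt0.
pose d := Num.min e (m / (K + 1)); have K1 : 0 < K + 1 by lra.
have d0 : 0 < d by rewrite lt_min e0 divr_gt0.
have low w : cmod (w - x) < d -> m <= cmod P.[w].
  rewrite lt_min ltr_pdivlMr // => /andP[we wm].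
  have [_ ] := H x x w xx xx we; rewrite [cmod (x - w)]cmodB => Pw.
  have := cmod_lowerB P.[x] P.[w]; have := cmod_ge0 (w - x); rewrite /m in wm *; nra.
have nz w : cmod (w - x) < d -> P.[w] != 0.
  by move=> /low wm; rewrite -cmod_gt0 (lt_le_trans m0).
split; last by exists d.
exists d, (m^-1 + K / m ^+ 2); split => // [|z w w' zd wd w'd].
  by rewrite addr_ge0 ?divr_ge0 ?invr_ge0 ?exprn_ge0 // ltW.
have iw t : cmod (t - x) < d -> cmod P.[t]^-1 <= m^-1.
  by move=> td; rewrite cmodV lef_pV2 ?posrE ?low // cmod_gt0 nz.
split.
  by rewrite (le_trans (iw _ wd)) // lerDl divr_ge0 ?exprn_ge0 // ltW.
have -> : P.[w]^-1 - P.[w']^-1 = (P.[w'] - P.[w]) * (P.[w]^-1 * P.[w']^-1).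
  by field; rewrite !nz.
rewrite 2!cmodM mulrDl; apply: ler_wpDl.
  by rewrite mulr_ge0 ?cmod_ge0 ?invr_ge0 // ltW.
have lt_e t : cmod (t - x) < d -> cmod (t - x) < e.
  by rewrite lt_min => /andP[].
rewrite [K / _ * _]mulrAC cmodB; apply: ler_pM; rewrite ?mulr_ge0 ?cmod_ge0 //.
  by have [] := H x w w' xx (lt_e _ wd) (lt_e _ w'd).
by rewrite expr2 invfM ler_pM ?cmod_ge0 ?iw.
Qed.

Lemma loclip_fst x (h : C -> C) : loclip x (fun _ w => h w) -> loclip x (fun z _ => h z).
Proof.
move=> [e [K [e0 K0 H]]]; exists e, K; split => // z w w' zx wx w'x.
by rewrite subrr cmod0 mulr_ge0 ?cmod_ge0 //; have [-> _] := H z z z zx zx zx.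
Qed.

(** The quotient rule for divided differences. *)
Lemma ratio_dq P Q : exists T : C -> C -> C,
  [/\ forall z w, Q.[z] != 0 -> Q.[w] != 0 ->
        P.[z] / Q.[z] - P.[w] / Q.[w] = (z - w) * T z w,
      forall z w, Q.[z] != 0 -> Q.[w] != 0 -> T z w = T w z &
      forall x, Q.[x] != 0 -> loclip x T].
Proof.
have [D [PD _ DL]] := poly_dq P; have [E [QE _ EL]] := poly_dq Q.
pose T z w := (D z w * Q.[w] - P.[w] * E z w) * (Q.[z]^-1 * Q.[w]^-1).
have TD z w : Q.[z] != 0 -> Q.[w] != 0 ->
    P.[z] / Q.[z] - P.[w] / Q.[w] = (z - w) * T z w.
  move=> Qz Qw.
  have -> : (z - w) * T z w = (((z - w) * D z w) * Q.[w] - P.[w] * ((z - w) * E z w))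
     * (Q.[z]^-1 * Q.[w]^-1) by rewrite /T; ring.
  by rewrite -PD -QE; field; rewrite Qz Qw.
exists T; split => // [z w Qz Qw|x Qx].
  have [-> //|zw] := eqVneq z w.
  have zw0 : z - w != 0 by rewrite subr_eq0.
  by apply: (mulfI zw0); rewrite -TD // -[z - w]opprB mulNr -TD // opprB.
have [VQ _] := loclipV Qx.
apply: loclipM; last by apply: loclipM => //; exact: loclip_fst.
apply: loclipB; apply: loclipM; do ?exact: loclip_dq; exact: loclip_poly.
Qed.

(** Were all solutions of P = v Q far from z0, then P - v Q, which is small
    at z0 for v close to the value at z0, would be small everywhere by
    [root_distance_bound]. *)
Lemma ratio_open P Q (z0 : C) (e : R) : Q.[z0] != 0 -> 0 < e ->
  P - (P.[z0] / Q.[z0])%:P * Q != 0 ->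
  exists2 d : R, 0 < d & forall v, cmod (v - P.[z0] / Q.[z0]) < d ->
    exists z, [/\ cmod (z - z0) < e, Q.[z] != 0 & P.[z] / Q.[z] = v].
Proof.
move=> Qz0; set v0 := P.[z0] / Q.[z0] => e0 nz.
have [_ [e' e'0 Qnz]] := loclipV Qz0.
pose r := Num.min e e'; have r0 : 0 < r by rewrite lt_min e0.
have [z1] := poly_nonroot nz; rewrite !hornerE -cmod_gt0 => nz1.
pose n := (maxn (size P) (size Q)).
pose M := (1 + cmod (z1 - z0) / r) ^+ n.
have M1 : 1 <= 1 + cmod (z1 - z0) / r by rewrite lerDl divr_ge0 ?cmod_ge0 // ltW.
have M0 : 0 <= M by rewrite exprn_ge0 // (le_trans ler01).
pose L := M * cmod Q.[z0] + cmod Q.[z1] + 1.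
have L0 : 0 < L by rewrite ltr_wpDl // addr_ge0 ?mulr_ge0 ?cmod_ge0.
exists (cmod (P.[z1] - v0 * Q.[z1]) / L) => [|v]; first by rewrite divr_gt0.
rewrite ltr_pdivlMr // => vd.
suff [z [zr zroot]] : exists z, cmod (z - z0) < r /\ root (P - v%:P * Q) z.
  move: zr; rewrite lt_min => /andP[ze /Qnz Qz]; exists z; split => //.
  move: zroot; rewrite /root !hornerE subr_eq0 => /eqP ->.
  by rewrite mulfK.
apply: contrapT => none.
have far t : root (P - v%:P * Q) t -> r <= cmod (t - z0).
  by move=> tr; rewrite leNgt; apply/negP => tz; apply: none; exists t.
have := root_distance_bound z1 r0 far; rewrite !hornerE.
set k := (size _).-1.
have kn : (k <= n)%N.
  apply: (leq_trans (leq_pred _)); apply: (leq_trans (size_polyD _ _)).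
  rewrite size_polyN geq_max leq_maxl mul_polyC.
  by rewrite (leq_trans (size_scale_leq _ _)) // leq_maxr.
have Mk : (1 + cmod (z1 - z0) / r) ^+ k <= M by rewrite ler_weXn2l.
have -> : P.[z0] - v * Q.[z0] = (v0 - v) * Q.[z0].
  by rewrite mulrBl /v0 divfK.
have -> : P.[z1] - v * Q.[z1] = (P.[z1] - v0 * Q.[z1]) - (v - v0) * Q.[z1] by ring.
have := cmod_lowerB (P.[z1] - v0 * Q.[z1]) ((v - v0) * Q.[z1]).
rewrite !cmodM (cmodB v0); have := cmod_ge0 (v - v0).
have := ler_wpM2r (mulr_ge0 (cmod_ge0 (v - v0)) (cmod_ge0 Q.[z0])) Mk.
move: vd; rewrite /L; set a := cmod (v - v0); set b := cmod Q.[z0].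
set c := cmod Q.[z1]; set m := cmod (_ - _); set m' := cmod (_ - _ - _).
set M' := _ ^+ k => h1 h2 h3 h4 h5.
have h6 : m <= M * (a * b) + a * c by rewrite -lerBlDr (le_trans h4) // (le_trans h5).
have := lt_le_trans h1 h6.
have -> : M * (a * b) + a * c = a * (M * b + c + 1) - a by ring.
by rewrite ltrBrDr gtrDl ltNge h3.
Qed.

End LocallyLipschitz.

(** * Charts and complex derivatives *)

Section Charts.
Context {R : realType}.
Local Notation C := R[i].
Local Notation Chat := (sphere R).

Lemma uncoord_coord (x : Chat) : uncoord x (coord x x) = x.
Proof. by case: x => [z|] //=; rewrite eqxx. Qed.

Lemma coord_uncoord (y : Chat) (w : C) : coord y (uncoord y w) = w.
Proof. by case: y => [z|] //; rewrite /coord /uncoord sinvK. Qed.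

Lemma sdst_uncoord (y : Chat) (v v' : C) :
  sdst (uncoord y v) (uncoord y v') <= 2 * cmod (v - v').
Proof. by case: y => [z|]; rewrite /uncoord ?sdst_sinv sdst_le_cmod. Qed.

Lemma uncoord_near (y : Chat) (e : R) : 0 < e -> exists2 d : R, 0 < d &
  forall z, sdst y z < d -> exists2 w, z = uncoord y w & cmod (w - coord y y) < e.
Proof.
move=> e0; pose N := cmod (coord y y) ^+ 2 + 1.
have N0 : 0 < N by rewrite ltr_wpDl // sqr_ge0.
exists (Num.min N^-1 (e / (4 * N))).
  by rewrite lt_min invr_gt0 N0 divr_gt0 // mulr_gt0.
have small (x : Chat) : sdst (Some (coord y y)) x < Num.min N^-1 (e / (4 * N)) ->
    exists2 w, x = Some w & cmod (w - coord y y) < e.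
  move=> /(sdst_near (lexx _)); rewrite ge_min lexx => /(_ isT)[w -> wy].
  exists w => //; apply: (le_lt_trans wy).
  rewrite mulrC -ltr_pdivlMr ?mulr_gt0 //.
  apply: (@le_lt_trans _ _ (e / (4 * N))); first by rewrite ge_min lexx orbT.
  by rewrite ltr_pM2l // ltf_pV2 ?posrE ?mulr_gt0 // ltr_pM2r // ltr_nat.
move=> z; case: y @N N0 small => [y|] N N0 small; first exact: small.
rewrite -sdst_sinv => /small[w zw wy].
by exists w => //; rewrite /uncoord -zw sinvK.
Qed.

(** Complex differentiability with real radii, equivalent by the next two
    lemmas to derivability over the complex line. *)
Definition has_cderiv (g : C -> C) (z a : C) := forall e : R, 0 < e ->
  exists2 d : R, 0 < d & forall w, cmod (w - z) < d ->
    cmod (g w - g z - a * (w - z)) <= e * cmod (w - z).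

Lemma has_cderiv_derivable (g : C -> C) (z a : C) : has_cderiv g z a ->
  derivable (g : C^o -> C^o) z 1 /\ derive1 (g : C^o -> C^o) z = a.
Proof.
move=> ga.
have lim1 : (fun h : C^o => h^-1 *: (g (h + z) - g z)) @ 0^' --> (a : C^o).
  move=> A /nbhs_cmodP[e e0 eA]; have [d d0 dg] := ga (e / 2) (divr_gt0 e0 (ltr0Sn _ 1)).
  apply/nbhs_cmodP; exists d => // h; rewrite subr0 => hd h0.
  apply: eA; have := dg (h + z); rewrite addrK => /(_ hd).
  have h1 : 0 < cmod h by rewrite cmod_gt0.
  have -> : h^-1 *: (g (h + z) - g z : C^o) - a = (g (h + z) - g z - a * h) * h^-1.
    by rewrite mulrBl mulfK // mulrC.
  rewrite cmodM cmodV ltr_pdivrMr // => /le_lt_trans; apply.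
  by rewrite ltr_pM2r //; lra.
have lim2 : (fun h : C^o => h^-1 *: (g (h *: 1 + z) - g z)) @ 0^' --> (a : C^o).
  by under eq_fun do rewrite scaler1.
split; first by apply/cvg_ex; exists a.
rewrite derive1E /derive.
apply: cvg_lim; last exact: lim2.
exact: norm_hausdorff.
Qed.

Lemma derivable_has_cderiv (g : C -> C) (z : C) :
  derivable (g : C^o -> C^o) z 1 -> has_cderiv g z (derive1 (g : C^o -> C^o) z).
Proof.
move=> /cvg_ex[/= a ga].
have lim1 : (fun h : C^o => h^-1 *: (g (h + z) - g z)) @ 0^' --> (a : C^o).
  suff -> : (fun h : C^o => h^-1 *: (g (h + z) - g z)) =
            (fun h : C^o => h^-1 *: (g (h *: (1 : C^o) + z) - g z)) by [].
  by apply/funext => h; rewrite scaler1.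
have -> : derive1 (g : C^o -> C^o) z = a.
  by rewrite derive1E /derive; apply: cvg_lim; [exact: norm_hausdorff|exact: ga].
move=> e e0.
have /lim1 : nbhs (a : C^o) [set w | cmod (w - a) < e] by apply/nbhs_cmodP; exists e.
move=> /nbhs_cmodP[d d0 dg]; exists d => // w wd.
have [->|wz] := eqVneq w z; first by rewrite !subrr mulr0 subr0 cmod0 mulr0.
have h0 : w - z != 0 by rewrite subr_eq0.
have := dg (w - z); rewrite subr0 => /(_ wd h0) /=; rewrite subrK => dw.
have -> : g w - g z - a * (w - z) = ((w - z)^-1 *: (g w - g z : C^o) - a) * (w - z).
  by rewrite mulrBl /GRing.scale /= mulrAC mulVf // mul1r.
by rewrite cmodM ler_wpM2r ?cmod_ge0 // ltW.
Qed.

Lemma has_cderiv_ext g h (z a : C) (e : R) : 0 < e ->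
  (forall w, cmod (w - z) < e -> g w = h w) -> has_cderiv g z a -> has_cderiv h z a.
Proof.
move=> e0 gh ga e1 /ga[d d0 H]; exists (Num.min d e); first by rewrite lt_min d0.
move=> w; rewrite lt_min => /andP[wd we]; rewrite -!gh //; first exact: H.
by rewrite subrr cmod0.
Qed.

Lemma has_cderiv_lip g z a : has_cderiv g z a -> exists2 d : R, 0 < d &
  forall w, cmod (w - z) < d -> cmod (g w - g z) <= (cmod a + 1) * cmod (w - z).
Proof.
move=> /(_ 1 ltr01)[d d0 H]; exists d => // w /H; rewrite mul1r => h.
have -> : g w - g z = (g w - g z - a * (w - z)) + a * (w - z) by ring.
rewrite (le_trans (cmodD _ _)) // cmodM; lra.
Qed.

Lemma has_cderiv_comp g h z a b : has_cderiv g z a -> has_cderiv h (g z) b ->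
  has_cderiv (h \o g) z (b * a).
Proof.
move=> ga hb e e0.
pose L := cmod a + 1; have L0 : 0 < L by rewrite ltr_wpDl ?cmod_ge0.
pose B := cmod b + 1; have B0 : 0 < B by rewrite ltr_wpDl ?cmod_ge0.
have [d1 d10 gL] := has_cderiv_lip ga.
have [d2 d20 gd] := ga (e / 2 / B) (divr_gt0 (divr_gt0 e0 (ltr0Sn _ 1)) B0).
have [d3 d30 hd] := hb (e / 2 / L) (divr_gt0 (divr_gt0 e0 (ltr0Sn _ 1)) L0).
exists (Num.min (Num.min d1 d2) (d3 / L)).
  by rewrite !lt_min d10 d20 divr_gt0.
move=> w; rewrite !lt_min => /andP[/andP[w1 w2] w3].
have gw := gL _ w1; rewrite -/L in gw.
have w3' : cmod (g w - g z) < d3.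
  by apply: (le_lt_trans gw); rewrite mulrC -ltr_pdivlMr.
have -> : (h \o g) w - (h \o g) z - b * a * (w - z) =
  (h (g w) - h (g z) - b * (g w - g z)) + b * (g w - g z - a * (w - z)).
  by rewrite /=; ring.
rewrite (le_trans (cmodD _ _)) // (@le_trans _ _ (e / 2 * cmod (w - z) + e / 2 * cmod (w - z))) //; last lra.
apply: lerD.
  apply: (le_trans (hd _ w3')); rewrite -mulrA ler_wpM2l ?divr_ge0 ?(ltW e0) //.
  by rewrite ler_pdivrMl.
rewrite cmodM; apply: (@le_trans _ _ (B * (e / 2 / B * cmod (w - z)))).
  by rewrite ler_pM ?cmod_ge0 ?gd // lerDl.
by rewrite mulrA mulrCA divff ?gt_eqF // mulr1.
Qed.

End Charts.

(** * Rational maps in charts *)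

Section LocalForm.
Context {R : realType}.
Local Notation C := R[i].
Local Notation Chat := (sphere R).

(** What is needed of a rational map near x: in the charts at x and f x it
    is a map g, open at the centre, with a symmetric, bounded and Lipschitz
    divided difference T. The point x is critical exactly when T vanishes at
    the centre. *)
Record local_form (f : Chat -> Chat) (x : Chat) (g : C -> C) (T : C -> C -> C)
    (e K : R) : Prop := LocalForm {
  lf_gt0 : 0 < e;
  lf_ge0 : 0 <= K;
  lf_eq : forall w, cmod (w - coord x x) < e -> f (uncoord x w) = uncoord (f x) (g w);
  lf_dq : forall z w, cmod (z - coord x x) < e -> cmod (w - coord x x) < e ->
    g z - g w = (z - w) * T z w;
  lf_sym : forall z w, cmod (z - coord x x) < e -> cmod (w - coord x x) < e ->
    T z w = T w z;
  lf_lip : forall z w w', cmod (z - coord x x) < e -> cmod (w - coord x x) < e ->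
    cmod (w' - coord x x) < e ->
    cmod (T z w) <= K /\ cmod (T z w - T z w') <= K * cmod (w - w');
  lf_open : forall e' : R, 0 < e' -> exists2 d : R, 0 < d &
    forall v, cmod (v - g (coord x x)) < d ->
    exists2 z, cmod (z - coord x x) < e' & g z = v }.

(** The point of the sphere with homogeneous coordinates (a : b). *)
Definition hmap (a b : C) : Chat := if b == 0 then None else Some (a / b).

Lemma hmap_sinv a b : a != 0 \/ b != 0 -> hmap a b = sinv (hmap b a).
Proof.
rewrite /hmap; case: (eqVneq a 0) => [->|a0] [] //= b0; rewrite ?(negbTE b0) /=.
- by rewrite mul0r.
- by case: eqP => [->|/eqP b1]; rewrite ?mul0r ?eqxx // mulf_eq0 invr_eq0 (negbTE a0) orbF (negbTE b1) invf_div.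
- by rewrite mulf_eq0 invr_eq0 (negbTE a0) (negbTE b0) invf_div.
Qed.

(** The polynomial that represents p in the coordinate 1 / z, for the degree
    bound n. *)
Definition revp n (p : {poly C}) : {poly C} := \poly_(i < n.+1) p`_(n - i).

Lemma revp0 n (p : {poly C}) : (revp n p).[0] = p`_n.
Proof. by rewrite horner_coef0 coef_poly /= subn0. Qed.

Lemma revpE n (p : {poly C}) (w : C) : (size p <= n.+1)%N -> w != 0 ->
  (revp n p).[w] = w ^+ n * p.[w^-1].
Proof.
move=> pn w0; rewrite horner_poly (horner_coef_wide _ pn) mulr_sumr.
rewrite (reindex_inj rev_ord_inj) /=; apply: eq_bigr => i _.
have i_n : (i <= n)%N by rewrite -ltnS.
rewrite subSS subKn // mulrCA; congr (_ * _).
by rewrite exprB ?unitfE // exprVn.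
Qed.

Lemma common_root_coprime (p q : {poly C}) z : coprimep p q ->
  p.[z] != 0 \/ q.[z] != 0.
Proof.
move=> pq; have [pz|] := eqVneq p.[z] 0; last by left.
by right; apply: (coprimep_root pq); apply/rootP.
Qed.

Lemma ratdeg_coef (p q : {poly C}) : coprimep p q ->
  p`_(ratdeg p q) != 0 \/ q`_(ratdeg p q) != 0.
Proof.
move=> pq; have pq0 : (p != 0) || (q != 0).
  rewrite -negb_and; apply/negP => /andP[/eqP p0 /eqP q0].
  by move: pq; rewrite p0 q0 coprimep0 -size_poly_eq1 size_poly0.
rewrite /ratdeg; case: (leqP (size p) (size q)) => pqs.
  right; rewrite -/(lead_coef q) lead_coef_eq0; move: pq0; case: (eqVneq q 0) => //= q0.
  by rewrite orbF -size_poly_gt0 => /leq_trans/(_ pqs); rewrite q0 size_poly0.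
by left; rewrite -/(lead_coef p) lead_coef_eq0 -size_poly_gt0 (leq_ltn_trans _ pqs).
Qed.

(** At infinity p and q are replaced by their reversals. Nontrivial
    combinations of P and Q are kept nonzero because their roots are the
    fibres of the map. *)
Lemma ratmap_chart (p q : {poly C}) (x : Chat) : coprimep p q ->
  (0 < ratdeg p q)%N -> exists P Q : {poly C},
  [/\ forall w, P.[w] != 0 \/ Q.[w] != 0,
      forall w, ratmap p q (uncoord x w) = hmap P.[w] Q.[w] &
      forall a b, a != 0 \/ b != 0 -> a *: P + b *: Q != 0].
Proof.
move=> pq d0; set n := ratdeg p q in d0 *.
have comb a b : a != 0 \/ b != 0 -> a *: p + b *: q != 0.
  move=> ab; apply/negP => /eqP abpq.
  have small_size : size p = 1%N -> size q = 1%N -> False.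
    by move=> p1 q1; move: d0; rewrite /n /ratdeg p1 q1.
  have [a0|a0] := eqVneq a 0.
    case: ab => [|b0]; first by rewrite a0 eqxx.
    move: abpq; rewrite a0 scale0r add0r => /eqP; rewrite scaler_eq0 (negbTE b0) /=.
    move=> /eqP q0; move: pq; rewrite q0 coprimep0 -size_poly_eq1 => /eqP p1.
    by move: d0; rewrite /n /ratdeg p1 q0 size_poly0.
  have pE : p = (- b / a) *: q.
    apply: (scalerI a0); rewrite scalerA mulrCA divff // mulr1 scaleNr.
    by apply/eqP; rewrite -addr_eq0 abpq.
  have [b0|b0] := eqVneq b 0.
    move: pq; rewrite pE b0 oppr0 mul0r scale0r coprime0p -size_poly_eq1 => /eqP q1.
    by move: d0; rewrite /n /ratdeg pE b0 oppr0 mul0r scale0r size_poly0 q1.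
  have c0 : - b / a != 0 by rewrite mulf_neq0 ?oppr_eq0 ?invr_eq0.
  move: pq; rewrite pE coprimepZl // coprimepp => /eqP q1.
  by apply: small_size => //; rewrite pE size_scale.
case: x => [z|].
  exists p, q; split => // w; first exact: common_root_coprime.
have sp : (size p <= n.+1)%N.
  by rewrite (leq_trans (leq_maxl _ (size q))) // leqSpred.
have sq : (size q <= n.+1)%N.
  by rewrite (leq_trans (leq_maxr (size p) _)) // leqSpred.
have rev0 (s : {poly C}) : (size s <= n.+1)%N -> revp n s = 0 -> s = 0.
  move=> sn r0; apply/polyP => i; rewrite coef0; have [ni|ni] := ltnP n i.
    by rewrite nth_default // (leq_trans sn).
  by have := congr1 (fun t : {poly C} => t`_(n - i)) r0; rewrite /revp coef_poly coef0 ltnS leq_subr subKn.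
exists (revp n p), (revp n q); split => [w|w|a b /comb abpq].
- have [->|w0] := eqVneq w 0; first by rewrite !revp0; exact: ratdeg_coef.
  rewrite !revpE // !mulf_eq0 !negb_or expf_eq0 (negbTE w0) andbF /=.
  exact: common_root_coprime.
- have [->|w0] := eqVneq w 0; first by rewrite /= eqxx !revp0.
  rewrite /uncoord /= (negbTE w0) !revpE // /hmap mulf_eq0 expf_eq0 (negbTE w0) andbF /=.
  by rewrite -mulf_div divff ?mul1r // expf_eq0 (negbTE w0) andbF.
- apply: contra abpq => /eqP abr; apply/eqP/rev0.
    rewrite (leq_trans (size_polyD _ _)) // geq_max.
    by rewrite !(leq_trans (size_scale_leq _ _)).
  rewrite -abr; apply/polyP => i; rewrite /revp coefD !coefZ !coef_poly.
  by rewrite coefD !coefZ; case: ifP => // _; rewrite !mulr0 addr0.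
Qed.

(** If the denominator vanishes at the centre, the numerator and the
    denominator exchange roles, which is the passage to the chart at
    infinity in the target. *)
Lemma rational_local_form (f : Chat -> Chat) (x : Chat) :
  nonconstant_rational f -> exists g T e K, local_form f x g T e K.
Proof.
move=> [d d0 [p [q [pq pqd ->]]]]; rewrite -pqd in d0 => {d pqd}.
have [P0 [Q0 [nz0 E0 comb0]]] := ratmap_chart x pq d0.
set w0 := coord x x; set F := ratmap p q in E0 *.
have Fx : F x = hmap P0.[w0] Q0.[w0] by rewrite -E0 uncoord_coord.
have [P [Q [Qw0 E comb]]] : exists P Q : {poly C}, [/\ Q.[w0] != 0,
    forall w, Q.[w] != 0 -> F (uncoord x w) = uncoord (F x) (P.[w] / Q.[w]) &
    forall a b, a != 0 \/ b != 0 -> a *: P + b *: Q != 0].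
  have [Q00|Q00] := eqVneq Q0.[w0] 0.
    exists Q0, P0; split => [|w Pw|a b ab].
    - by case: (nz0 w0) => //; rewrite Q00 eqxx.
    - by rewrite Fx E0 {2}/hmap Q00 eqxx hmap_sinv // /hmap (negbTE Pw).
    - by rewrite addrC; apply: comb0; case: ab; [right|left].
  exists P0, Q0; split => // w Qw.
  by rewrite Fx E0 /hmap (negbTE Qw) (negbTE Q00).
have [T [TD Tsym TL]] := ratio_dq P Q.
have [e1 [K [e10 K0 TK]]] := TL _ Qw0.
have [_ [e2 e20 Qnz]] := loclipV Qw0.
exists (fun w => P.[w] / Q.[w]), T, (Num.min e1 e2), K; split => //.
- by rewrite lt_min e10.
- by move=> w; rewrite lt_min => /andP[_ /Qnz]; exact: E.
- by move=> z w; rewrite !lt_min => /andP[_ /Qnz Qz] /andP[_ /Qnz Qw]; exact: TD.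
- by move=> z w; rewrite !lt_min => /andP[_ /Qnz Qz] /andP[_ /Qnz Qw]; exact: Tsym.
- move=> z w w'; rewrite !lt_min => /andP[ze _] /andP[we _] /andP[w'e _].
  exact: TK.
move=> e' e'0.
have cnz : P - (P.[w0] / Q.[w0])%:P * Q != 0.
  by rewrite mul_polyC -scaleNr -[P]scale1r; apply: comb; left; exact: oner_neq0.
have [r r0 H] := ratio_open Qw0 e'0 cnz.
by exists r => // v /H[z [ze _ zv]]; exists z.
Qed.

End LocalForm.

(** * Continuity, openness and fibres of rational maps *)

Section SphereMaps.
Context {R : realType}.
Local Notation C := R[i].
Local Notation Chat := (sphere R).
Implicit Types (f g : Chat -> Chat).

Definition scont f := forall x (e : R), 0 < e -> exists2 d : R, 0 < d &
  forall y, sdst x y < d -> sdst (f x) (f y) < e.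

Definition unif_scont f := forall e : R, 0 < e -> exists2 d : R, 0 < d &
  forall x y, sdst x y < d -> sdst (f x) (f y) < e.

Definition unif_open f := forall e : R, 0 < e -> exists2 d : R, 0 < d &
  forall x v, sdst (f x) v < d -> exists2 y, sdst x y < e & f y = v.

Definition loc_inj f (x : Chat) := exists2 d : R, 0 < d &
  forall y y', sdst x y < d -> sdst x y' < d -> f y = f y' -> y = y'.

Definition chart_map f (x : Chat) (w : C) : C := coord (f x) (f (uncoord x w)).

Lemma scont_unif f : scont f -> unif_scont f.
Proof.
move=> fc e e0.
have [||d d0 H] := @uniform_radius R setT
   (fun d x => forall y, sdst x y < d -> sdst (f x) (f y) < e) closedT.
- by move=> d d' x dd' H y xy; apply: H; exact: lt_le_trans dd'.
- move=> x _; have [d d0 H] := fc x (e / 2) (divr_gt0 e0 (ltr0Sn _ 1)).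
  exists (d / 2), (d / 2); split; rewrite ?divr_gt0 // => y _ xy z yz.
  have xz : sdst x z < d by have := sdst_triangle y x z; lra.
  have xy' : sdst x y < d by have := sdst_ge0 y z; lra.
  have := H _ xz; have := H _ xy'; rewrite sdstC.
  by have := sdst_triangle (f x) (f y) (f z); lra.
by exists d => // x y; exact: H.
Qed.

Lemma scont_continuous f : scont f -> continuous f.
Proof.
move=> fc x A /snbhsP[e e0 eA]; have [d d0 H] := fc x e e0.
by apply/snbhsP; exists d => // y /H/eA.
Qed.

Lemma scont_comp f g : scont f -> scont g -> scont (g \o f).
Proof.
move=> fc gc x e /(gc (f x))[d d0 dg]; have [r r0 H] := fc x d d0.
by exists r => // y /H/dg.
Qed.

Lemma unif_open_comp f g : unif_open f -> unif_open g -> unif_open (g \o f).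
Proof.
move=> fo go e /fo[d d0 df]; have [r r0 H] := go d d0.
by exists r => // x v /H[y /df[z xz <-] <-]; exists z.
Qed.

Lemma loc_inj_comp f g x : scont f -> loc_inj f x -> loc_inj g (f x) ->
  loc_inj (g \o f) x.
Proof.
move=> fc [d d0 df] [r r0 rg]; have [d' d'0 H] := fc x r r0.
exists (Num.min d d'); first by rewrite lt_min d0.
move=> y y'; rewrite !lt_min => /andP[yd /H fy] /andP[y'd /H fy'] /rg fyy'.
by apply: df => //; apply: fyy'.
Qed.

Lemma chart_map_base f x : chart_map f x (coord x x) = coord (f x) (f x).
Proof. by rewrite /chart_map uncoord_coord. Qed.

Lemma critE f c : crit f c = (derive1 (chart_map f c : C^o -> C^o) (coord c c) = 0).
Proof. by []. Qed.

Section AtPoint.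
Variables (f : Chat -> Chat) (x : Chat) (g : C -> C) (T : C -> C -> C) (e K : R).
Hypothesis lf : local_form f x g T e K.
Let w0 := coord x x.

Lemma lf_center : cmod (w0 - w0) < e.
Proof. by rewrite subrr cmod0 (lf_gt0 lf). Qed.

Lemma lf_base : uncoord (f x) (g w0) = f x.
Proof. by rewrite -(lf_eq lf lf_center) uncoord_coord. Qed.

Lemma lf_base_coord : g w0 = coord (f x) (f x).
Proof. by rewrite -{2}lf_base coord_uncoord. Qed.

Lemma lf_lipg z w : cmod (z - w0) < e -> cmod (w - w0) < e ->
  cmod (g z - g w) <= K * cmod (z - w).
Proof.
move=> ze we; rewrite (lf_dq lf ze we) cmodM mulrC ler_wpM2r ?cmod_ge0 //.
by have [] := lf_lip lf ze we we.
Qed.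

Lemma lf_cderiv : has_cderiv (chart_map f x) w0 (T w0 w0).
Proof.
apply: (has_cderiv_ext (lf_gt0 lf) (g := g)) => [w we|e1 e10].
  by rewrite /chart_map (lf_eq lf we) coord_uncoord.
have K0 := lf_ge0 lf; have K1 : 0 < K + 1 by lra.
exists (Num.min e (e1 / (K + 1))); first by rewrite lt_min (lf_gt0 lf) divr_gt0.
move=> w; rewrite lt_min ltr_pdivlMr // => /andP[we w1].
rewrite (lf_dq lf we lf_center).
have -> : (w - w0) * T w w0 - T w0 w0 * (w - w0) = (w - w0) * (T w0 w - T w0 w0).
  by rewrite (lf_sym lf we lf_center); ring.
rewrite cmodM mulrC ler_wpM2r ?cmod_ge0 //.
have [_ /le_trans] := lf_lip lf lf_center we lf_center; apply.
by have := cmod_ge0 (w - w0); lra.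
Qed.

Lemma lf_crit : crit f x <-> T w0 w0 = 0.
Proof. by rewrite critE (has_cderiv_derivable lf_cderiv).2. Qed.

Lemma lf_scont (e1 : R) : 0 < e1 -> exists2 d : R, 0 < d &
  forall y, sdst x y < d -> sdst (f x) (f y) < e1.
Proof.
move=> e10; have K0 := lf_ge0 lf; have K1 : 0 < 2 * (K + 1) by lra.
have [|d d0 H] := @uncoord_near _ x (Num.min e (e1 / (2 * (K + 1)))).
  by rewrite lt_min (lf_gt0 lf) divr_gt0.
exists d => // y /H[w -> ]; rewrite lt_min ltr_pdivlMr // => /andP[we w1].
rewrite (lf_eq lf we) -{1}lf_base (le_lt_trans (sdst_uncoord _ _ _)) //.
have := lf_lipg lf_center we; rewrite -/w0 [X in K * X]cmodB => h.
by have := cmod_ge0 (w - w0); nra.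
Qed.

Lemma lf_sopen (e1 : R) : 0 < e1 -> exists2 d : R, 0 < d &
  forall v, sdst (f x) v < d -> exists2 y, sdst x y < e1 & f y = v.
Proof.
move=> e10; have e20 : 0 < Num.min e (e1 / 2) by rewrite lt_min (lf_gt0 lf) divr_gt0.
have [d d0 gd] := lf_open lf e20; have [r r0 H] := uncoord_near (f x) d0.
exists r => // v /H[w ->]; rewrite -lf_base_coord => /gd[z].
rewrite lt_min => /andP[ze z1] <-; exists (uncoord x z); last exact: (lf_eq lf).
rewrite -{1}(uncoord_coord x) (le_lt_trans (sdst_uncoord _ _ _)) //.
by rewrite cmodB; rewrite -/w0 in z1 *; lra.
Qed.

Lemma lf_loc_inj : ~ crit f x -> loc_inj f x.
Proof.
move=> /lf_crit/eqP; rewrite -cmod_gt0 => T0.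
have K0 := lf_ge0 lf; have K1 : 0 < 2 * (K + 1) by lra.
have [|d d0 H] := @uncoord_near _ x (Num.min e (cmod (T w0 w0) / (2 * (K + 1)))).
  by rewrite lt_min (lf_gt0 lf) divr_gt0.
exists d => // y y' /H[z -> zd] /H[w -> wd].
move: zd wd; rewrite !lt_min !ltr_pdivlMr // => /andP[ze z1] /andP[we w1].
rewrite !(lf_eq lf) // => /(congr1 (coord (f x))); rewrite !coord_uncoord => gzw.
have /eqP := lf_dq lf ze we; rewrite gzw subrr eq_sym mulf_eq0 subr_eq0.
case/orP => [/eqP -> //|/eqP Tzw]; exfalso.
have [_] := lf_lip lf ze we lf_center; rewrite Tzw sub0r cmodN (lf_sym lf ze lf_center).
have [_] := lf_lip lf lf_center ze lf_center.
have := cmod_triangle (T w0 z) (T w0 w0) 0; rewrite !subr0 (cmodB (T w0 w0)) => h1 h2 h3.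
by rewrite -/w0 in z1 w1 h2 h3; have := cmod_ge0 (z - w0); have := cmod_ge0 (w - w0); lra.
Qed.

End AtPoint.

Section Rational.
Variable f : Chat -> Chat.
Hypothesis fr : nonconstant_rational f.

Lemma rational_scont : scont f.
Proof.
move=> x e e0; have [g [T [e1 [K lf]]]] := rational_local_form x fr.
exact: (lf_scont lf).
Qed.

Lemma rational_unif_open : unif_open f.
Proof.
move=> e e0.
have [||d d0 H] := @uniform_radius R setT (fun d x =>
   forall v, sdst (f x) v < d -> exists2 y, sdst x y < e & f y = v) closedT.
- by move=> d d' x dd' H v xv; apply: H; exact: lt_le_trans dd'.
- move=> x _; have [g [T [e1 [K lf]]]] := rational_local_form x fr.
  have [d d0 H] := lf_sopen lf (divr_gt0 e0 (ltr0Sn _ 1)).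
  have [r r0 Hr] := lf_scont lf (divr_gt0 d0 (ltr0Sn _ 1)).
  exists (Num.min r (e / 2)), (d / 2); split; rewrite ?lt_min ?r0 ?divr_gt0 // => y _.
  rewrite lt_min => /andP[/Hr xy xye] v yv.
  have [|z xz <-] := H v; first by have := sdst_triangle (f y) (f x) v; lra.
  by exists z => //; rewrite sdstC in xye; have := sdst_triangle x y z; lra.
by exists d => // x v; exact: H.
Qed.

Lemma rational_cderiv x : exists a, has_cderiv (chart_map f x) (coord x x) a.
Proof.
have [g [T [e1 [K lf]]]] := rational_local_form x fr.
by exists (T (coord x x) (coord x x)); exact: lf_cderiv lf.
Qed.

Lemma rational_noncrit x : ~ crit f x -> loc_inj f x /\
  exists2 a, a != 0 & has_cderiv (chart_map f x) (coord x x) a.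
Proof.
have [g [T [e1 [K lf]]]] := rational_local_form x fr.
move=> nc; split; first exact: (lf_loc_inj lf nc).
exists (T (coord x x) (coord x x)); last exact: lf_cderiv lf.
by apply/eqP => T0; apply: nc; apply/(lf_crit lf).
Qed.

(** Up to the point at infinity a fibre consists of roots of a nonzero
    combination of the two polynomials. *)
Lemma rational_fiber_bound : exists N, forall v (s : seq Chat),
  uniq s -> (forall y, y \in s -> f y = v) -> (size s <= N)%N.
Proof.
have [d d0 [p [q [pq pqd fE]]]] := fr; rewrite -pqd in d0.
have [P [Q [nz E comb]]] := ratmap_chart (Some 0) pq d0.
exists (maxn (size P) (size Q)).+1 => v s us sv.
pose s1 := [seq fin y | y <- s & y != None].
have [c c0 croot] : exists2 c : C * C, c.1 != 0 \/ c.2 != 0 &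
    forall z, f (Some z) = v -> root (c.1 *: P + c.2 *: Q) z.
  case: v sv => [v|] sv.
    exists (1, - v) => [|z]; first by left; exact: oner_neq0.
    rewrite fE -[Some z]/(uncoord (Some 0) z) E /hmap; case: ifPn => // Qz [<-].
    by rewrite /root !hornerE mulNr divfK ?subrr.
  exists (0, 1) => [|z]; first by right; exact: oner_neq0.
  rewrite fE -[Some z]/(uncoord (Some 0) z) E /hmap; case: ifPn => // /eqP Qz _.
  by rewrite /root !hornerE Qz.
have s1r : all (root (c.1 *: P + c.2 *: Q)) s1.
  apply/allP => z /mapP[[y|]]; rewrite mem_filter //= => ys ->.
  by apply: croot; exact: sv.
have us1 : uniq s1.
  rewrite map_inj_in_uniq ?filter_uniq // => -[y|] [y'|]; rewrite !mem_filter //=.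
  by move=> _ _ ->.
have := max_poly_roots (comb _ _ c0) s1r us1; rewrite size_map => h1.
have : (size s <= (size [seq y <- s | y != None]).+1)%N.
  rewrite size_filter -(count_predC (fun y : Chat => y != None)) -addn1 leq_add2l.
  have -> : count (predC (fun y : Chat => y != None)) s = count_mem None s.
    by apply: eq_count => y /=; rewrite negbK.
  by rewrite count_uniq_mem // leq_b1.
move=> /leq_trans; apply; rewrite ltnS.
apply: (leq_trans (ltnW h1)); apply: (leq_trans (size_polyD _ _)).
by rewrite geq_max !(leq_trans (size_scale_leq _ _)) ?leq_maxl ?leq_maxr.
Qed.

(** If p - v q is constant, it has no root, but then the value v is taken at
    infinity. *)
Lemma rational_onto v : exists y, f y = v.
Proof.
have [d d0 [p [q [pq pqd fE]]]] := fr; rewrite -pqd in d0.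
have [P [Q [nz E comb]]] := ratmap_chart (Some 0) pq d0.
have fin_sol (a b z : C) : (a *: p + b *: q).[z] = 0 -> a * p.[z] + b * q.[z] = 0.
  by rewrite !hornerE.
have inf_sol (a b : C) : size (a *: p + b *: q) = 1%N ->
    a * p`_(ratdeg p q) + b * q`_(ratdeg p q) = 0.
  by move=> s1; rewrite -!coefZ -coefD nth_default // s1.
have sol (a b : C) : a != 0 \/ b != 0 ->
    (exists z, a * p.[z] + b * q.[z] = 0) \/
    a * p`_(ratdeg p q) + b * q`_(ratdeg p q) = 0.
  move=> ab; have [s1|s1] := eqVneq (size (a *: p + b *: q)) 1%N.
    by right; exact: inf_sol.
  by left; have /closed_rootP[z /rootP/fin_sol zr] := s1; exists z.
have dpq := ratdeg_coef pq.
case: v => [v|].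
  have [|[z]|] := sol 1 (- v).
  - by left; exact: oner_neq0.
  - move=> /eqP; rewrite mul1r mulNr subr_eq0 => /eqP pz.
    exists (Some z); rewrite fE /=; case: ifPn => [/eqP qz|qz]; last by rewrite pz mulfK.
    by case: (common_root_coprime z pq); rewrite ?pz qz ?mulr0 eqxx.
  - move=> /eqP; rewrite mul1r mulNr subr_eq0 => /eqP pz.
    exists None; rewrite fE /=; case: ifPn => [/eqP qz|qz]; last by rewrite pz mulfK.
    by case: dpq; rewrite ?pz qz ?mulr0 eqxx.
have [|[z]|] := sol 0 1.
- by right; exact: oner_neq0.
- by rewrite mul0r mul1r add0r => qz; exists (Some z); rewrite fE /= qz eqxx.
- by rewrite mul0r mul1r add0r => qz; exists None; rewrite fE /= qz eqxx.
Qed.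

End Rational.

(** A connected set that is mapped close to x stays close to the fibre over
    x. If it were long, points spaced along its length would be close to
    more points of the fibre than there are. *)
Lemma connected_fiber_small f : nonconstant_rational f -> forall e : R, 0 < e ->
  exists2 d : R, 0 < d & forall (E : set Chat) x, connected E ->
    (forall y, E y -> sdst (f y) x < d) -> forall y y', E y -> E y' -> sdst y y' < e.
Proof.
move=> fr e e0; have [N fibN] := rational_fiber_bound fr.
have N2 : 0 < (N.+2)%:R :> R by rewrite ltr0n.
pose h := e / N.+2%:R; have h0 : 0 < h by rewrite divr_gt0.
have [d d0 fo] := rational_unif_open fr (divr_gt0 h0 (ltr0Sn _ 1)).
exists d => // E x cE Ex y y' Ey Ey'; rewrite ltNge; apply/negP => far.
have pts k : (k <= N)%N -> exists2 t, E t & sdst y t = k%:R * h.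
  move=> kN; have : is_interval [set sdst y t | t in E].
    apply/connected_intervalP/connected_continuous_connected => //.
    apply: continuous_subspaceT => t A /nbhs_ballP[r /= r0 rA].
    apply/snbhsP; exists r => // t' tt'; apply: rA; rewrite /ball /= ltr_norml.
    have := sdst_triangle t' y t; have := sdst_triangle t y t'.
    by rewrite (sdstC t'); move=> *; apply/andP; split; lra.
  have E0 : [set sdst y t | t in E] 0 by exists y => //; rewrite sdstxx.
  have E1 : [set sdst y t | t in E] (sdst y y') by exists y'.
  move=> /(_ 0 _ E0 E1 (k%:R * h))[|t Et ty]; last by exists t.
  apply/andP; split; first by rewrite mulr_ge0 // ltW.
  apply: le_trans far; rewrite /h mulrCA ger_pMr // ler_pdivrMr // mul1r ler_nat.
  by rewrite (leq_trans kN) // -addn2 leq_addr.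
have sol k : (k <= N)%N -> exists z, f z = x /\ `|sdst y z - k%:R * h| < h / 2.
  move=> /pts[t Et ty]; have [z tz <-] := fo t x (Ex _ Et); exists z; split => //.
  rewrite ltr_norml -ty; have := sdst_triangle z y t; have := sdst_triangle t y z.
  by rewrite (sdstC z); move=> *; apply/andP; split; lra.
pose z k := if pselect (k <= N)%N is left kN then projT1 (cid (sol k kN)) else y.
have zP k : (k <= N)%N -> f (z k) = x /\ `|sdst y (z k) - k%:R * h| < h / 2.
  by rewrite /z; case: pselect => // kN _; exact: (projT2 (cid (sol k kN))).
have : (size [seq z k | k <- iota 0 N.+1] <= N)%N; last by rewrite size_map size_iota ltnn.
apply: (fibN x); last first.
  by move=> t /mapP[k]; rewrite mem_iota add0n ltnS => /zP[fz _] ->.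
rewrite map_inj_in_uniq ?iota_uniq // => k j; rewrite !mem_iota !add0n !ltnS /=.
move=> kN jN zkj; have [_] := zP k kN; have [_] := zP j jN; rewrite zkj.
rewrite !ltr_norml => /andP[a1 a2] /andP[b1 b2].
have : `|k%:R - j%:R| < 1 :> R.
  by rewrite ltr_norml -(ltr_pM2r h0) -[X in _ && X](ltr_pM2r h0); apply/andP; split; lra.
case: (ltngtP k j) => // kj.
  by rewrite distrC -natrB ?(ltnW kj) // ger0_norm ?ler0n // ltrn1 ltnS leqn0 subn_eq0 leqNgt kj.
by rewrite -natrB ?(ltnW kj) // ger0_norm ?ler0n // ltrn1 ltnS leqn0 subn_eq0 leqNgt kj.
Qed.

End SphereMaps.

(** * Normal families *)

Section UniformConvergence.
Context {R : realType}.
Local Notation Chat := (sphere R).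
Implicit Types (V W : set Chat).

Lemma uniform_cvgP (A : set Chat) (g : nat -> Chat -> Chat) (h : Chat -> Chat) :
  {uniform A, g @ \oo --> h} <->
  forall e : R, 0 < e -> exists N, forall n, (N <= n)%N ->
    forall y, A y -> sdst (h y) (g n y) < e.
Proof.
split=> [gh e e0|H].
  have : nbhs (h : {uniform` A -> Chat})
      [set k | forall y, A y -> sdst (h y) (k y) < e].
    apply/uniform_nbhs; exists [set xy | ball xy.1 e xy.2]; split.
      exact: entourage_ball (PosNum e0).
    by move=> k /= H y Ay; apply/sball_def/H.
  by move=> /gh [N _ HN]; exists N => n Nn; exact: HN.
move=> P /uniform_nbhs[E [entE EP]].
move: entE; rewrite -entourage_ballE => -[e /= e0 eE].
have [N HN] := H e e0; exists N => // n /= Nn; apply: EP => y Ay.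
by apply: eE => /=; apply/sball_def/HN.
Qed.

Lemma luc_iff V (g : nat -> Chat -> Chat) h : locally_uniform_cvg V g h <->
  forall z, V z -> exists2 d : R, 0 < d & forall e : R, 0 < e ->
    exists N, forall n, (N <= n)%N -> forall y, V y -> sdst z y < d ->
      sdst (h y) (g n y) < e.
Proof.
split=> H z /H.
  move=> [W /snbhsP[d d0 dW] /uniform_cvgP gh]; exists d => // e /gh[N HN].
  by exists N => n Nn y Vy zy; apply: HN => //; split => //; exact: dW.
move=> [d d0 gh]; exists [set y | sdst z y < d]; first by apply/snbhsP; exists d.
by apply/uniform_cvgP => e /gh[N HN]; exists N => n Nn y [zy Vy]; exact: HN.
Qed.

Lemma normal_pull (F F' : set (Chat -> Chat)) (phi : Chat -> Chat) V W :
  (forall y, W y -> V (phi y)) ->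
  (forall z (e : R), W z -> 0 < e -> exists2 d : R, 0 < d & forall y, W y ->
     sdst z y < d -> sdst (phi z) (phi y) < e) ->
  (forall g, F' g -> exists2 g', F g' & forall y, W y -> g y = g' (phi y)) ->
  normal_on F V -> normal_on F' W.
Proof.
move=> WV phic FF' nF g F'g.
have /(_ _)/cid2-/all_sig2[g' Fg' gg'] n := FF' _ (F'g n).
have [k [h [kinc /luc_iff gh]]] := nF _ Fg'; exists k, (h \o phi); split => //.
apply/luc_iff => z Wz; have [d d0 H] := gh _ (WV _ Wz).
have [r r0 Hr] := phic z d Wz d0; exists r => // e /H[N HN].
by exists N => n Nn y Wy zy; rewrite gg' //; apply: HN => //; [exact: WV|exact: Hr].
Qed.

(** The limit on V is constant on the fibres of phi, so it descends to the
    image of V, where openness of phi makes the convergence locally uniform. *)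
Lemma normal_push (F F' : set (Chat -> Chat)) (phi : Chat -> Chat) V :
  open V -> unif_open phi -> (forall g, F' g -> F (g \o phi)) -> normal_on F V ->
  normal_on F' (phi @` V).
Proof.
move=> oV ophi FF' nF g F'g.
have [k [h [kinc /luc_iff gh]]] := nF (fun n => g n \o phi) (fun n => FF' _ (F'g n)).
have hphi y y' : V y -> V y' -> phi y = phi y' -> h y = h y'.
  move=> Vy Vy' yy'; apply: sdst_eq0; apply/eqP; rewrite eq_le sdst_ge0 andbT.
  apply/ler_addgt0Pr => e e0; rewrite add0r.
  have [d d0 H] := gh _ Vy; have [N HN] := H _ (divr_gt0 e0 (ltr0Sn _ 1)).
  have [d' d'0 H'] := gh _ Vy'; have [N' HN'] := H' _ (divr_gt0 e0 (ltr0Sn _ 1)).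
  have := HN (maxn N N') (leq_maxl _ _) y Vy; rewrite sdstxx => /(_ d0).
  have := HN' (maxn N N') (leq_maxr _ _) y' Vy'; rewrite sdstxx => /(_ d'0).
  rewrite /= -yy' (sdstC (h y')) => *.
  have := sdst_triangle (g (k (maxn N N')) (phi y)) (h y) (h y'); lra.
pose sel y := if pselect (exists2 t, V t & phi t = y) is left E then projT1 (cid2 E) else y.
have selP y : (phi @` V) y -> V (sel y) /\ phi (sel y) = y.
  by move=> Vy; rewrite /sel; case: pselect => // E; case: (cid2 E).
exists k, (h \o sel); split => //; apply/luc_iff => z Vz.
have [Vt tz] := selP _ Vz; set t := sel z in Vt tz *.
have [d d0 H] := gh _ Vt.
have /snbhsP[r r0 rV] : nbhs t V by apply: open_nbhs_nbhs.
have [|q q0 Hq] := ophi (Num.min d r); first by rewrite lt_min d0.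
exists q => // e /H[N HN]; exists N => n Nn y Vy zy.
have [|t' tt' t'y] := Hq t y; first by rewrite tz.
move: tt'; rewrite lt_min => /andP[tt'd /rV Vt'].
have [Vs sy] := selP _ Vy.
rewrite /= (hphi _ t' Vs Vt' (etrans sy (esym t'y))) -t'y.
exact: HN.
Qed.

(** One of the finitely many values is taken infinitely often. *)
Lemma subseq_const (T : finType) (c : nat -> T) : exists (i : T) (k : nat -> nat),
  {homo k : m n / (m < n)%N} /\ forall n, c (k n) = i.
Proof.
have [i inf] : exists i, forall N, exists2 n, (N <= n)%N & c n = i.
  apply: contrapT => none.
  have bd i : exists N, forall n, (N <= n)%N -> c n <> i.
    apply: contrapT => nb; apply: none; exists i => N; apply: contrapT => nn.
    by apply: nb; exists N => n Nn cn; apply: nn; exists n.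
  have /all_sig[B HB] i := cid (bd i).
  by apply: (HB (c (\max_i B i)) (\max_i B i)) => //; exact: leq_bigmax.
have /(_ _)/cid2-/all_sig2[nx nx1 nx2] N := inf N.
pose k := fix k n := if n is n'.+1 then nx (k n').+1 else nx 0.
exists i, k; split; last by case=> [|n]; exact: nx2.
by apply: homo_ltn => [|n]; [exact: ltn_trans|exact: nx1].
Qed.

End UniformConvergence.

(** * Words and the Julia set *)

Section ChartComposition.
Context {R : realType}.
Local Notation Chat := (sphere R).

Lemma chart_map_near (f : Chat -> Chat) x : scont f -> exists2 d : R, 0 < d &
  forall w, cmod (w - coord x x) < d ->
    f (uncoord x w) = uncoord (f x) (chart_map f x w).
Proof.
move=> fc; have [d d0 H] := uncoord_near (f x) ltr01.
have [r r0 Hr] := fc x d d0; exists (r / 2); first by rewrite divr_gt0.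
move=> w wr; have /Hr/H[v fv _] : sdst x (uncoord x w) < r.
  rewrite -{1}(uncoord_coord x) (le_lt_trans (sdst_uncoord _ _ _)) // cmodB; lra.
by rewrite /chart_map fv coord_uncoord.
Qed.

Lemma chart_map_comp (f g : Chat -> Chat) x a b : scont f ->
  has_cderiv (chart_map f x) (coord x x) a ->
  has_cderiv (chart_map g (f x)) (coord (f x) (f x)) b ->
  has_cderiv (chart_map (g \o f) x) (coord x x) (b * a).
Proof.
move=> fc fa gb; have [d d0 H] := chart_map_near x fc.
apply: (has_cderiv_ext d0 (g := chart_map g (f x) \o chart_map f x)).
  by move=> w /H fw; rewrite /chart_map /= fw coord_uncoord.
by apply: has_cderiv_comp => //; rewrite chart_map_base.
Qed.

End ChartComposition.

Section WordMaps.
Context {R : realType} {u : nat}.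
Local Notation C := R[i].
Local Notation Chat := (sphere R).
Variable f : 'I_u -> Chat -> Chat.
Hypothesis hf : forall i, nonconstant_rational (f i).

Lemma fword_cat w1 w2 : fword f (w1 ++ w2) = fword f w2 \o fword f w1.
Proof. by elim: w1 => //= i w1 ->. Qed.

Lemma fword_rcons w i : fword f (rcons w i) = f i \o fword f w.
Proof. by rewrite -cats1 fword_cat. Qed.

Lemma fword_scont w : scont (fword f w).
Proof.
elim: w => [|i w IH] /=; first by move=> x e e0; exists e.
exact: scont_comp (rational_scont (hf i)) IH.
Qed.

Lemma fword_unif_open w : unif_open (fword f w).
Proof.
elim: w => [|i w IH] /=; first by move=> e e0; exists e => // x v; exists v.
exact: unif_open_comp (rational_unif_open (hf i)) IH.
Qed.

Lemma fword_onto w v : exists y, fword f w y = v.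
Proof.
elim: w v => [|i w IH] v; first by exists v.
by have [y <-] := IH v; have [z <-] := rational_onto (hf i) y; exists z.
Qed.

Lemma fword_cderiv w z : exists a, has_cderiv (chart_map (fword f w) z) (coord z z) a.
Proof.
elim: w z => [|i w IH] z; last first.
  have [a fa] := rational_cderiv (hf i) z; have [b gb] := IH (f i z).
  by exists (b * a); apply: chart_map_comp => //; exact: rational_scont.
exists 1 => e e0; exists e => // v _.
rewrite /chart_map /= !coord_uncoord mul1r subrr cmod0 mulr_ge0 ?cmod_ge0 //.
exact: ltW.
Qed.

Lemma crit_fword_cons i w z : crit (f i) z -> crit (fword f (i :: w)) z.
Proof.
rewrite !critE => fz; have [b gb] := fword_cderiv w (f i z).
have [a fa] := rational_cderiv (hf i) z.
have a0 : a = 0 by rewrite -fz (has_cderiv_derivable fa).2.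
have := chart_map_comp (rational_scont (hf i)) fa gb.
by rewrite a0 mulr0 => /has_cderiv_derivable[].
Qed.

Lemma fword_noncrit w z :
  (forall w1 i w2, w = w1 ++ i :: w2 -> ~ crit (f i) (fword f w1 z)) ->
  loc_inj (fword f w) z /\
  exists2 a, a != 0 & has_cderiv (chart_map (fword f w) z) (coord z z) a.
Proof.
elim: w z => [|i w IH] z nc.
  split; first by exists 1.
  exists 1; first exact: oner_neq0.
  move=> e e0; exists e => // v _.
  rewrite /chart_map /= !coord_uncoord mul1r subrr cmod0 mulr_ge0 ?cmod_ge0 //.
  exact: ltW.
have [l1 [a a0 fa]] := rational_noncrit (hf i) (nc [::] i w erefl).
have [|l2 [b b0 gb]] := IH (f i z).
  by move=> w1 j w2 wE; apply: (nc (i :: w1) j w2); rewrite wE.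
split; first exact: (loc_inj_comp (rational_scont (hf i)) l1 l2).
by exists (b * a); [rewrite mulf_neq0|exact: chart_map_comp (rational_scont (hf i)) fa gb].
Qed.

Lemma fword_fiber_finite w v : finite_set [set y | fword f w y = v].
Proof.
elim: w v => [|i w IH] v; first exact: finite_set1.
have fin1 y : finite_set [set z | f i z = y].
  apply: contrapT => inf; have [N fibN] := rational_fiber_bound (hf i).
  have [B BA] := infinite_set_fset N.+1 inf.
  by rewrite ltnNge (fibN y (enum_fset B)) ?fset_uniq // => t tB; exact: BA.
have -> : [set y | fword f (i :: w) y = v] =
   \bigcup_(y in [set y | fword f w y = v]) [set z | f i z = y].
  by apply/seteqP; split => [z zv|z [y /= <- <-] //]; exists (f i z).
exact: bigcup_finite.
Qed.

Lemma semigroup_fword w : w <> [::] -> semigroup f (fword f w).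
Proof. by move=> w0; exists w. Qed.

Lemma julia_open_fatou : open (fatou f).
Proof.
rewrite openE => z [V [oV Vz nV]]; rewrite /interior.
by apply: filterS (open_nbhs_nbhs (conj oV Vz)) => y Vy; exists V.
Qed.

Lemma julia_closed : closed (julia f).
Proof. exact: open_closedC julia_open_fatou. Qed.

Lemma open_push (phi : Chat -> Chat) V : unif_open phi -> open V -> open (phi @` V).
Proof.
move=> ophi oV; rewrite openE => _ [z Vz <-].
have /snbhsP[r r0 rV] : nbhs z V by apply: open_nbhs_nbhs.
have [d d0 H] := ophi r r0; rewrite /interior; apply/snbhsP; exists d => // y /H[t /rV Vt <-].
by exists t.
Qed.

(** Normality at z passes to f_i z, because f_i is open and the semigroup is
    stable under composition with f_i on the right. *)
Lemma julia_backward1 i z : julia f (f i z) -> julia f z.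
Proof.
apply: contra_not => -[V [oV Vz nV]].
have ofi := rational_unif_open (hf i).
exists (f i @` V); split; [exact: open_push|by exists z|].
apply: (normal_push oV ofi _ nV) => _ [w w0 <-].
by exists (i :: w).
Qed.

Lemma julia_backward w z : julia f (fword f w z) -> julia f z.
Proof. by elim: w z => [|i w IH] z //= /IH/julia_backward1. Qed.

(** In a sequence of the semigroup infinitely many words have the same first
    letter i, so normality at all the points f_i z gives normality at z. *)
Lemma julia_forward z : julia f z -> exists i, julia f (f i z).
Proof.
move=> Jz; apply: contrapT => none; apply: Jz.
have /(_ _)/cid-/all_sig[V HV] i : fatou f (f i z).
  by apply: contrapT => Ji; apply: none; exists i.
have [d d0 dV] : exists2 d : R, 0 < d & forall i y, sdst z y < d -> V i (f i y).
  have /(_ _)/cid2-/all_sig2[d d0 dV] i : exists2 d : R, 0 < d & forall y, sdst z y < d -> V i (f i y).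
    have [oV Vz _] := HV i.
    have /snbhsP[r r0 rV] : nbhs (f i z) (V i) by apply: open_nbhs_nbhs.
    by have [d d0 H] := rational_scont (hf i) z r0; exists d => // y /H/rV.
  exists (\big[Num.min/1]_i d i); last first.
    move=> i y zy; apply: dV; apply: lt_le_trans zy _.
    by rewrite (bigD1 i) //= ge_min lexx.
  by elim/big_ind: _ => // x y x0 y0; rewrite lt_min x0.
have /snbhsP zW : exists2 e : R, 0 < e & forall y, sdst z y < e -> [set y | sdst z y < d] y.
  by exists d.
exists (interior [set y | sdst z y < d]); split.
- exact: open_interior.
- exact: zW.
move=> g gG.
have /(_ _)/cid2-/all_sig2[w w0 gw] n := gG n.
have uE n : exists i, exists w', w n = i :: w'.
  by case: (w n) (w0 n) => // i w' _; exists i, w'.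
have /(_ _)/cid-/all_sig[c cP] n := uE n.
have /(_ _)/cid-/all_sig[w' wE] n := cP n.
have [i [k [kinc ki]]] := subseq_const c.
have [b [l [linc lb]]] := subseq_const (fun n => w' (k n) == [::]).
have kl_inc : {homo (k \o l) : m n / (m < n)%N} by move=> m n /linc/kinc.
have gE n : g (k (l n)) = fword f (w' (k (l n))) \o f i.
  by rewrite -gw wE ki.
have inW y : interior [set y | sdst z y < d] y -> sdst z y < d.
  by move=> /interior_subset.
case: b lb => lb.
  exists (k \o l), (f i); split => //; apply/luc_iff => y Wy; exists 1 => // e e0.
  exists 0 => n _ t Wt _; rewrite /= gE; move/eqP: (lb n) => ->.
  by rewrite /= sdstxx.
have [oV Vz nV] := HV i.
have nP := @normal_pull R (semigroup f) [set g' \o f i | g' in semigroup f] (f i) (V i)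
   (interior [set y | sdst z y < d]) _ _ _ nV.
have [] := nP _ _ _ (fun n => g (k (l n))).
- by move=> y /inW; exact: dV.
- move=> y e _ e0; have [r r0 H] := rational_scont (hf i) y e0.
  by exists r => // t _; exact: H.
- by move=> _ [g' Gg' <-]; exists g'.
- move=> n; exists (fword f (w' (k (l n)))); last by rewrite gE.
  by apply: semigroup_fword; apply/eqP; rewrite lb.
move=> m [h [minc mh]]; exists (fun n => k (l (m n))), h; split => //.
by move=> p q /minc/linc/kinc.
Qed.

Hypothesis Finf : fatou f None.

Lemma julia_finite z : julia f z -> exists z', z = Some z'.
Proof. by case: z => [z'|//] _; exists z'. Qed.

Lemma julia_bounded : exists2 A : R, 0 < A & forall z, julia f (Some z) -> cmod z <= A.
Proof.
have : nbhs (None : Chat) (fatou f) by apply: open_nbhs_nbhs; split => //; exact: julia_open_fatou.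
move=> /snbhsP[e e0 eF]; exists (2 / e + 1) => [|z Jz].
  by rewrite ltr_wpDl // divr_ge0 // ltW.
rewrite leNgt; apply/negP => zA; apply: Jz; apply: eF.
have z0 : z != 0.
  by rewrite -cmod_gt0; apply: lt_trans zA; rewrite ltr_wpDl // divr_ge0 // ltW.
rewrite -sdst_sinv /= (negbTE z0) (le_lt_trans (sdst_le_cmod _ _)) // sub0r cmodN cmodV.
rewrite ltr_pdivrMr ?cmod_gt0 // mulrC -ltr_pdivrMr //; lra.
Qed.

Definition jorbit (om : nat -> 'I_u) (x : nat -> C) := forall n,
  julia f (Some (x n)) /\ f (om n) (Some (x n)) = Some (x n.+1).

Lemma jorbit_exists z : julia f (Some z) -> exists om x, jorbit om x /\ x 0%N = z.
Proof.
move=> Jz.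
have next y : exists iy : 'I_u * C, julia f (Some y) ->
    f iy.1 (Some y) = Some iy.2 /\ julia f (Some iy.2).
  have [Jy|nJ] := pselect (julia f (Some y)).
    have [i Ji] := julia_forward Jy; have [y' fy] := julia_finite Ji.
    by exists (i, y') => _ /=; rewrite -fy.
  by have [i _] := julia_forward Jz; exists (i, y).
have /(_ _)/cid-/all_sig[s sP] y := next y.
pose x := fix x n := if n is n'.+1 then (s (x n')).2 else z.
have Jx n : julia f (Some (x n)) by elim: n => //= n /sP[].
by exists (fun n => (s (x n)).1), x; split => // n; split => //=; have [] := sP _ (Jx n).
Qed.

Definition seg (om : nat -> 'I_u) (j n : nat) : seq 'I_u := [seq om k | k <- iota j (n - j)].

Lemma size_seg om j n : size (seg om j n) = (n - j)%N.
Proof. by rewrite size_map size_iota. Qed.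

Lemma seg_cat om j k n : (j <= k <= n)%N -> seg om j n = seg om j k ++ seg om k n.
Proof.
move=> /andP[jk kn]; rewrite /seg -map_cat; congr map.
by rewrite -{2}(subnKC jk) -iotaD; congr iota; lia.
Qed.

Lemma seg_cons om j n : (j < n)%N -> seg om j n = om j :: seg om j.+1 n.
Proof. by move=> jn; rewrite /seg -(subnSK jn). Qed.

Lemma seg_orbit om (x : nat -> C) j n : (j <= n)%N ->
  (forall k, (j <= k < n)%N -> f (om k) (Some (x k)) = Some (x k.+1)) ->
  fword f (seg om j n) (Some (x j)) = Some (x n).
Proof.
elim: n => [|n IH]; first by rewrite leqn0 => /eqP ->.
rewrite leq_eqVlt => /orP[/eqP -> _|jn H]; first by rewrite /seg subnn.
rewrite (@seg_cat _ _ n) ?leqnSn ?andbT // fword_cat /= IH //; last first.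
  by move=> k /andP[jk kn]; apply: H; rewrite jk ltnW.
by rewrite seg_cons // /seg subnn /= H // leqnn -ltnS jn.
Qed.

Lemma seg0 om n : seg om 0 n = initial om n.
Proof. by rewrite /seg subn0. Qed.

End WordMaps.

(** * The maximum principle and maps omitting a disc *)

Section MaximumModulus.
Context {R : realType}.
Local Notation C := R[i].
Local Notation Chat := (sphere R).
Implicit Types (A D : {poly C}).

Lemma near_some (z : C) (e : R) : 0 < e -> exists2 d : R, 0 < d &
  forall y : Chat, sdst (Some z) y < d -> exists2 w, y = Some w & cmod (w - z) < e.
Proof. exact: (@uncoord_near _ (Some z)). Qed.

Lemma closed_disc (x : C) (r : R) : 0 <= r ->
  closed ((Some : C -> Chat) @` [set z | cmod (z - x) <= r]).
Proof.
move=> r0; rewrite -openC openE => y Ky; rewrite /interior; apply/snbhsP.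
case: y Ky => [w|] Ky.
  have wr : 0 < cmod (w - x) - r.
    by rewrite subr_gt0 ltNge; apply/negP => wx; apply: Ky; exists w.
  have [d d0 H] := near_some w wr; exists d => // y /H[v -> vw] [v' v'x [vv']].
  rewrite /= vv' in v'x; have := cmod_triangle v w x; rewrite (cmodB w v); lra.
have e0 : 0 < (cmod x + r + 1)^-1 by rewrite invr_gt0 ltr_wpDl // addr_ge0 ?cmod_ge0.
have [d d0 H] := uncoord_near (None : Chat) e0; exists d => // y /H[v -> vx] [v' /= v'x].
move: vx; rewrite /= subr0; case: (eqVneq v 0) => // v0 vx [] vv'.
have : cmod v' <= cmod x + r by have := cmod_lowerB v' x; lra.
rewrite vv' cmodV => h.
have : cmod x + r + 1 < (cmod v)^-1; last by lra.
by rewrite -[X in X < _]invrK ltf_pV2 ?posrE ?cmod_gt0.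
Qed.

Lemma ratio_cmod_continuous A D (z : C) : D.[z] != 0 ->
  {for (Some z : Chat), continuous (fun y : Chat => cmod (A.[fin y] / D.[fin y]))}.
Proof.
move=> Dz; have [T [TD _ TL]] := ratio_dq A D.
have [e [K [e0 K0 H]]] := TL z Dz; have [_ [e' e'0 Dnz]] := loclipV Dz.
move=> B /nbhs_ballP[r /= r0 rB]; have K1 : 0 < K + 1 by lra.
have [|d d0 Hd] := @near_some z (Num.min (Num.min e e') (r / (K + 1))).
  by rewrite !lt_min e0 e'0 divr_gt0.
apply/snbhsP; exists d => // y /Hd[w ->].
rewrite !lt_min ltr_pdivlMr // => /andP[/andP[we we'] wr]; apply: rB.
have zz : cmod (z - z) < e by rewrite subrr cmod0.
have bd : cmod (A.[w] / D.[w] - A.[z] / D.[z]) < r.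
  rewrite TD ?Dz ?Dnz // cmodM; have [h _] := H w z z we zz zz.
  by have := cmod_ge0 (w - z); have := cmod_ge0 (T w z); nra.
rewrite /ball /= ltr_norml.
have := cmod_lowerB (A.[w] / D.[w]) (A.[z] / D.[z]).
have := cmod_lowerB (A.[z] / D.[z]) (A.[w] / D.[w]).
by rewrite (cmodB (A.[z] / D.[z])); move=> *; apply/andP; split; lra.
Qed.

(** At an interior maximum, openness of A / D provides a point where the
    modulus is larger, unless A / D is constant. *)
Lemma max_modulus A D (x : C) (r M : R) : 0 < r ->
  (forall z, cmod (z - x) <= r -> D.[z] != 0) ->
  (forall z, cmod (z - x) = r -> cmod A.[z] <= M * cmod D.[z]) ->
  forall z, cmod (z - x) <= r -> cmod A.[z] <= M * cmod D.[z].
Proof.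
move=> r0 Dnz bdry.
pose K := (Some : C -> Chat) @` [set z | cmod (z - x) <= r].
have K0 : K !=set0 by exists (Some x), x => //=; rewrite subrr cmod0 ltW.
have cK : compact K.
  apply: (@subclosed_compact Chat K setT); [exact: closed_disc (ltW r0)|exact: compact_sphere|exact: subsetT].
have [|_ /set_mem[c cr <-] cmax] := compact_EVT_max K0 cK (f := fun y : Chat => cmod (A.[fin y] / D.[fin y])).
  by apply: continuous_in_subspaceT => _ /set_mem[z zr <-]; apply/ratio_cmod_continuous/Dnz.
have cm z : cmod (z - x) <= r -> cmod (A.[z] / D.[z]) <= cmod (A.[c] / D.[c]).
  by move=> zr; apply: (cmax (Some z)); apply/mem_set; exists z.
pose b := x + (r%:C)%C; have br : cmod (b - x) = r.
  by rewrite /b addrAC subrr add0r cmodR gtr0_norm.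
have Dpos z : cmod (z - x) <= r -> 0 < cmod D.[z] by move=> /Dnz; rewrite cmod_gt0.
have M0 : 0 <= M.
  have bb := bdry b br; have Db : 0 < cmod D.[b] by rewrite Dpos // br.
  by rewrite -(pmulr_lge0 _ Db) (le_trans (cmod_ge0 _) bb).
suff cM : cmod (A.[c] / D.[c]) <= M.
  move=> z zr; have := le_trans (cm z zr) cM.
  by rewrite cmodM cmodV ler_pdivrMr ?Dpos.
rewrite leNgt; apply/negP => Mc.
have cr' : cmod (c - x) < r.
  rewrite lt_neqAle cr andbT; apply/eqP => cxr.
  by move: Mc; rewrite cmodM cmodV ltr_pdivlMr ?Dpos // ltNge bdry.
set v0 := A.[c] / D.[c] in Mc cm.
have v00 : 0 < cmod v0 by exact: le_lt_trans Mc.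
have [Av|Av] := eqVneq (A - v0%:P * D) 0.
  have := bdry b br; have Db : 0 < cmod D.[b] by rewrite Dpos // br.
  have /eqP := congr1 (fun p : {poly C} => p.[b]) Av.
  by rewrite !hornerE subr_eq0 => /eqP ->; rewrite cmodM ler_pM2r // leNgt Mc.
have e0 : 0 < r - cmod (c - x) by rewrite subr_gt0.
have [d d0 H] := ratio_open (Dnz c cr) e0 Av.
pose t := d / 2 / cmod v0; have t0 : 0 < t by rewrite !divr_gt0.
have vv : cmod ((1 + t%:C%C) * v0 - v0) = d / 2.
  by rewrite mulrDl mul1r addrAC subrr add0r cmodM cmodR gtr0_norm // divfK // gt_eqF.
have [|z [zc Dz zv]] := H ((1 + t%:C%C) * v0); first by rewrite vv; lra.
have zr : cmod (z - x) <= r by have := cmod_triangle c z x; lra.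
have := cm z zr; rewrite zv cmodM.
have -> : cmod (1 + t%:C%C) = 1 + t.
  rewrite -[1]/(1%:C%C : C) -rmorphD cmodR gtr0_norm //; lra.
by rewrite mulrDl mul1r gerDl leNgt mulr_gt0.
Qed.

(** The Cauchy estimate at the centre, by the maximum principle for the
    divided difference of A / D with base point x. *)
Lemma bounded_ratio_lip A D (x : C) (e B : R) : 0 < e ->
  (forall z, cmod (z - x) <= e -> D.[z] != 0) ->
  (forall z, cmod (z - x) <= e -> cmod A.[z] <= B * cmod D.[z]) ->
  forall z, cmod (z - x) <= e ->
    cmod (A.[z] / D.[z] - A.[x] / D.[x]) <= 2 * B / e * cmod (z - x).
Proof.
move=> e0 Dnz AB.
have xe : cmod (x - x) <= e by rewrite subrr cmod0 ltW.
have Dpos z : cmod (z - x) <= e -> 0 < cmod D.[z] by move=> /Dnz; rewrite cmod_gt0.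
have /factor_theorem[Q QE] : root (D.[x] *: A - A.[x] *: D) x.
  by rewrite /root !hornerE mulrC subrr.
have QEz z : D.[x] * A.[z] - A.[x] * D.[z] = Q.[z] * (z - x).
  by have := congr1 (fun p : {poly C} => p.[z]) QE; rewrite !hornerE.
have key z : cmod (z - x) <= e ->
    cmod (D.[x] * A.[z] - A.[x] * D.[z]) <= 2 * B * cmod D.[x] * cmod D.[z].
  move=> ze; rewrite (le_trans (cmodD _ _)) // cmodN !cmodM.
  have := ler_wpM2l (cmod_ge0 D.[x]) (AB z ze).
  have := ler_wpM2r (cmod_ge0 D.[z]) (AB x xe); lra.
have bd z : cmod (z - x) = e -> cmod Q.[z] <= 2 * B * cmod D.[x] / e * cmod D.[z].
  move=> ze; have := key z; rewrite ze lexx QEz cmodM ze => /(_ isT).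
  by rewrite -ler_pdivlMr // => /le_trans; apply; rewrite mulrAC.
move=> z ze; have := max_modulus e0 Dnz bd ze => Qz.
have -> : A.[z] / D.[z] - A.[x] / D.[x] = Q.[z] * (z - x) / (D.[x] * D.[z]).
  by rewrite -QEz; field; rewrite !Dnz.
rewrite !cmodM cmodV cmodM mulrAC ler_wpM2r ?cmod_ge0 // ler_pdivrMr ?mulr_gt0 ?Dpos //.
by apply: (le_trans Qz); rewrite le_eqVlt; apply/orP; left; apply/eqP; ring.
Qed.

End MaximumModulus.

Section WordPolynomials.
Context {R : realType} {u : nat}.
Local Notation C := R[i].
Local Notation Chat := (sphere R).
Variable f : 'I_u -> Chat -> Chat.
Hypothesis hf : forall i, nonconstant_rational (f i).

Lemma hmap_scale (c a b : C) : c != 0 -> hmap (c * a) (c * b) = hmap a b.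
Proof.
move=> c0; rewrite /hmap mulf_eq0 (negbTE c0) /=; case: ifP => // b0.
by rewrite -mulf_div divff // mul1r.
Qed.

(** The polynomial s (p / q) with its denominators cleared; at the zeros of
    q only the leading term survives. *)
Lemma homogenize n (s p q : {poly C}) : (size s <= n.+1)%N ->
  exists h : {poly C}, forall z,
    (q.[z] != 0 -> h.[z] = q.[z] ^+ n * s.[p.[z] / q.[z]]) /\
    (q.[z] = 0 -> h.[z] = p.[z] ^+ n * s`_n).
Proof.
move=> sn; exists (\sum_(k < n.+1) s`_k *: (p ^+ k * q ^+ (n - k))) => z; split=> qz.
  rewrite horner_sum (horner_coef_wide _ sn) mulr_sumr; apply: eq_bigr => k _.
  have kn : (k <= n)%N by rewrite -ltnS.
  rewrite !(hornerE, horner_exp) exprB ?unitfE // exprMn exprVn.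
  by rewrite /= -!mulrA [RHS]mulrCA; congr (_ * _); rewrite [RHS]mulrCA.
rewrite horner_sum big_ord_recr /= subnn expr0 mulr1 hornerZ horner_exp mulrC.
rewrite big1 ?add0r // => k _.
by rewrite !(hornerE, horner_exp) qz expr0n subn_eq0 leqNgt ltn_ord /= !mulr0.
Qed.

(** Iterates enter the maximum principle as quotients of polynomials. *)
Lemma fword_polys w : exists P Q : {poly C}, forall z,
  (P.[z] != 0 \/ Q.[z] != 0) /\ fword f w (Some z) = hmap P.[z] Q.[z].
Proof.
elim/last_ind: w => [|w i [P [Q PQ]]].
  exists 'X, 1 => z; rewrite !hornerE; split; first by right; exact: oner_neq0.
  by rewrite /hmap (negbTE (oner_neq0 _)) divr1.
have [d d0 [p [q [pq pqd fiE]]]] := hf i; set n := ratdeg p q in pqd.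
have sp : (size p <= n.+1)%N by rewrite (leq_trans (leq_maxl _ (size q))) // leqSpred.
have sq : (size q <= n.+1)%N by rewrite (leq_trans (leq_maxr (size p) _)) // leqSpred.
have [h1 H1] := homogenize P Q sp; have [h2 H2] := homogenize P Q sq.
exists h1, h2 => z; have [nz E] := PQ z; rewrite fword_rcons /= E fiE.
have [h1n h1z] := H1 z; have [h2n h2z] := H2 z.
have [Qz|Qz] := eqVneq Q.[z] 0; last first.
  have qn : Q.[z] ^+ n != 0 by rewrite expf_neq0.
  rewrite h1n // h2n // hmap_scale // /hmap (negbTE Qz); split => //=.
  rewrite !mulf_eq0 (negbTE qn) /=; exact: common_root_coprime.
have Pz : P.[z] != 0 by case: nz => //; rewrite Qz eqxx.
have pn : P.[z] ^+ n != 0 by rewrite expf_neq0.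
rewrite h1z // h2z // hmap_scale // {1}/hmap Qz eqxx; split => //=.
rewrite !mulf_eq0 (negbTE pn) /=; exact: ratdeg_coef.
Qed.

(** After an inversion centred in the omitted disc, f_w is bounded by 1 / r,
    so its expansion is bounded by the Cauchy estimate, independently of w.
    This replaces Montel's theorem. *)
Lemma fword_omit_lip w (x b : C) (e r : R) : 0 < e -> 0 < r ->
  (forall z v, cmod (z - x) <= e -> fword f w (Some z) = Some v -> r <= cmod (v - b)) ->
  forall z vz vx, cmod (z - x) <= e ->
    fword f w (Some z) = Some vz -> fword f w (Some x) = Some vx ->
    cmod ((vz - b)^-1 - (vx - b)^-1) <= 2 / (r * e) * cmod (z - x).
Proof.
move=> e0 r0 omit; have [P [Q PQ]] := fword_polys w.
pose D := P - b *: Q.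
have low z : cmod (z - x) <= e -> r * cmod Q.[z] <= cmod D.[z].
  move=> ze; rewrite !hornerE; have [nz E] := PQ z.
  have [->|Qz] := eqVneq Q.[z] 0; first by rewrite cmod0 mulr0 cmod_ge0.
  have := omit z (P.[z] / Q.[z]) ze; rewrite E /hmap (negbTE Qz) => /(_ erefl).
  have -> : P.[z] - b * Q.[z] = (P.[z] / Q.[z] - b) * Q.[z] by rewrite mulrBl divfK.
  by move=> h; rewrite cmodM ler_wpM2r ?cmod_ge0.
have Dnz z : cmod (z - x) <= e -> D.[z] != 0.
  move=> ze; apply/eqP => Dz; have [nz _] := PQ z.
  have := low z ze; rewrite Dz cmod0 pmulr_rle0 // => Qz.
  have Q0 : Q.[z] = 0 by apply/eqP; rewrite -cmod_eq0 eq_le Qz cmod_ge0.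
  by case: nz; rewrite ?Q0 ?eqxx //; move: Dz; rewrite !hornerE Q0 mulr0 subr0 => ->; rewrite eqxx.
have QD z : cmod (z - x) <= e -> cmod Q.[z] <= r^-1 * cmod D.[z].
  by move=> ze; rewrite ler_pdivlMl // low.
have inv z v : cmod (z - x) <= e -> fword f w (Some z) = Some v -> (v - b)^-1 = Q.[z] / D.[z].
  move=> ze; have [nz ->] := PQ z; rewrite /hmap; case: ifPn => // Qz [<-].
  rewrite !hornerE; have -> : P.[z] - b * Q.[z] = (P.[z] / Q.[z] - b) * Q.[z].
    by rewrite mulrBl divfK.
  by rewrite invfM mulrCA divff // mulr1.
move=> z vz vx ze fz fx; rewrite (inv z) // (inv x) ?subrr ?cmod0 ?(ltW e0) //.
have := bounded_ratio_lip e0 Dnz QD ze; rewrite invfM mulrA //.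
Qed.

End WordPolynomials.

(** * Components of preimages *)

Section ConnectedComponents.
Context {R : realType}.
Local Notation C := R[i].
Local Notation Chat := (sphere R).

Lemma sphere_hausdorff : hausdorff_space Chat.
Proof.
move=> x y cl; apply: sdst_eq0; apply/eqP; rewrite eq_le sdst_ge0 andbT.
apply/ler_addgt0Pr => e e0; rewrite add0r.
have [||z [/= xz yz]] := cl [set z | sdst x z < e / 2] [set z | sdst y z < e / 2].
- by apply/snbhsP; exists (e / 2) => //; rewrite divr_gt0.
- by apply/snbhsP; exists (e / 2) => //; rewrite divr_gt0.
by have := sdst_triangle z x y; rewrite (sdstC z); lra.
Qed.

Lemma connected_chart_disc (p : Chat) (w0 : C) (d : R) : 0 < d ->
  connected (uncoord p @` B2 w0 d).
Proof.
move=> d0; pose s (w : C) (t : R) : Chat := uncoord p (w0 + (t%:C)%C * (w - w0)).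
have -> : uncoord p @` B2 w0 d = \bigcup_(w in B2 w0 d) (s w @` `[0, 1]%classic).
  apply/seteqP; split => [_ [w wd <-]|_ [w wd [t t01 <-]]].
    exists w => //; exists 1; rewrite /= ?in_itv /= ?lexx ?ler01 //.
    by rewrite /s mul1r addrC subrK.
  move: t01; rewrite /= in_itv /= => /andP[t0 t1]; exists (w0 + (t%:C)%C * (w - w0)) => //.
  rewrite /B2 /= addrAC subrr add0r cmodM cmodR ger0_norm //.
  apply: le_lt_trans (_ : cmod (w - w0) < d) => //.
  by rewrite -[leRHS]mul1r ler_wpM2r ?cmod_ge0.
apply: bigcup_connected.
  exists (uncoord p w0) => w wd; exists 0; rewrite /= ?in_itv /= ?lexx ?ler01 //.
  by rewrite /s mul0r addr0.
move=> w _; apply: connected_continuous_connected.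
  exact: segment_connected.
apply: continuous_subspaceT => t A /snbhsP[e e0 eA].
have k0 : 0 < 2 * (cmod (w - w0) + 1).
  by rewrite mulr_gt0 // ltr_wpDl ?cmod_ge0.
apply/nbhs_ballP; exists (e / (2 * (cmod (w - w0) + 1))); first by rewrite /= divr_gt0.
move=> t' tt'; apply: eA; apply: (le_lt_trans (sdst_uncoord _ _ _)).
rewrite opprD addrACA subrr add0r -mulrBl cmodM -rmorphB cmodR.
move: tt'; rewrite /ball /= ltr_pdivlMr // => tt'.
by have := normr_ge0 (t - t'); have := cmod_ge0 (w - w0); nra.
Qed.

Lemma open_chart_disc (x : C) (r : R) : open ((Some : C -> Chat) @` B2 x r).
Proof.
rewrite openE => _ [w wr <-]; rewrite /interior; apply/snbhsP.
have e0 : 0 < r - cmod (w - x) by rewrite subr_gt0.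
have [d d0 H] := near_some w e0; exists d => // y /H[v -> vw]; exists v => //.
by rewrite /B2 /=; have := cmod_triangle w v x; lra.
Qed.

Variable F : Chat -> Chat.
Hypothesis Fc : scont F.

(** Nearby points are joined by a disc in a chart. *)
Lemma component_open (B : set Chat) y : open B -> open (connected_component (F @^-1` B) y).
Proof.
move=> oB; have oFB : open (F @^-1` B).
  by apply: open_comp => // z _; exact: scont_continuous.
rewrite openE => z Pz; rewrite /interior.
have Bz : (F @^-1` B) z by apply: connected_component_sub Pz.
have /snbhsP[r r0 rB] : nbhs z (F @^-1` B) by apply: open_nbhs_nbhs.
have h0 : 0 < r / 2 by rewrite divr_gt0.
have [d d0 H] := uncoord_near z h0; apply/snbhsP; exists d => // t zt.
apply: (connected_component_trans Pz).
apply: (@connected_component_max _ _ (uncoord z @` B2 (coord z z) (r / 2))).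
- by exists (coord z z); [exact: B2_center|exact: uncoord_coord].
- move=> _ [w wr <-]; apply: rB; rewrite -{1}(uncoord_coord z).
  apply: (le_lt_trans (sdst_uncoord _ _ _)); rewrite cmodB.
  by move: wr; rewrite /B2 /=; lra.
- exact: connected_chart_disc.
- by have [w tw wz] := H t zt; exists w.
Qed.

(** Components of preimages of a disc under an open map are mapped onto the
    disc: the image of a component is open, and closed in the disc since the
    sphere is compact. *)
Lemma component_onto (x : C) (r : R) y : 0 < r -> unif_open F ->
  (Some @` B2 x r) (F y) -> forall v, B2 x r v ->
  exists2 z, connected_component (F @^-1` (Some @` B2 x r)) y z & F z = Some v.
Proof.
move=> r0 Fo; set B : set Chat := Some @` B2 x r => By v xv.
have oB : open B by exact: open_chart_disc.
have cB : connected B by exact: (@connected_chart_disc (Some 0)).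
set P := connected_component _ y.
have Py : P y by exact: connected_component_refl.
have oQ : open (F @` P) by apply: open_push => //; exact: component_open.
have QB : F @` P `<=` B by move=> _ [z Pz <-]; apply: connected_component_sub Pz.
have cQ : closed (F @` closure P).
  apply: (compact_closed sphere_hausdorff); apply: continuous_compact.
    by apply: continuous_subspaceT; exact: scont_continuous.
  by apply: (@subclosed_compact Chat _ setT); [exact: closed_closure|exact: compact_sphere|].
suff FP : F @` P = B.
  have [z Pz zv] : (F @` P) (Some v) by rewrite FP; exists v.
  by exists z.
apply: cB.
- by exists (F y), y.
- by exists (F @` P) => //; apply/seteqP; split => [t Pt|t []//]; split => //; exact: QB.
exists (F @` closure P) => //; apply/seteqP; split=> [t Pt|t [Bt [p clp pt]]].
  by split; [exact: QB|case: Pt => z Pz <-; exists z => //; exact: subset_closure].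
have Bp : (F @^-1` B) p by rewrite /= pt.
have [z [Pz pz]] : P `&` connected_component (F @^-1` B) p !=set0.
  apply: clp; apply: open_nbhs_nbhs; split; first exact: component_open.
  exact: connected_component_refl.
exists p => //; apply: (connected_component_trans Pz).
exact: connected_component_sym.
Qed.

Lemma component_image (F' : Chat -> Chat) (B : set Chat) y z : 
  connected_component ((F' \o F) @^-1` B) y z ->
  connected_component (F' @^-1` B) (F y) (F z).
Proof.
move=> Pz; apply: (@connected_component_max _ _ (F @` connected_component ((F' \o F) @^-1` B) y)).
- exists y => //; apply: connected_component_refl; apply: connected_component_sub.
  exact: connected_component_sym Pz.
- by move=> _ [t Pt <-]; have := connected_component_sub Pt.
- apply: connected_continuous_connected; first exact: component_connected.
  by apply: continuous_subspaceT; exact: scont_continuous.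
- by exists z.
Qed.

Lemma componentS (A B : set Chat) y : A `<=` B -> 
  connected_component A y `<=` connected_component B y.
Proof.
move=> AB z Pz; apply: (@connected_component_max _ _ (connected_component A y)) => //.
- apply: connected_component_refl; apply: connected_component_sub.
  exact: connected_component_sym Pz.
- by move=> t /connected_component_sub/AB.
- exact: component_connected.
Qed.

End ConnectedComponents.

(** * Finite invariant sets and total ramification *)

Section Periodic.
Context {R : realType}.
Local Notation C := R[i].
Local Notation Chat := (sphere R).

Lemma geometric_small (q K e : R) : 0 < q < 1 -> 0 < K -> 0 < e ->
  exists N, forall n, (N <= n)%N -> K * q ^+ n < e.
Proof.
move=> /andP[q0 q1] K0 e0.
have q1' : `|q| < 1 by rewrite gtr0_norm.
have /cvgrPdist_lt /(_ _ (divr_gt0 e0 K0)) [N _ HN] := cvg_expr q1'.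
exists N => n Nn; have := HN n Nn.
by rewrite /= sub0r normrN ger0_norm ?exprn_ge0 ?(ltW q0) // ltr_pdivlMr // mulrC.
Qed.

(** Preimages in A define a right inverse r of h on A. As A is finite, the
    orbit of c under r repeats, and h carries the repetition back to c. *)
Lemma finite_periodic (h : Chat -> Chat) (A : set Chat) : finite_set A ->
  (forall y, A (h y) -> A y) -> (forall v, A v -> exists y, h y = v) ->
  forall c, A c -> exists2 k, (0 < k)%N & iter k h c = c.
Proof.
move=> /finite_setP[n]; move=> An; have /finite_seqP[s As] : finite_set A by exists n.
move=> back onto c Ac.
have pre v : exists y, A v -> A y /\ h y = v.
  have [Av|nA] := pselect (A v); last by exists v.
  by have [y hy] := onto v Av; exists y => _; split => //; apply: back; rewrite hy.
have /(_ _)/cid-/all_sig[r rP] v := pre v.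
have Ar k : A (iter k r c) by elim: k => //= k /rP[].
have hr k y : A y -> iter k h (iter k r y) = y.
  elim: k => // k IH Ay; rewrite iterSr /= (rP _ _).2 ?IH //.
  by elim: (k) => //= j /rP[].
have [i [j [ij rij]]] : exists i j, (i < j)%N /\ iter i r c = iter j r c.
  apply: contrapT => none.
  have : (size [seq iter k r c | k <- iota 0 (size s).+1] <= size s)%N.
    apply: uniq_leq_size.
      rewrite map_inj_in_uniq ?iota_uniq // => i j _ _ rij.
      by case: (ltngtP i j) => // ij; case: none; [exists i, j|exists j, i].
    by move=> _ /mapP[k _ ->]; have := Ar k; rewrite As.
  by rewrite size_map size_iota ltnn.
exists (j - i)%N; first by rewrite subn_gt0.
have cE : iter (j - i) r c = c.
  rewrite -[RHS](hr i) // rij -{2}(subnKC (ltnW ij)) iterD hr //.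
have := hr (j - i)%N c Ac; rewrite cE //.
Qed.

(** The value at infinity is not v, so p - v q has degree d; as c is its
    only root and d is at least 2, it is a double root. *)
Lemma total_ramification_crit (g : Chat -> Chat) d (c v : C) : (2 <= d)%N ->
  rational_of_degree g d -> g (Some c) = Some v ->
  (forall y, g y = Some v -> y = Some c) -> crit g (Some c).
Proof.
move=> d2 [p [q [pq pqd gE]]] gc uniqc.
pose s := p - v *: q.
have qc : q.[c] != 0 by move: gc; rewrite gE /=; case: ifP.
have pv : p.[c] = v * q.[c].
  by move: gc; rewrite gE /= (negbTE qc) => -[<-]; rewrite divfK.
have sd : s`_d != 0.
  apply/eqP => sd0; suff : g None = Some v by move=> /uniqc.
  have pd : p`_d = v * q`_d by move: sd0; rewrite coefB coefZ => /eqP; rewrite subr_eq0 => /eqP.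
  rewrite gE /= pqd; case: ifPn => [/eqP qd|qd]; last by rewrite pd mulfK.
  by case: (ratdeg_coef pq); rewrite pqd ?pd qd ?mulr0 eqxx.
have sroot r : root s r -> r = c.
  rewrite /root !hornerE subr_eq0 => /eqP pr.
  have qr : q.[r] != 0.
    by apply/eqP => qr; case: (common_root_coprime r pq); rewrite ?pr qr ?mulr0 eqxx.
  suff /uniqc[] : g (Some r) = Some v by [].
  by rewrite gE /= (negbTE qr) pr mulfK.
have [t tE] : exists t, s = t * ('X - c%:P) * ('X - c%:P).
  have /factor_theorem[t1 t1E] : root s c by rewrite /root !hornerE pv subrr.
  have [t1c|t1c] := boolP (root t1 c).
    by have /factor_theorem[t tE] := t1c; exists t; rewrite t1E tE.
  have [t1s|/closed_rootP[r t1r]] := eqVneq (size t1) 1%N.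
    have : (size s <= d)%N.
      by rewrite t1E size_Mmonic ?monicXsubC ?size_XsubC ?t1s // -size_poly_gt0 t1s.
    by move=> sz; move: sd; rewrite nth_default ?eqxx.
  case/negP: t1c; have rc : r = c by apply: sroot; rewrite t1E rootM t1r.
  by rewrite -rc.
have [[e [K [e0 K0 H]]] [e' e'0 qnz]] := (loclipM (loclip_poly c t) (loclipV qc).1, (loclipV qc).2).
rewrite critE; apply: (has_cderiv_derivable _).2 => e1 e10.
have K1 : 0 < K + 1 by lra.
exists (Num.min (Num.min e e') (e1 / (K + 1))); first by rewrite !lt_min e0 e'0 divr_gt0.
move=> w; rewrite /= !lt_min ltr_pdivlMr // => /andP[/andP[we we'] w1].
rewrite /chart_map /= !gc gE /= (negbTE (qnz _ we')) mul0r subr0 /=.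
have -> : p.[w] / q.[w] - v = (w - c) * ((w - c) * (t.[w] * (q.[w])^-1)).
  have sw : p.[w] - v * q.[w] = t.[w] * (w - c) * (w - c).
    by have := congr1 (fun p : {poly C} => p.[w]) tE; rewrite !hornerE.
  rewrite -[v in LHS](mulfK (qnz _ we')) -mulrBl sw; ring.
rewrite cmodM mulrC ler_wpM2r ?cmod_ge0 // cmodM.
have [h _] := H w w w we we we; have := cmod_ge0 (w - c).
have := ler_wpM2l (cmod_ge0 (w - c)) h; rewrite /=; lra.
Qed.

End Periodic.

(** * Shadowing and transitivity on the Julia set *)

Section Dynamics.
Context {R : realType} {u : nat}.
Local Notation C := R[i].
Local Notation Chat := (sphere R).
Variable f : 'I_u -> Chat -> Chat.
Hypothesis hf : forall i, nonconstant_rational (f i).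

(** The exponential bound provided by R_*, with q standing for exp (-
    alpha). *)
Definition shrinking (Rs K q : R) := forall (x : C) (w : seq 'I_u) y,
  julia f (Some x) -> (Some @` B2 x Rs) (fword f w y) ->
  ediam_le (connected_component (fword f w @^-1` (Some @` B2 x Rs)) y) (K * q ^+ size w).

Lemma Rstar_shrinking Rs : Rstar f Rs -> exists K q : R,
  [/\ 0 < Rs, 0 < K, 0 < q < 1 & shrinking Rs K q].
Proof.
move=> [Rs0 _ [K [a [K0 a0 H]]]]; exists K, (expR (- a)); split => //.
  by rewrite expR_gt0 expR_lt1 oppr_lt0.
move=> x w y Jx By; have [_] := H x w Jx y By.
by rewrite -mulNr -expRM_natr.
Qed.

(** For finitely many lengths [connected_fiber_small] can be iterated. This
    covers the lengths at which the exponential bound is not yet small. *)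
Lemma words_small N (e : R) : 0 < e -> exists2 d : R, 0 < d &
  forall w, (size w <= N)%N -> forall (E : set Chat) x, connected E ->
    (forall y, E y -> sdst (fword f w y) x < d) -> forall y y', E y -> E y' -> sdst y y' < e.
Proof.
have small0 (e1 : R) (E : set Chat) x : (forall y, E y -> sdst y x < e1 / 2) ->
    forall y y', E y -> E y' -> sdst y y' < e1.
  move=> Ex y y' /Ex h1 /Ex; rewrite sdstC => h2.
  by have := sdst_triangle x y y'; lra.
elim: N e => [|N IH] e e0.
  exists (e / 2); first by rewrite divr_gt0.
  by move=> [|//] _ E x _; exact: small0.
have /(_ _)/cid2-/all_sig2[d d0 dH] i := connected_fiber_small (hf i) e0.
pose m := \big[Num.min/1]_i d i.
have m0 : 0 < m by rewrite /m; elim/big_ind: _ => // x y x0 y0; rewrite lt_min x0.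
have [r r0 rH] := IH m m0; exists (Num.min r (e / 2)); first by rewrite lt_min r0 divr_gt0.
case=> [_|i w] /=.
  move=> E x _ Ex; apply: (small0 _ _ x) => y Ey.
  by have := Ex y Ey; rewrite lt_min => /andP[].
rewrite ltnS => wN E x cE Ex y y' Ey Ey'; apply: (dH i E (f i y)) => // t Et.
have cfE : connected (f i @` E).
  apply: connected_continuous_connected => //; apply: continuous_subspaceT.
  by apply: scont_continuous; exact: rational_scont.
have := rH w wN _ x cfE _ (f i t) (f i y) => /(_ _ (imageP _ Et) (imageP _ Ey)) h.
apply: lt_le_trans (h _) _; last by rewrite /m (bigD1 i) //= ge_min lexx.
by move=> _ [t' /Ex h' <-]; move: h'; rewrite lt_min => /andP[].
Qed.

Hypothesis Finf : fatou f None.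
Variables Rs K q : R.
Hypotheses (Rs0 : 0 < Rs) (K0 : 0 < K) (q01 : 0 < q < 1) (shr : shrinking Rs K q).

Let q0 : 0 < q. Proof. by case/andP: q01. Qed.

(** The component of the preimage that contains y is mapped onto the disc. *)
Lemma pull_back (x v0 v : C) w y : julia f (Some x) -> fword f w y = Some v0 ->
  B2 x Rs v0 -> B2 x Rs v -> exists y' z,
  [/\ y = Some y', fword f w (Some z) = Some v & cmod (z - y') <= K * q ^+ size w].
Proof.
move=> Jx fy xv0 xv.
have By : (Some @` B2 x Rs) (fword f w y) by rewrite fy; exists v0.
have [z Pz fz] := component_onto (fword_scont hf w) Rs0 (fword_unif_open hf w) By xv.
have Py := @connected_component_refl _ (fword f w @^-1` (Some @` B2 x Rs)) y By.
have [a [b [ya zb ab]]] := shr Jx By Py Pz.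
by exists a, b; split => //; [rewrite -zb|rewrite cmodB].
Qed.

Lemma sdst_far (A r : R) : 0 < A -> 0 < r -> exists2 e : R, 0 < e & forall x y,
  cmod x <= A -> sdst (Some x) (Some y) < e -> cmod (y - x) < r.
Proof.
move=> A0 r0; have B0 : 0 < A ^+ 2 + 1 by rewrite ltr_wpDl // sqr_ge0.
exists (Num.min (A ^+ 2 + 1)^-1 (r / (4 * (A ^+ 2 + 1)))).
  by rewrite lt_min invr_gt0 B0 divr_gt0 // mulr_gt0.
move=> x y xA /(sdst_near xA); rewrite ge_min lexx => /(_ isT)[w [<-] h].
apply: (le_lt_trans h); rewrite mulrC -ltr_pdivlMr ?mulr_gt0 //.
apply: (@le_lt_trans _ _ (r / (4 * (A ^+ 2 + 1)))); first by rewrite ge_min lexx orbT.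
by rewrite ltr_pM2l // ltf_pV2 ?posrE ?mulr_gt0 // ltr_pM2r // ltr_nat.
Qed.

(** Shadowing. Consider the components, containing the points x_j, of the
    preimages of a small disc around x_n. They are mapped into one another,
    and the first one onto the disc, so a preimage of v in the first has an
    orbit through all of them. Their diameters decay like q ^ (n - j); for j
    close to n, where this bound is not small, [words_small] applies. *)
Lemma tracking (e : R) : 0 < e -> exists2 r : R, 0 < r <= Rs &
  forall om x, jorbit f om x -> forall n v, cmod (v - x n) < r ->
  exists z : nat -> C, [/\ z n = v,
    forall j, (j < n)%N -> f (om j) (Some (z j)) = Some (z j.+1) &
    forall j, (j <= n)%N -> cmod (z j - x j) <= K * q ^+ (n - j) /\ cmod (z j - x j) < e].
Proof.
move=> e0; have [A A0 JA] := julia_bounded Finf.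
have [N HN] := geometric_small q01 K0 e0.
have [e1 e10 He1] := sdst_far A0 e0.
have [d d0 dH] := words_small N e10.
exists (Num.min Rs (d / 4)); first by rewrite lt_min Rs0 divr_gt0 //= ge_min lexx.
set r := Num.min _ _; have r0 : 0 < r by rewrite lt_min Rs0 divr_gt0.
have rRs : B2 (0 : C) r `<=` B2 0 Rs.
  by move=> t; rewrite /B2 /= => /lt_le_trans; apply; rewrite ge_min lexx.
move=> om x xorb n v vx; have [Jx xS] := (fun k => (xorb k).1, fun k => (xorb k).2).
pose B : set Chat := Some @` B2 (x n) r.
have BRs : B `<=` Some @` B2 (x n) Rs.
  move=> _ [t tr <-]; exists t => //; move: tr; rewrite /B2 /= => /lt_le_trans; apply.
  by rewrite ge_min lexx.
have segx j : (j <= n)%N -> fword f (seg om j n) (Some (x j)) = Some (x n).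
  by move=> jn; apply: seg_orbit => // k _; exact: xS.
have Bx : B (fword f (seg om 0 n) (Some (x 0%N))).
  by rewrite segx //; exists (x n) => //; exact: B2_center.
have [y0 Py0 fy0] := component_onto (fword_scont hf _) r0 (fword_unif_open hf _) Bx vx.
pose y j := fword f (seg om 0 j) y0.
have yP j : (j <= n)%N -> connected_component (fword f (seg om j n) @^-1` B) (Some (x j)) (y j).
  move=> jn; have <- : fword f (seg om 0 j) (Some (x 0%N)) = Some (x j).
    by apply: seg_orbit => // k _; exact: xS.
  apply: (@component_image _ (fword f (seg om 0 j)) (fword_scont hf _) (fword f (seg om j n)) B (Some (x 0%N)) y0).
  by rewrite -fword_cat -seg_cat ?jn.
have yfin j : (j <= n)%N -> exists2 t, y j = Some t & cmod (t - x j) <= K * q ^+ (n - j).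
  move=> jn; have By : (Some @` B2 (x n) Rs) (fword f (seg om j n) (Some (x j))).
    by rewrite segx //; exists (x n) => //; exact: B2_center.
  have Pyj : connected_component (fword f (seg om j n) @^-1` (Some @` B2 (x n) Rs)) (Some (x j)) (y j).
    by apply: componentS (yP j jn) => t; exact: BRs.
  have [a [b [[xa] yb ab]]] := shr (Jx n) By (@connected_component_refl _ (fword f (seg om j n) @^-1` (Some @` B2 (x n) Rs)) _ By) Pyj.
  by exists b => //; rewrite cmodB xa -(size_seg om j n).
pose z j := fin (y j).
have yz j : (j <= n)%N -> y j = Some (z j) by move=> /yfin[t yt _]; rewrite /z yt.
exists z; split => [|j jn|j jn].
- by rewrite /z /y fy0.
- rewrite -(yz j (ltnW jn)) -(yz j.+1 jn) /y.
  have -> : seg om 0 j.+1 = seg om 0 j ++ [:: om j].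
    by rewrite (@seg_cat _ om 0 j j.+1) ?leqnSn // (@seg_cons _ om j) // /seg subnn.
  by rewrite fword_cat.
have [t yt tx] := yfin j jn; rewrite /z yt /=; split => //.
have [nj|nj] := leqP N (n - j); first by exact: le_lt_trans tx (HN _ nj).
apply: He1; first exact: JA.
apply: (dH (seg om j n) _ (connected_component (fword f (seg om j n) @^-1` B) (Some (x j))) (Some (x n))).
- by rewrite size_seg ltnW.
- exact: component_connected.
- move=> s /connected_component_sub[s' s'x <-].
  apply: (le_lt_trans (sdst_le_cmod _ _)).
  move: s'x; rewrite /B2 /= lt_min => /andP[_]; lra.
- apply: connected_component_refl; rewrite /= segx //.
  by exists (x n) => //; exact: B2_center.
- by rewrite -yt; exact: yP.
Qed.

(** Along an orbit in the Julia set the iterates expand arbitrarily small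
    discs to a fixed size, by [tracking], so they are not normal. *)
Lemma jorbit_fiber om x : jorbit f om x -> julia_fiber f om (Some (x 0%N)).
Proof.
move=> xorb [V [oV Vx nV]].
have [r /andP[r0 rRs] trk] := tracking ltr01.
have [A A0 JA] := julia_bounded Finf.
have r20 : 0 < r / 2 by rewrite divr_gt0.
have [e e0 far] := sdst_far A0 r20.
have [|k [h [kinc /luc_iff gh]]] := nV (fun n => fword f (initial om n.+1)).
  by move=> n; exists n.
have [d d0 H] := gh _ Vx; have [N HN] := H (e / 5) (divr_gt0 e0 (ltr0Sn _ 4)).
have [d' d'0 H'] := fword_scont hf (initial om (k N).+1) (Some (x 0%N)) (divr_gt0 e0 (ltr0Sn _ 4)).
have /snbhsP[d2 d20 d2V] : nbhs (Some (x 0%N) : Chat) V by apply: open_nbhs_nbhs.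
have m0 : 0 < Num.min (Num.min d d') d2 / 2 by rewrite divr_gt0 // !lt_min d0 d'0.
have [M HM] := geometric_small q01 K0 m0.
pose n := maxn N M; have kn : (M <= (k n).+1)%N.
  have : (n <= k n)%N by elim: (n) => // j IH; exact: leq_ltn_trans IH (kinc _ _ (ltnSn j)).
  by move=> nk; rewrite (leq_trans (leq_maxr N M)) // (leq_trans nk) // leqnSn.
have [|z [zn zS zx]] := trk om x xorb (k n).+1 (x (k n).+1 + (r / 2)%:C%C).
  by rewrite addrAC subrr add0r cmodR gtr0_norm //; lra.
have [z0 _] := zx 0%N isT; rewrite subn0 in z0.
have : sdst (Some (x 0%N) : Chat) (Some (z 0%N)) < Num.min (Num.min d d') d2.
  rewrite sdstC (le_lt_trans (sdst_le_cmod _ _)) //.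
  by have := le_lt_trans z0 (HM _ kn); rewrite ltr_pdivlMr // mulrC.
rewrite !lt_min => /andP[/andP[zd zd'] /d2V Vz].
have fz : fword f (initial om (k n).+1) (Some (z 0%N)) = Some (z (k n).+1).
  by rewrite -seg0; apply: seg_orbit => // j /andP[_]; exact: zS.
have fx : fword f (initial om (k n).+1) (Some (x 0%N)) = Some (x (k n).+1).
  by rewrite -seg0; apply: seg_orbit => // j _; have [] := xorb j.
have h1 := HN N (leqnn N) _ Vx; rewrite sdstxx in h1; have {}h1 := h1 d0.
have h2 := HN N (leqnn N) _ Vz zd.
have h3 := HN n (leq_maxl N M) _ Vx; rewrite sdstxx fx in h3; have {}h3 := h3 d0.
have h4 := HN n (leq_maxl N M) _ Vz zd; rewrite fz in h4.
have h5 := H' _ zd'.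
set gx := fword f _ (Some (x 0%N)) in h1 h5; set gz := fword f _ (Some (z 0%N)) in h2 h5.
have : sdst (Some (x (k n).+1) : Chat) (Some (z (k n).+1)) < e.
  have t1 := sdst_triangle (h (Some (x 0%N))) (Some (x (k n).+1)) (Some (z (k n).+1)).
  have t2 := sdst_triangle gx (h (Some (x 0%N))) (Some (z (k n).+1)).
  have t3 := sdst_triangle gz gx (Some (z (k n).+1)).
  have t4 := sdst_triangle (h (Some (z 0%N))) gz (Some (z (k n).+1)).
  rewrite (sdstC _ (h (Some (x 0%N)))) in t1; rewrite (sdstC gz (h _)) in t4.
  lra.
move=> /far; rewrite zn addrAC subrr add0r cmodR gtr0_norm // ltxx.
by move=> /(_ (JA _ (xorb _).1)).
Qed.

(** If no word took a point near x to b, long words would omit near x the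
    disc of radius Rs around b, since preimages of this disc are small. By
    [fword_omit_lip] they would have bounded expansion there, whereas by
    [tracking] they expand exponentially small discs to a fixed size. *)
Lemma julia_transitive (x b : C) (e : R) : julia f (Some x) -> julia f (Some b) ->
  0 < e -> exists w z, [/\ w <> [::], cmod (z - x) < e & fword f w (Some z) = Some b].
Proof.
move=> Jx Jb e0; apply: contrapT => none.
have [A A0 JA] := julia_bounded Finf.
have [om [xs [xorb x0E]]] := jorbit_exists hf Finf Jx.
have [r /andP[r0 rRs] trk] := tracking ltr01.
have h0 : 0 < e / 2 by rewrite divr_gt0.
pose B := 2 * A + Rs; have B0 : 0 < B by rewrite addr_gt0 // mulr_gt0.
(* A lower bound for the distance of the images of z_n and x_n under the
   inversion at b. *)
pose c := r / 2 / (B * B); have c0 : 0 < c by rewrite !divr_gt0 // mulr_gt0.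
have m0 : 0 < Num.min (e / 2) (c * (Rs * (e / 2)) / 2).
  by rewrite lt_min h0 !(divr_gt0, mulr_gt0).
have [N HN] := geometric_small q01 K0 m0; pose n := N.+1.
have := HN n (leqnSn N); rewrite lt_min => /andP[ne nc].
have omit z v : cmod (z - x) <= e / 2 -> fword f (seg om 0 n) (Some z) = Some v ->
    Rs <= cmod (v - b).
  move=> zx fz; rewrite leNgt; apply/negP => vb.
  have [_ [z' [[<-] fz' z'z]]] := pull_back Jb fz vb (B2_center b Rs0).
  apply: none; exists (seg om 0 n), z'; split => //.
  rewrite size_seg subn0 in z'z.
  by have := cmod_triangle z z' x; lra.
have [|z [zn zS zx]] := trk om xs xorb n (xs n + (r / 2)%:C%C).
  by rewrite addrAC subrr add0r cmodR gtr0_norm; lra.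
have [z0 _] := zx 0%N isT; rewrite subn0 x0E in z0.
have fz : fword f (seg om 0 n) (Some (z 0%N)) = Some (z n).
  by apply: seg_orbit => // j /andP[_]; exact: zS.
have fx : fword f (seg om 0 n) (Some x) = Some (xs n).
  by rewrite -x0E; apply: seg_orbit => // j _; have [] := xorb j.
have ze : cmod (z 0%N - x) <= e / 2 by exact: ltW (le_lt_trans z0 ne).
have lip := fword_omit_lip hf h0 Rs0 omit ze fz fx.
have xe : cmod (x - x) <= e / 2 by rewrite subrr cmod0 ltW.
have zb := omit _ _ ze fz; have xb := omit _ _ xe fx.
have zb0 : z n - b != 0 by rewrite -cmod_gt0 (lt_le_trans Rs0).
have xb0 : xs n - b != 0 by rewrite -cmod_gt0 (lt_le_trans Rs0).
have znx : cmod (z n - xs n) = r / 2.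
  by rewrite zn addrAC subrr add0r cmodR gtr0_norm; lra.
have low : c <= cmod ((z n - b)^-1 - (xs n - b)^-1).
  have -> : (z n - b)^-1 - (xs n - b)^-1 = (xs n - z n) / ((z n - b) * (xs n - b)).
    by field; rewrite ?xb0 ?zb0.
  rewrite cmodM cmodV cmodM cmodB znx.
  have xA := JA _ (xorb n).1; have bA := JA _ Jb.
  have xbB : cmod (xs n - b) <= B by have := cmodD (xs n) (- b); rewrite cmodN /B; lra.
  have zbB : cmod (z n - b) <= B.
    have := cmod_triangle (xs n) (z n) b; have := cmodD (xs n) (- b).
    rewrite cmodN znx /B; lra.
  rewrite /c ler_pM2l; last by lra.
  rewrite lef_pV2 ?posrE ?mulr_gt0 ?cmod_gt0 //.
  by rewrite ler_pM ?cmod_ge0.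
have k0 : 0 < Rs * (e / 2) by rewrite mulr_gt0.
have := le_trans low lip; rewrite mulrAC ler_pdivlMr //.
have := le_lt_trans z0 nc; lra.
Qed.

End Dynamics.

(** * Perfectness of the Julia set *)

Section Perfectness.
Context {R : realType} {u : nat}.
Local Notation Chat := (sphere R).
Variable f : 'I_u -> Chat -> Chat.
Hypothesis hf : forall i, nonconstant_rational (f i).
Hypothesis Finf : fatou f None.

Lemma iter_fword i k : iter k (f i) = fword f (nseq k i) :> (Chat -> Chat).
Proof. by apply/funext => z; elim: k z => //= k IH z; rewrite -IH -iterSr. Qed.

(** A finite Julia set would be permuted by every generator, hence an
    element of degree at least two would be totally ramified over it; some
    generator would then have a critical point in a periodic orbit inside
    the Julia set. *)
Lemma julia_infinite : (exists2 g, semigroup f g &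
    exists2 d, (2 <= d)%N & rational_of_degree g d) ->
  crit_star f `&` PCV f = set0 -> forall b, julia f (Some b) ->
  ~ finite_set (julia f).
Proof.
move=> [_ [w w0 <-] [d d2 gd]] noPCV b Jb finJ.
have [y gy] := fword_onto hf w (Some b).
have Jy : julia f y by apply: (julia_backward hf (w := w)); rewrite gy.
have [c yc] := julia_finite Finf Jy; rewrite {y}yc in gy Jy.
have per h : (forall y, julia f (h y) -> julia f y) -> (forall v, exists y, h y = v) ->
    forall y, julia f y -> exists2 k, (0 < k)%N & iter k h y = y.
  by move=> back onto y; apply: (finite_periodic finJ).
have gper := per (fword f w) (julia_backward hf (w := w)) (fword_onto hf w).
have iterM (h : Chat -> Chat) k l y : iter k h y = y -> iter (l * k) h y = y.
  by move=> hk; elim: l => // l IH; rewrite mulSn iterD IH.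
have gc : crit (fword f w) (Some c).
  apply: (total_ramification_crit d2 gd gy) => t gt.
  have Jt : julia f t by apply: (julia_backward hf (w := w)); rewrite gt.
  have [k k0 kt] := gper t Jt; have [l l0 lc] := gper _ Jy.
  rewrite -(iterM _ _ l _ kt) -(iterM _ _ k _ lc) (mulnC k).
  case: (l * k)%N (muln_gt0 l k) => [|n _]; first by rewrite k0 l0.
  by rewrite !iterSr gt gy.
have [w1 [i [w2 [wE ci]]]] : exists w1 i w2, w = w1 ++ i :: w2 /\ crit (f i) (fword f w1 (Some c)).
  apply: contrapT => none.
  have [|_ [a a0 ga]] := fword_noncrit hf (w := w) (z := Some c).
    by move=> w1 i w2 wE ci; apply: none; exists w1, i, w2.
  by move: gc; rewrite critE (has_cderiv_derivable ga).2 => /eqP; rewrite (negbTE a0).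
set c' := fword f w1 (Some c) in ci.
have fc' : fword f w2 (f i c') = Some b by rewrite -gy wE fword_cat.
have Jfc : julia f (f i c') by apply: (julia_backward hf (w := w2)); rewrite fc'.
have Jc' := julia_backward1 hf Jfc.
have [k k0 kc] := per (f i) (@julia_backward1 _ _ _ hf i) (rational_onto (hf i)) c' Jc'.
have : (crit_star f `&` PCV f) c'.
  split; first by exists i.
  apply: subset_closure; exists (fword f (nseq k i)), c'; split.
  - by apply: semigroup_fword; case: (k) k0.
  - have -> : nseq k i = i :: nseq k.-1 i by case: (k) k0.
    exact: (crit_fword_cons hf _ ci).
  - by rewrite -iter_fword kc.
by rewrite noPCV.
Qed.

Variables Rs K q : R.
Hypotheses (Rs0 : 0 < Rs) (K0 : 0 < K) (q01 : 0 < q < 1) (shr : shrinking f Rs K q).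

(** By transitivity and openness one isolated point makes all points of the
    Julia set isolated; by compactness the set would then be finite. *)
Lemma julia_perfect : (exists2 g, semigroup f g &
    exists2 d, (2 <= d)%N & rational_of_degree g d) ->
  crit_star f `&` PCV f = set0 -> forall x (e : R), julia f (Some x) -> 0 < e ->
  exists v, [/\ julia f (Some v), v != x & cmod (v - x) < e].
Proof.
move=> deg2 noPCV x e Jx e0; apply: contrapT => none.
have isox v : julia f (Some v) -> cmod (v - x) < e -> v = x.
  move=> Jv vx; apply/eqP; apply: contrapT => /negP vx0.
  by apply: none; exists v.
have iso b : julia f (Some b) -> exists2 d : R, 0 < d &
    forall y, julia f y -> sdst (Some b) y < d -> y = Some b.
  move=> Jb; have [w [z [_ zx fz]]] := julia_transitive hf Finf Rs0 K0 q01 shr Jx Jb e0.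
  have Jz : julia f (Some z) by apply: (julia_backward hf (w := w)); rewrite fz.
  have {Jz zx} zx := isox z Jz zx; rewrite {z}zx in fz.
  have [d d0 dx] := near_some x e0; have [r r0 H] := fword_unif_open hf w d0.
  exists r => // y Jy by_; have [|t xt ft] := H (Some x) y; first by rewrite fz.
  have [t' tt' t'x] := dx t xt.
  have Jt : julia f (Some t') by apply: (julia_backward hf (w := w)); rewrite -tt' ft.
  by rewrite -ft tt' (isox t' Jt t'x).
apply: (julia_infinite deg2 noPCV Jx).
have cJ : compact (julia f : set Chat).
  by apply: (@subclosed_compact Chat _ setT); [exact: julia_closed|exact: compact_sphere|].
(* The filter of the finite sets, ordered by inclusion: by isolation they
   eventually contain all points of the Julia set near a given one. *)
pose F := filter_from [set D : set Chat | finite_set D] (fun D => [set X | D `<=` X]).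
have FF : Filter F.
  apply: filter_from_filter; first by exists set0; exact: finite_set0.
  move=> D1 D2 /= fD1 fD2; exists (D1 `|` D2); first by rewrite finite_setU.
  by move=> X DX; split => y Dy; apply: DX; [left|right].
have /compact_near_coveringP cov := cJ.
have [y Jy|D finD DX] := cov (set Chat) F (fun X y => julia f y -> X y) FF.
  have [b yb] := julia_finite Finf Jy; rewrite yb in Jy *.
  have [d d0 H] := iso b Jy.
  exists ([set t | sdst (Some b) t < d], [set X | [set (Some b : Chat)] `<=` X]).
    split; first by apply/snbhsP; exists d.
    by exists [set (Some b : Chat)] => //; exact: finite_set1.
  by case=> t X /= [bt bX] Jt; rewrite (H t Jt bt); exact: bX.
apply: (sub_finite_set _ finD) => y Jy; exact: (DX D).
Qed.

End Perfectness.

(** * Holomorphic inverse branches *)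

Section InverseBranches.
Context {R : realType} {u : nat}.
Local Notation C := R[i].
Local Notation Chat := (sphere R).
Variable f : 'I_u -> Chat -> Chat.
Hypothesis hf : forall i, nonconstant_rational (f i).
Variables (b : C) (rR : R).
Hypotheses (rR0 : 0 < rR) (bPCV : ~ enbhd (PCV f) (8 * rR) b).
Implicit Types (w : seq 'I_u) (h : C -> Chat).

(** Critical values of words are in the postcritical set, at distance at
    least 8 rR from b. *)
Lemma PCV_noncrit w z v : fword f w z = Some v -> cmod (v - b) <= 4 * rR ->
  forall w1 i w2, w = w1 ++ i :: w2 -> ~ crit (f i) (fword f w1 z).
Proof.
move=> fz vb w1 i w2 wE ci; apply: bPCV; exists v; last by rewrite (cmodB b v); apply: (le_lt_trans vb); rewrite ltr_pM2r // ltr_nat.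
rewrite -fz wE fword_cat; apply: subset_closure.
exists (fword f (i :: w2)), (fword f w1 z); split.
- by exists (i :: w2).
- exact: (crit_fword_cons hf _ ci).
- by [].
Qed.

(** Words are locally injective at the preimages of the closed disc,
    uniformly by compactness. *)
Lemma separated_fibers w : exists2 e : R, 0 < e & forall z z' v,
  fword f w z = Some v -> fword f w z' = Some v -> cmod (v - b) <= 4 * rR ->
  sdst z z' < e -> z = z'.
Proof.
pose A : set Chat := fword f w @^-1` ((Some : C -> Chat) @` [set v | cmod (v - b) <= 4 * rR]).
have cA : closed A.
  apply: closed_comp; last by apply: closed_disc; rewrite mulr_ge0 // ltW.
  by move=> z _; apply: scont_continuous; exact: fword_scont.
have [||e e0 H] := @uniform_radius _ A (fun e z => forall z',
    fword f w z = fword f w z' -> sdst z z' < e -> z = z') cA.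
- by move=> e e' x ee' H z' fz zz'; apply: H => //; exact: lt_le_trans ee'.
- move=> z [v vb fz]; have [[d d0 inj] _] := fword_noncrit hf (PCV_noncrit (esym fz) vb).
  exists (d / 2), (d / 2); split; rewrite ?divr_gt0 // => y _ zy z' fy yz'.
  apply: inj => //; first by have := sdst_ge0 z y; lra.
  by have := sdst_triangle y z z'; lra.
exists e => // z z' v fz fz' vb zz'; apply: (H z) => //; last by rewrite fz.
by exists v.
Qed.

(** Continuity is enough to characterise the holomorphic branches, see
    [HIBP]. *)
Definition cont_branch w h :=
  (forall v, B2 b (4 * rR) v -> fword f w (h v) = Some v) /\
  forall v (e : R), B2 b (4 * rR) v -> 0 < e -> exists2 d : R, 0 < d &
    forall v', cmod (v' - v) < d -> sdst (h v) (h v') < e.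

(** The branch is lifted along the segments issuing from v0. Uniform
    openness provides each of finitely many steps with a lift close to the
    previous one; it is unique by [separated_fibers], hence depends
    continuously on v. *)
Lemma branch_exists w z0 v0 : B2 b (4 * rR) v0 -> fword f w z0 = Some v0 ->
  exists h, [/\ forall v, B2 b (4 * rR) v -> fword f w (h v) = Some v, h v0 = z0 &
    forall v (e : R), B2 b (4 * rR) v -> 0 < e -> exists2 d : R, 0 < d &
      forall v', B2 b (4 * rR) v' -> cmod (v' - v) < d -> sdst (h v) (h v') < e].
Proof.
move=> v0b; have [s s0 sep] := separated_fibers w; have Fo := fword_unif_open hf w.
move: (fword f w) sep Fo => F sep Fo fz0.
have s40 : 0 < s / 4 by rewrite divr_gt0.
have [d d0 lift] := Fo _ s40.
have [N0 HN0] : exists N, 16 * rR / d < N%:R.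
  exists (Num.bound (16 * rR / d)); apply: archi_boundP.
  by rewrite divr_ge0 ?mulr_ge0 ?ltW.
pose N := N0.+1; have N0R : 0 < N%:R :> R by rewrite ltr0n.
have HN : 16 * rR / d < N%:R by apply: lt_trans HN0 _; rewrite ltr_nat.
pose p k v : C := v0 + ((k%:R / N%:R)%:C)%C * (v - v0).
have pb k v : (k <= N)%N -> B2 b (4 * rR) v -> B2 b (4 * rR) (p k v).
  move=> kN vb; rewrite /B2 /=; set t : R := k%:R / N%:R.
  have t0 : 0 <= t by rewrite divr_ge0 // ler0n.
  have t1 : t <= 1 by rewrite ler_pdivrMr // mul1r ler_nat.
  have -> : p k v - b = (t%:C)%C * (v - b) + ((1 - t)%:C)%C * (v0 - b).
    by rewrite /p -/t rmorphB rmorph1; ring.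
  apply: (le_lt_trans (cmodD _ _)); rewrite !cmodM !cmodR ger0_norm // ger0_norm ?subr_ge0 //.
  pose M := Num.max (cmod (v - b)) (cmod (v0 - b)).
  have Mb : M < 4 * rR by rewrite gt_max; apply/andP; split.
  apply: le_lt_trans Mb; rewrite [leRHS](_ : M = t * M + (1 - t) * M); last by ring.
  by rewrite lerD // ler_wpM2l ?subr_ge0 // le_max lexx ?orbT.
have pstep k v : B2 b (4 * rR) v -> sdst (Some (p k v)) (Some (p k.+1 v)) < d.
  move=> vb; apply: (le_lt_trans (sdst_le_cmod _ _)).
  have -> : p k v - p k.+1 v = - ((N%:R^-1)%:C)%C * (v - v0).
    by rewrite /p -[k.+1]addn1 natrD mulrDl mul1r rmorphD; ring.
  rewrite mulNr cmodN cmodM cmodR gtr0_norm ?invr_gt0 //.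
  have : cmod (v - v0) <= 8 * rR.
    have := cmod_triangle b v v0; rewrite (cmodB b); move: vb v0b; rewrite /B2 /=; lra.
  have -> : 2 * (N%:R^-1 * cmod (v - v0)) = 2 * cmod (v - v0) / N%:R by rewrite mulrCA mulrC.
  rewrite ltr_pdivrMr // => vv0; move: HN; rewrite ltr_pdivrMr // => HN.
  by rewrite (mulrC d); apply: le_lt_trans HN; lra.
pose L z (v : C) : Chat := if pselect (exists2 y, sdst z y < s / 4 & F y = Some v) is left E
  then projT1 (cid2 E) else z.
have LP z v : sdst (F z) (Some v) < d -> sdst z (L z v) < s / 4 /\ F (L z v) = Some v.
  move=> zv; rewrite /L; case: pselect => [E|]; first by case: (cid2 E).
  by case; exact: lift.
pose h k v := iteri k (fun j z => L z (p j.+1 v)) z0.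
have p0 v : p 0 v = v0 by rewrite /p mul0r mul0r addr0.
have hP k v : (k < N)%N -> B2 b (4 * rR) v -> F (h k v) = Some (p k v) ->
    sdst (h k v) (h k.+1 v) < s / 4 /\ F (h k.+1 v) = Some (p k.+1 v).
  by move=> kN vb Fk; apply: LP; rewrite Fk; exact: pstep.
have hF k v : (k <= N)%N -> B2 b (4 * rR) v -> F (h k v) = Some (p k v).
  move=> + vb; elim: k => [|k IH] kN; first by rewrite p0.
  by have [] := hP k v kN vb (IH (ltnW kN)).
have hstep k v : (k < N)%N -> B2 b (4 * rR) v -> sdst (h k v) (h k.+1 v) < s / 4.
  by move=> kN vb; have [] := hP k v kN vb (hF k v (ltnW kN) vb).
have hcont k v e : (k <= N)%N -> B2 b (4 * rR) v -> 0 < e -> exists2 d : R, 0 < d &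
    forall v', B2 b (4 * rR) v' -> cmod (v' - v) < d -> sdst (h k v) (h k v') < e.
  move=> + vb; elim: k e => [|k IH] e kN e0.
    by exists 1 => // v' _ _; rewrite sdstxx.
  have m0 : 0 < Num.min e (s / 4) by rewrite lt_min e0.
  have [r r0 lift'] := Fo _ m0.
  have [d1 d10 H1] := IH _ (ltnW kN) s40.
  exists (Num.min d1 (r / 2)); first by rewrite lt_min d10 divr_gt0.
  move=> v' v'b; rewrite lt_min => /andP[/(H1 _ v'b) hk v'r].
  have [|y hy Fy] := lift' (h k.+1 v) (Some (p k.+1 v')).
    rewrite hF //; apply: (le_lt_trans (sdst_le_cmod _ _)).
    have -> : p k.+1 v - p k.+1 v' = ((k.+1%:R / N%:R)%:C)%C * (v - v') by rewrite /p; ring.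
    rewrite cmodM cmodR ger0_norm ?divr_ge0 // cmodB.
    have : k.+1%:R / N%:R <= 1 :> R by rewrite ler_pdivrMr // mul1r ler_nat.
    by have := cmod_ge0 (v' - v); nra.
  move: hy; rewrite lt_min => /andP[hye hys].
  suff -> : h k.+1 v' = y by [].
  apply: esym; apply: (sep _ _ _ Fy (hF k.+1 v' kN v'b)).
    by apply: ltW; exact: pb.
  have a1 := hstep k v kN vb; have a2 := hstep k v' kN v'b.
  have t1 := sdst_triangle (h k.+1 v) y (h k.+1 v').
  have t2 := sdst_triangle (h k v) (h k.+1 v) (h k.+1 v').
  have t3 := sdst_triangle (h k v') (h k v) (h k.+1 v').
  rewrite (sdstC y (h k.+1 v)) in t1; rewrite (sdstC (h k.+1 v) (h k v)) in t2; lra.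
exists (h N); split.
- move=> v vb; rewrite hF // /p divff ?gt_eqF // rmorph1 mul1r addrC subrK //.
- have : forall k, (k <= N)%N -> h k v0 = z0; last exact.
  elim=> // k IH kN.
  apply: esym; apply: (sep _ _ v0); rewrite ?fz0 //.
  + by rewrite hF // /p subrr mulr0 addr0.
  + exact: ltW.
  + by rewrite -{1}(IH (ltnW kN)); apply: lt_trans (hstep k v0 kN v0b) _; lra.
- by move=> v e vb e0; exact: hcont.
Qed.

Lemma cont_branch_exists w z0 v0 : B2 b (4 * rR) v0 -> fword f w z0 = Some v0 ->
  exists h, [/\ cont_branch w h, h v0 = z0 & forall v, ~ B2 b (4 * rR) v -> h v = None].
Proof.
move=> v0b fz0; have [h [hF h0 hc]] := branch_exists v0b fz0.
exists (fun v => if cmod (v - b) < 4 * rR then h v else None); split.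
- split=> [v vb|v e vb e0]; first by rewrite ifT // hF.
  have [d d0 H] := hc v e vb e0.
  have m0 : 0 < 4 * rR - cmod (v - b) by rewrite subr_gt0.
  exists (Num.min d (4 * rR - cmod (v - b))); first by rewrite lt_min d0.
  move=> v'; rewrite lt_min => /andP[v'd v'b].
  have v'b' : B2 b (4 * rR) v' by rewrite /B2 /=; have := cmod_triangle v v' b; lra.
  by rewrite ifT // ifT //; exact: H.
- by rewrite ifT.
- by move=> v vb; case: ifP.
Qed.

(** By [separated_fibers] both the set where two branches agree and the set
    where they differ are open. *)
Lemma cont_branch_unique w h h' v0 : cont_branch w h -> cont_branch w h' ->
  B2 b (4 * rR) v0 -> h v0 = h' v0 -> forall v, B2 b (4 * rR) v -> h v = h' v.
Proof.
move=> [hF hc] [h'F h'c] v0b hv0.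
have [s s0 sep] := separated_fibers w; have s20 : 0 < s / 2 by rewrite divr_gt0.
pose B : set Chat := Some @` B2 b (4 * rR).
have cB : connected B.
  by apply: (@connected_chart_disc _ (Some 0)); rewrite mulr_gt0.
have oB : open B by exact: open_chart_disc.
pose E : set Chat := Some @` [set v | B2 b (4 * rR) v /\ h v = h' v].
pose NE : set Chat := Some @` [set v | B2 b (4 * rR) v /\ h v <> h' v].
have nearB v (e : R) : B2 b (4 * rR) v -> 0 < e -> exists2 d : R, 0 < d & forall y,
    sdst (Some v) y < d -> exists v', [/\ y = Some v', B2 b (4 * rR) v' & cmod (v' - v) < e].
  move=> vb e0; have m0 : 0 < Num.min e (4 * rR - cmod (v - b)) by rewrite lt_min e0 subr_gt0.
  have [d d0 H] := near_some v m0; exists d => // y /H[v' -> ]; rewrite lt_min => /andP[h1 h2].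
  by exists v'; split => //; rewrite /B2 /=; have := cmod_triangle v v' b; lra.
have oE : open E.
  rewrite openE => _ [v [vb hv] <-]; rewrite /interior; apply/snbhsP.
  have [d1 d10 H1] := hc v _ vb s20; have [d2 d20 H2] := h'c v _ vb s20.
  have m0 : 0 < Num.min d1 d2 by rewrite lt_min d10.
  have [d d0 H] := nearB v _ vb m0; exists d => // y /H[v' [-> v'b]].
  rewrite lt_min => /andP[/H1 h1 /H2 h2]; exists v' => //; split => //.
  apply: (sep _ _ v'); rewrite ?hF ?h'F //; first exact: ltW.
  have t := sdst_triangle (h v) (h v') (h' v').
  by rewrite (sdstC (h v') (h v)) in t; rewrite -hv in h2; lra.
have oNE : open NE.
  rewrite openE => _ [v [vb hv] <-]; rewrite /interior; apply/snbhsP.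
  have g0 : 0 < sdst (h v) (h' v) / 2.
    rewrite divr_gt0 // lt_def sdst_ge0 andbT; apply/eqP => /sdst_eq0; exact: hv.
  have [d1 d10 H1] := hc v _ vb g0; have [d2 d20 H2] := h'c v _ vb g0.
  have m0 : 0 < Num.min d1 d2 by rewrite lt_min d10.
  have [d d0 H] := nearB v _ vb m0; exists d => // y /H[v' [-> v'b]].
  rewrite lt_min => /andP[/H1 h1 /H2 h2]; exists v' => //; split => // hh.
  have := sdst_triangle (h v') (h v) (h' v); rewrite {2}hh (sdstC (h' v') (h' v)); lra.
have EB : E = B.
  apply: cB; first by exists (Some v0), v0.
    exists E => //; apply/seteqP; split=> [_ [v [vb hv] <-]|y []//].
    by split; exists v.
  exists (~` NE); first exact: open_closedC.
  apply/seteqP; split=> [_ [v [vb hv] <-]|_ [[v vb <-] nNE]].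
    by split; [exists v|move=> [v' [_ nhv] [vv']]; rewrite vv' in nhv].
  by exists v => //; split => //; apply: contrapT => hv; apply: nNE; exists v.
move=> v vb; have : E (Some v) by rewrite EB; exists v.
by move=> [v' [_ hv'] [<-]].
Qed.

Lemma cont_branch_holomorphic w h v : cont_branch w h -> B2 b (4 * rR) v ->
  holomorphic_at h v.
Proof.
move=> [hF hc] vb; set z := h v.
have [_ [a a0 Fa]] := fword_noncrit hf (PCV_noncrit (hF v vb) (ltW vb)).
split.
  move=> A /snbhsP[e e0 eA]; have [d d0 H] := hc v e vb e0.
  by apply/nbhs_cmodP; exists d => // v' /H/eA.
suff : has_cderiv (fun v' => coord z (h v')) v a^-1 by move=> /has_cderiv_derivable[].
set w0 := coord z z in Fa; have ca : 0 < cmod a by rewrite cmod_gt0.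
move=> e e0; pose e1 := Num.min (cmod a / 2) (e * cmod a ^+ 2 / 2).
have e10 : 0 < e1 by rewrite lt_min !(divr_gt0, mulr_gt0) // exprn_gt0.
have [d d0 Hd] := Fa e1 e10; have [r r0 Hr] := uncoord_near z d0.
have [t t0 Ht] := hc v r vb r0.
have m0 : 0 < 4 * rR - cmod (v - b) by rewrite subr_gt0.
exists (Num.min t (4 * rR - cmod (v - b))); first by rewrite lt_min t0.
move=> v'; rewrite lt_min => /andP[/Ht/Hr[x hx xd] v'v].
have v'b : B2 b (4 * rR) v' by rewrite /B2 /=; have := cmod_triangle v v' b; lra.
rewrite -/z hx coord_uncoord -/w0; have := Hd x xd.
have -> : chart_map (fword f w) z x = v'.
  by rewrite /chart_map -hx (hF v' v'b) (hF v vb).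
have -> : chart_map (fword f w) z w0 = v.
  by rewrite chart_map_base (hF v vb).
have := cmod_ge0 (x - w0) => x0 h1.
have e1a : e1 <= cmod a / 2 by rewrite ge_min lexx.
have e1b : e1 <= e * cmod a ^+ 2 / 2 by rewrite ge_min lexx orbT.
have h2 : cmod (x - w0) <= 2 / cmod a * cmod (v' - v).
  have t1 := cmod_lowerB (a * (x - w0)) (v' - v).
  rewrite (cmodB (a * (x - w0))) cmodM in t1.
  have t2 := ler_wpM2r x0 e1a.
  by rewrite mulrAC ler_pdivlMr //; lra.
have -> : x - w0 - a^-1 * (v' - v) = - a^-1 * (v' - v - a * (x - w0)) by field.
rewrite mulNr cmodN cmodM cmodV ler_pdivrMl // (le_trans h1) //.
apply: (@le_trans _ _ (e * cmod a ^+ 2 / 2 * (2 / cmod a * cmod (v' - v)))).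
  by rewrite ler_pM // ltW.
by rewrite le_eqVlt; apply/orP; left; apply/eqP; field; rewrite gt_eqF.
Qed.

Lemma HIBP (rho : hib R u) : HIB f rR b rho <->
  [/\ hib_base rho = b, cont_branch (hib_word rho) (hib_inv rho) &
      forall z, ~ B2 b (4 * rR) z -> hib_inv rho z = None].
Proof.
split=> [[base holo inv out]|[base br out]]; split => //.
- split => // v e vb e0; have [hc _] := holo v vb.
  have : nbhs (hib_inv rho v) [set y | sdst (hib_inv rho v) y < e] by apply/snbhsP; exists e.
  by move=> /hc/nbhs_cmodP[d d0 H]; exists d.
- by move=> z zb; exact: (cont_branch_holomorphic br).
- by case: br.
Qed.

Lemma HIB_exists w z0 v0 : B2 b (4 * rR) v0 -> fword f w z0 = Some v0 ->
  exists rho, [/\ HIB f rR b rho, hib_word rho = w & hib_inv rho v0 = z0].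
Proof.
move=> v0b fz0; have [h [hb h0 out]] := cont_branch_exists v0b fz0.
by exists (Hib b w h); split => //; apply/HIBP.
Qed.

Lemma HIB_unique rho rho' v0 : HIB f rR b rho -> HIB f rR b rho' ->
  hib_word rho = hib_word rho' -> B2 b (4 * rR) v0 ->
  hib_inv rho v0 = hib_inv rho' v0 -> rho = rho'.
Proof.
case: rho rho' => [b1 w1 h1] [b2 w2 h2] /HIBP[/= -> br1 out1] /HIBP[/= -> br2 out2] /= ww.
rewrite -{}ww in br2 *; move=> v0b hv0; congr Hib; apply/funext => v.
have [vb|vb] := pselect (B2 b (4 * rR) v); last by rewrite out1 // out2.
exact: (cont_branch_unique br1 br2 v0b hv0).
Qed.

Lemma HIB_behead i w h : HIB f rR b (Hib b (i :: w) h) ->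
  HIB f rR b (Hib b w (fun v => if cmod (v - b) < 4 * rR then f i (h v) else None)).
Proof.
move=> /HIBP[/= _ [hF hc] out]; apply/HIBP; split => //=; last by move=> v vb; case: ifP.
split=> [v vb|v e vb e0]; first by rewrite ifT // -(hF v vb).
have [d1 d10 H1] := rational_scont (hf i) (h v) e0.
have [d d0 H] := hc v d1 vb d10.
have m0 : 0 < 4 * rR - cmod (v - b) by rewrite subr_gt0.
exists (Num.min d (4 * rR - cmod (v - b))); first by rewrite lt_min d0.
move=> v'; rewrite lt_min => /andP[/H/H1 v'd v'b].
have v'b' : B2 b (4 * rR) v' by rewrite /B2 /=; have := cmod_triangle v v' b; lra.
by rewrite !ifT.
Qed.

(** A branch is determined by its word and by its value at b, one of
    finitely many. *)
Lemma HIB_countable : countable (HIB f rR b).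
Proof.
have -> : HIB f rR b = \bigcup_(w in [set: seq 'I_u])
    \bigcup_(z in [set z | fword f w z = Some b])
      [set rho | [/\ HIB f rR b rho, hib_word rho = w & hib_inv rho b = z]].
  apply/seteqP; split => [rho H|rho [w _ [z _ []]]//].
  exists (hib_word rho) => //; exists (hib_inv rho b) => //=.
  by have [_ _ inv _] := H; apply: inv; apply: B2_center; rewrite mulr_gt0.
apply: bigcup_countable => // w _; apply: bigcup_countable.
  exact: (finite_set_countable (fword_fiber_finite hf w (Some b))).
move=> z _; apply: finite_set_countable.
have [[rho [H ww hz]]|none] := pselect (exists rho, [/\ HIB f rR b rho, hib_word rho = w & hib_inv rho b = z]).
  apply: (sub_finite_set _ (finite_set1 rho)) => rho' [H' ww' hz'] /=.
  apply: (@HIB_unique rho' rho b) => //; rewrite ?ww ?ww' ?hz ?hz' //.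
  by apply: B2_center; rewrite mulr_gt0.
by rewrite (_ : [set rho | _] = set0) //; apply/seteqP; split => // rho H; case: none; exists rho.
Qed.

End InverseBranches.

(** * Orbit segments avoiding the vertices *)

Section FreePaths.
Context {R : realType} {u : nat}.
Local Notation C := R[i].
Local Notation Chat := (sphere R).

Lemma finite_min (T : eqType) (A : set T) (P : T -> R -> Prop) : finite_set A ->
  (forall t e e', e' <= e -> P t e -> P t e') ->
  (forall t, A t -> exists2 e : R, 0 < e & P t e) ->
  exists2 e : R, 0 < e & forall t, A t -> P t e.
Proof.
move=> /finite_seqP[s ->] mono; elim: s => [|t s IH] H; first by exists 1.
have [|e e0 He] := IH; first by move=> t' t's; apply: H; rewrite /= inE t's orbT.
have [|d d0 Hd] := H t; first by rewrite /= inE eqxx.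
exists (Num.min e d) => [|t']; first by rewrite lt_min e0.
rewrite /= inE => /orP[/eqP ->|t's].
  by apply: mono Hd; rewrite ge_min lexx orbT.
by apply: (mono t' e); [rewrite ge_min lexx|exact: He].
Qed.

Lemma finite_words n : finite_set [set w : seq 'I_u | (0 < size w <= n)%N].
Proof.
apply: (@sub_finite_set _ _ (\bigcup_(k in `I_n.+1) [set tval t | t in [set: k.-tuple 'I_u]])).
  move=> w /= /andP[_ wn]; exists (size w) => //=.
  by exists (in_tuple w).
by apply: bigcup_finite => // k _; apply: finite_image; exact: finite_finset.
Qed.

Variable f : 'I_u -> Chat -> Chat.
Hypothesis hf : forall i, nonconstant_rational (f i).
Hypothesis Finf : fatou f None.

Definition fpath (om : nat -> 'I_u) (z : nat -> C) n :=
  forall j, (j < n)%N -> f (om j) (Some (z j)) = Some (z j.+1).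

Lemma fpath_word om z n j k : fpath om z n -> (j <= k <= n)%N ->
  fword f (seg om j k) (Some (z j)) = Some (z k).
Proof.
move=> zp /andP[jk kn]; apply: seg_orbit => // l /andP[_ lk]; apply: zp.
exact: leq_trans lk kn.
Qed.

Lemma fpath_julia om z n : fpath om z n -> julia f (Some (z n)) ->
  forall j, (j <= n)%N -> julia f (Some (z j)).
Proof.
move=> zp Jn j jn; apply: (julia_backward hf (w := seg om j n)).
by rewrite (fpath_word zp) // jn leqnn.
Qed.

Lemma word_fpath w z b : w <> [::] -> fword f w (Some z) = Some b -> julia f (Some b) ->
  exists om zz, [/\ zz 0%N = z, zz (size w) = b & fpath om zz (size w)].
Proof.
case: w => // i0 w _; move: (i0 :: w) => {}w fz Jb.
exists (nth i0 w), (fun j => fin (fword f (take j w) (Some z))).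
have Jj j : julia f (fword f (take j w) (Some z)).
  apply: (julia_backward hf (w := drop j w)).
  by rewrite -[X in julia f X]/((_ \o _) _) -fword_cat cat_take_drop fz.
split; [by rewrite take0|by rewrite take_size fz|].
move=> j jw; have [t tE] := julia_finite Finf (Jj j).
have := Jj j.+1; rewrite (take_nth i0) // fword_rcons /= tE /=.
by move=> /(julia_finite Finf)[t' ->].
Qed.

Definition join (T : Type) n (a b : nat -> T) j := if (j < n)%N then a j else b (j - n)%N.

Lemma fpath_join om z n om' z' n' : fpath om z n -> fpath om' z' n' -> z n = z' 0%N ->
  fpath (join n om om') (join n z z') (n + n').
Proof.
move=> zp zp' zz j jn; rewrite /join.
have [jn1|jn1] := ltnP j n.
  rewrite zp //; have [//|nj] := ltnP j.+1 n.
  have jE : j.+1 = n by apply/eqP; rewrite eqn_leq jn1.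
  by rewrite jE subnn zz.
rewrite ltnNge (leq_trans jn1) ?leqnSn //= subSn // zp' //.
by rewrite -(ltn_add2l n) subnKC.
Qed.

Variable S : set C.
Hypotheses (finS : finite_set S) (aper : aperiodic f S)
  (SJ : forall s, S s -> julia f (Some s)).

(** For y in S, D = kappa * r and e = r such an orbit segment is an edge
    from y to b, see [reach_edge]. *)
Definition reach (D : R) (y : C) (e : R) (b : C) := exists n om z,
  [/\ (0 < n)%N, cmod (z 0%N - y) < e, z n = b, fpath om z n &
      forall j s, (0 < j < n)%N -> S s -> D <= cmod (z j - s)].

Lemma dist_finite (y : Chat) : ~ (Some @` S) y -> exists2 d : R, 0 < d &
  forall t, sdst y (Some t) < d -> forall s, S s -> d <= cmod (t - s).
Proof.
move=> yS.
have [|s Ss|d d0 H] := @finite_min _ S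
   (fun s d => forall t, sdst y (Some t) < d -> d <= cmod (t - s)) finS.
- by move=> s e e' ee' H t yt; apply: (le_trans ee'); apply: H; exact: lt_le_trans ee'.
- have m0 : 0 < sdst y (Some s).
    rewrite lt_def sdst_ge0 andbT; apply/eqP => /sdst_eq0 ys.
    by apply: yS; exists s.
  exists (sdst y (Some s) / 4); first by rewrite divr_gt0.
  move=> t yt; have := sdst_triangle (Some t) y (Some s); have := sdst_le_cmod t s; lra.
by exists d => // t yt s Ss; exact: H.
Qed.

(** By aperiodicity each of the finitely many words of length at most N
    moves S off itself, and by continuity a neighbourhood as well. *)
Lemma no_early_return N : exists2 d : R, 0 < d & forall om z n s s',
  fpath om z n -> (0 < n <= N)%N -> S s -> S s' -> cmod (z 0%N - s) < d ->
  d <= cmod (z n - s').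
Proof.
have [||d d0 H] := finite_min (finite_words N) (P := fun w d => forall s, S s ->
    forall z t, cmod (z - s) < d -> fword f w (Some z) = Some t ->
    forall s', S s' -> d <= cmod (t - s')).
- move=> w e e' ee' H s Ss z t zs fz s' Ss'; apply: (le_trans ee').
  by apply: (H s Ss z t _ fz s' Ss'); exact: lt_le_trans ee'.
- move=> w /= /andP[w0 _].
  have wn : w <> [::] by case: (w) w0.
  have [|s Ss|d d0 H] := finite_min finS (P := fun s d => forall z t, cmod (z - s) < d ->
      fword f w (Some z) = Some t -> forall s', S s' -> d <= cmod (t - s')).
  + move=> s e e' ee' H z t zs fz s' Ss'; apply: (le_trans ee').
    by apply: (H z t _ fz s' Ss'); exact: lt_le_trans ee'.
  + have [d1 d10 H1] := dist_finite (aper (semigroup_fword f wn) Ss).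
    have [d2 d20 H2] := fword_scont hf w (Some s) d10.
    exists (Num.min d1 (d2 / 2)); first by rewrite lt_min d10 divr_gt0.
    move=> z t; rewrite lt_min => /andP[_ zs] fz s' Ss'.
    rewrite (le_trans _ (H1 t _ s' Ss')) ?ge_min ?lexx // -fz; apply: H2.
    by rewrite (le_lt_trans (sdst_le_cmod _ _)) // cmodB; lra.
  by exists d => // s Ss; exact: H.
exists d => // om z n s s' zp nN Ss Ss' zs.
apply: (H (seg om 0 n) _ s Ss (z 0%N) (z n)) => //; first by rewrite /= size_seg subn0.
by apply: fpath_word zp _; rewrite leqnn.
Qed.

(** The points of the segment are mapped into S, so by aperiodicity they are
    not in S. *)
Lemma fpath_avoid om z n b : fpath om z n -> z n = b -> S b ->
  exists2 d : R, 0 < d & forall j s, (j < n)%N -> S s -> d <= cmod (z j - s).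
Proof.
move=> zp zn Sb.
have [||d d0 H] := @finite_min _ `I_n (fun j d => forall s, S s -> d <= cmod (z j - s)) (finite_II n).
- by move=> j e e' ee' H s Ss; apply: (le_trans ee'); exact: H.
- move=> j /= jn; have zjS : ~ (Some @` S : set Chat) (Some (z j)).
    move=> [s Ss [sz]]; apply: (aper (g := fword f (seg om j n)) _ Ss).
      by apply: semigroup_fword; rewrite seg_cons.
    by exists b => //; rewrite sz (fpath_word zp) ?zn // leqnn ltnW.
  have [d d0 H] := dist_finite zjS; exists d => // s Ss.
  by apply: H => //; rewrite sdstxx.
by exists d => // j s jn Ss; exact: H.
Qed.

Variables Rs K q : R.
Hypotheses (Rs0 : 0 < Rs) (K0 : 0 < K) (q01 : 0 < q < 1) (shr : shrinking f Rs K q).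

(** Compactness of the Julia set makes [julia_transitive] and [fpath_avoid]
    uniform. *)
Lemma reach_targets (e : R) : 0 < e -> exists2 d : R, 0 < d & forall x b,
  julia f (Some x) -> S b -> exists n om z,
  [/\ (0 < n)%N, cmod (z 0%N - x) < e, z n = b, fpath om z n &
      forall j s, (j < n)%N -> S s -> d <= cmod (z j - s)].
Proof.
move=> e0.
have [|b Sb|d d0 H] := finite_min finS (P := fun b d => forall x,
   julia f (Some x) -> exists n om z, [/\ (0 < n)%N, cmod (z 0%N - x) < e, z n = b, fpath om z n &
      forall j s, (j < n)%N -> S s -> d <= cmod (z j - s)]).
- move=> b d d' dd' H x Jx; have [n [om [z [n0 zx zn zp far]]]] := H x Jx.
  by exists n, om, z; split => // j s jn Ss; apply: (le_trans dd'); exact: far.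
- have [||d d0 H] := @uniform_radius _ (julia f) (fun d (y : Chat) => forall x, y = Some x ->
     exists n om z, [/\ (0 < n)%N, cmod (z 0%N - x) < e, z n = b, fpath om z n &
      forall j s, (j < n)%N -> S s -> d <= cmod (z j - s)]) (@julia_closed R u f).
  + move=> d d' y dd' H x yx; have [n [om [z [n0 zx zn zp far]]]] := H x yx.
    by exists n, om, z; split => // j s jn Ss; apply: (le_trans dd'); exact: far.
  + move=> y Jy; have [x yx] := julia_finite Finf Jy; rewrite {y}yx in Jy *.
    have h0 : 0 < e / 2 by rewrite divr_gt0.
    have [w [z [w0 zx fz]]] := julia_transitive hf Finf Rs0 K0 q01 shr Jy (SJ Sb) h0.
    have [om [zz [z0 zn zp]]] := word_fpath w0 fz (SJ Sb).
    have [d d0 far] := fpath_avoid zp zn Sb.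
    have [r r0 Hr] := near_some x h0; exists r, d; split => // y _ /Hr[x' -> xx'] x'' [<-].
    exists (size w), om, zz; split => //; first by case: (w) w0.
    by rewrite z0; have := cmod_triangle x z x'; rewrite (cmodB x); lra.
  by exists d => // x Jx; exact: (H _ Jx x).
by exists d => // x b Jx Sb; exact: H.
Qed.

Lemma reach_join (D e : R) om (z : nat -> C) n y b :
  (0 < n)%N -> fpath om z n -> cmod (z 0%N - y) < e ->
  (forall j s, (0 < j < n)%N -> S s -> D <= cmod (z j - s)) ->
  (exists n' om' z', [/\ (0 < n')%N, z' 0%N = z n, z' n' = b, fpath om' z' n' &
      forall j s, (j < n')%N -> S s -> D <= cmod (z' j - s)]) ->
  reach D y e b.
Proof.
move=> n0 zp zy far [n' [om' [z' [n'0 z'0 z'n zp' far']]]].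
exists (n + n')%N, (join n om om'), (join n z z'); split.
- by rewrite addn_gt0 n0.
- by rewrite /join n0.
- by rewrite /join ltnNge leq_addr /= addKn.
- exact: fpath_join.
move=> j s /andP[j0 jn] Ss; rewrite /join; have [jn1|jn1] := ltnP j n.
  by apply: far; rewrite ?j0.
by apply: far' => //; rewrite -(ltn_add2l n) subnKC.
Qed.

(** The orbit of c is in the postcritical set, hence far from S. It is
    shadowed until an arbitrarily small disc at c has grown to a fixed size,
    from where [reach_targets] leads to b. *)
Lemma hub_critical (rR : R) c : 0 < rR -> S c -> (forall s, S s -> ~ enbhd (PCV f) (8 * rR) s) ->
  (crit_star f) (Some c) ->
  exists2 d : R, 0 < d & forall D e b, 0 < e -> D <= d -> D <= 7 * rR -> S b -> reach D c e b.
Proof.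
move=> rR0 Sc SP [i ci Jfc].
have [x1 x1E] := julia_finite Finf Jfc; rewrite x1E in Jfc.
have [om1 [xs1 [xorb1 x10]]] := jorbit_exists hf Finf Jfc.
pose om n := if n is n'.+1 then om1 n' else i.
pose x n := if n is n'.+1 then xs1 n' else c.
have xorb : jorbit f om x.
  by case=> [|n] /=; [rewrite x10; split => //; exact: SJ|exact: xorb1].
have xfar n s : (0 < n)%N -> S s -> 8 * rR <= cmod (x n - s).
  case: n => // n _ Ss; rewrite leNgt; apply/negP => xs; apply: (SP s Ss).
  exists (x n.+1); last by rewrite cmodB.
  apply: subset_closure; exists (fword f (i :: seg om 1 n.+1)), (Some c); split.
  - by exists (i :: seg om 1 n.+1).
  - exact: (crit_fword_cons hf _ ci).
  - rewrite /= x1E -x10 -[xs1 0%N]/(x 1%N) (@seg_orbit _ _ f om x) //.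
    by move=> k _; have [] := xorb k.
have [r /andP[r0 rRs] trk] := tracking hf Finf Rs0 K0 q01 shr rR0.
have [d d0 targ] := reach_targets r0; exists d => // D e b e0 Dd DR Sb.
have [N HN] := geometric_small q01 K0 e0; pose n := N.+1.
have [n' [om' [z' [n'0 z'x z'n zp' far']]]] := targ (x n) b (xorb n).1 Sb.
have [z [zn zS zx]] := trk om x xorb n _ z'x.
apply: (@reach_join D e om z n c b) => //.
- by have [z0 _] := zx 0%N isT; apply: (le_lt_trans z0); rewrite subn0 HN // leqnSn.
- move=> j s /andP[j0 jn] Ss; have [_ zxj] := zx j (ltnW jn).
  have := xfar j s j0 Ss; have := cmod_triangle (z j) (x j) s.
  by rewrite (cmodB (x j) (z j)); lra.
- by exists n', om', z'; split => // j s jn Ss; apply: (le_trans Dd); exact: far'.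
Qed.

End FreePaths.

(** * Bounded distortion and uniform perfectness *)

Section BoundedProduct.
Context {R : realType}.

(** The logarithm of the product is bounded by a geometric series. *)
Lemma geometric_product_bound (q c : R) : 0 < q < 1 -> 0 <= c -> exists2 M : R, 0 < M &
  forall n, \prod_(i < n) (1 + c * q ^+ i.+1) <= M.
Proof.
move=> /andP[q0 q1] c0; exists (expR (c / (1 - q))); first exact: expR_gt0.
have sum_le n : \sum_(i < n) q ^+ i.+1 <= (1 - q)^-1 - q ^+ n / (1 - q).
  have q1' : 1 - q != 0 by lra.
  elim: n => [|n IH]; first by rewrite big_ord0 expr0 mul1r subrr.
  rewrite big_ord_recr /=; apply: (le_trans (lerD IH (lexx _))).
  have -> : (1 - q)^-1 - q ^+ n / (1 - q) + q ^+ n.+1 =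
     (1 - q)^-1 - q ^+ n.+1 / (1 - q) - q ^+ n * (1 - q).
    by rewrite exprS; field.
  by rewrite gerDl oppr_le0 mulr_ge0 ?exprn_ge0 ?(ltW q0) //; lra.
move=> n; have : \prod_(i < n) (1 + c * q ^+ i.+1) <= expR (c * \sum_(i < n) q ^+ i.+1).
  elim: n => [|n IH]; first by rewrite !big_ord0 mulr0 expR0.
  rewrite !big_ord_recr /= [c * (_ + _)]mulrDr expRD; apply: ler_pM => //.
  - by apply: prodr_ge0 => i _; rewrite addr_ge0 // mulr_ge0 // exprn_ge0 // ltW.
  - by rewrite addr_ge0 // mulr_ge0 // exprn_ge0 // ltW.
  - exact: expR_ge1Dx.
move=> /le_trans; apply; rewrite ler_expR ler_wpM2l //.
apply: (le_trans (sum_le n)); rewrite gerBl.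
by rewrite divr_ge0 ?exprn_ge0 ?(ltW q0) //; lra.
Qed.

End BoundedProduct.

Section Expanding.
Context {R : realType} {u : nat}.
Local Notation C := R[i].
Local Notation Chat := (sphere R).
Variable f : 'I_u -> Chat -> Chat.
Hypothesis hf : forall i, nonconstant_rational (f i).
Hypothesis Finf : fatou f None.
Hypothesis noncrit : forall i z, julia f (f i z) -> ~ crit (f i) z.

(** Near the Julia set the divided differences of the generators are bounded
    away from zero, so their values at (x, z) and (x, z') agree up to a
    factor that differs from 1 by a multiple of |z - z'|. *)
Lemma local_distortion : exists e L : R, [/\ 0 < e, 0 <= L &
  forall i x x1 z z' y y', julia f (Some x) -> f i (Some x) = Some x1 -> julia f (Some x1) ->
    cmod (z - x) < e -> cmod (z' - x) < e ->
    f i (Some z) = Some y -> f i (Some z') = Some y' ->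
    cmod (y - x1) * cmod (z' - x) <=
      (1 + L * cmod (z - z')) * (cmod (y' - x1) * cmod (z - x)) /\
    (z' != x -> y' != x1)].
Proof.
pose P i (e : R) (t : Chat) := forall x x1 z z' y y', t = Some x -> f i t = Some x1 ->
    cmod (z - x) < e -> cmod (z' - x) < e ->
    f i (Some z) = Some y -> f i (Some z') = Some y' ->
    cmod (y - x1) * cmod (z' - x) <=
      (1 + e^-1 * cmod (z - z')) * (cmod (y' - x1) * cmod (z - x)) /\
    (z' != x -> y' != x1).
have monoP i e e' t : 0 < e' -> e' <= e -> P i e t -> P i e' t.
  move=> e'0 ee' H x x1 z z' y y' tx fx zx z'x fz fz'.
  have [] := H x x1 z z' y y' tx fx (lt_le_trans zx ee') (lt_le_trans z'x ee') fz fz'.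
  move=> h1 h2; split => //; apply: (le_trans h1).
  rewrite ler_wpM2r ?mulr_ge0 ?cmod_ge0 // lerD2l ler_wpM2r ?cmod_ge0 //.
  by rewrite lef_pV2 ?posrE // (lt_le_trans e'0).
have unifP i : exists2 e : R, 0 < e & forall t, julia f t -> julia f (f i t) -> P i e t.
  have cK : closed (julia f `&` (f i @^-1` julia f)).
    apply: closedI; first exact: julia_closed.
    apply: closed_comp; last exact: julia_closed.
    by move=> t _; apply: scont_continuous; exact: rational_scont.
  have [||e e0 He] := @uniform_radius _ _ (fun e t => 0 < e -> P i e t) cK.
  - move=> e e' t ee' H e'0; apply: (monoP i e) => //; apply: H.
    exact: lt_le_trans ee'.
  - move=> t [Jt Jft]; have nc := noncrit Jft.
    have [a ta] := julia_finite Finf Jt; rewrite {t}ta in Jt Jft nc *.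
    have [v fv] := julia_finite Finf Jft.
    have [g [T [e [K lf]]]] := rational_local_form (Some a) (hf i).
    have T0 : 0 < cmod (T a a).
      by rewrite cmod_gt0; apply/eqP => T0; apply: nc; apply/(lf_crit lf).
    have K0 := lf_ge0 lf; have K1 : 0 < 4 * (K + 1) by lra.
    pose r := Num.min (e / 2) (cmod (T a a) / (4 * (K + 1))).
    have r0 : 0 < r by rewrite lt_min !divr_gt0 // (lf_gt0 lf).
    have re : r <= e / 2 by rewrite ge_min lexx.
    have rT : r * (4 * (K + 1)) <= cmod (T a a).
      by rewrite -ler_pdivlMr // ge_min lexx orbT.
    have [d d0 Hd] := near_some a r0; exists d, r; split => // _ _ /Hd[x -> xa] _.
    move=> _ x1 z z' y y' [<-] fx zx z'x fz fz'.
    have ae : cmod (a - a) < e by rewrite subrr cmod0 (lf_gt0 lf).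
    have xe : cmod (x - a) < e by lra.
    have ze : cmod (z - a) < e by have := cmod_triangle x z a; lra.
    have z'e : cmod (z' - a) < e by have := cmod_triangle x z' a; lra.
    have val w : cmod (w - a) < e -> f i (Some w) = Some (g w).
      by move=> we; have := lf_eq lf we; rewrite fv.
    move: fx fz fz'; rewrite !val // => -[<-] [<-] [<-].
    rewrite !(lf_dq lf) // !cmodM.
    rewrite (lf_sym lf ze xe) (lf_sym lf z'e xe).
    have [_ t1] := lf_lip lf xe z'e ae; have [_ t2] := lf_lip lf ae xe ae.
    have [_ t3] := lf_lip lf xe ze z'e.
    rewrite (lf_sym lf xe ae) in t1.
    have z'a : cmod (z' - a) <= 2 * r by have := cmod_triangle x z' a; lra.
    have lowT : r * (K + 1) <= cmod (T x z').
      have s1 := cmod_triangle (T a x) (T x z') (T a a).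
      have s2 := cmod_lowerB (T a a) (T x z').
      rewrite (cmodB (T a a)) in s2.
      have s3 : K * cmod (z' - a) <= K * (2 * r) by rewrite ler_wpM2l.
      have s4 : K * cmod (x - a) <= K * r by rewrite ler_wpM2l // ltW.
      lra.
    have Tpos : 0 < cmod (T x z') by apply: lt_le_trans lowT; rewrite mulr_gt0 //; lra.
    split; last first.
      move=> z'x0; rewrite -subr_eq0 (lf_dq lf) // -cmod_eq0 cmodM mulf_eq0 negb_or.
      by rewrite (lf_sym lf z'e xe) !gt_eqF // cmod_gt0 subr_eq0.
    have h1 : cmod (T x z) <= (1 + r^-1 * cmod (z - z')) * cmod (T x z').
      have s1 := cmod_lowerB (T x z) (T x z').
      have s2 : K * cmod (z - z') <= r^-1 * cmod (z - z') * cmod (T x z').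
        rewrite mulrAC ler_wpM2r ?cmod_ge0 // ler_pdivlMl //.
        by apply: le_trans lowT; lra.
      by rewrite mulrDl mul1r; lra.
    have -> : cmod (z - x) * cmod (T x z) * cmod (z' - x) = cmod (T x z) * (cmod (z - x) * cmod (z' - x)) by ring.
    have -> : (1 + r^-1 * cmod (z - z')) * (cmod (z' - x) * cmod (T x z') * cmod (z - x)) =
      ((1 + r^-1 * cmod (z - z')) * cmod (T x z')) * (cmod (z - x) * cmod (z' - x)) by ring.
    by rewrite ler_wpM2r // mulr_ge0 ?cmod_ge0.
  by exists e => // t Jt Jft; apply: He.
have [|i _|e e0 He] := finite_min (@finite_finset _ [set: 'I_u])
    (P := fun i e => 0 < e -> forall t, julia f t -> julia f (f i t) -> P i e t).
- move=> i e e' ee' H e'0 t Jt Jft; apply: (monoP i e) => //; apply: H => //.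
  exact: lt_le_trans ee'.
- by have [e e0 He] := unifP i; exists e.
exists e, e^-1; split => // [|i x x1 z z' y y' Jx fx Jx1].
  by rewrite invr_ge0 ltW.
have := He i _ e0 (Some x) Jx; rewrite fx => /(_ I Jx1); apply => //.
Qed.

Variables Rs K q : R.
Hypotheses (Rs0 : 0 < Rs) (K0 : 0 < K) (q01 : 0 < q < 1) (shr : shrinking f Rs K q).

(** The distortion factors at the successive times differ from 1 by
    exponentially small amounts, so their product is bounded. *)
Lemma bounded_distortion : exists e M : R, [/\ 0 < e, 0 < M &
  forall om x n a b, jorbit f om x -> fpath f om a n -> fpath f om b n ->
   (forall j, (j <= n)%N -> cmod (a j - x j) <= K * q ^+ (n - j) /\ cmod (a j - x j) < e) ->
   (forall j, (j <= n)%N -> cmod (b j - x j) <= K * q ^+ (n - j) /\ cmod (b j - x j) < e) ->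
   forall j, (j <= n)%N -> cmod (a n - x n) * cmod (b j - x j) <=
     M * (cmod (b n - x n) * cmod (a j - x j))].
Proof.
have [e [L [e0 L0 H]]] := local_distortion.
have c0 : 0 <= 2 * L * K by rewrite !mulr_ge0 // ltW.
have [M M0 HM] := geometric_product_bound q01 c0.
exists e, M; split => // om x n a b xorb ap bp ax bx j jn.
have q0 : 0 < q by case/andP: q01.
suff : cmod (a n - x n) * cmod (b j - x j) <=
   \prod_(i < n - j) (1 + 2 * L * K * q ^+ i.+1) * (cmod (b n - x n) * cmod (a j - x j)).
  by move=> /le_trans; apply; rewrite ler_wpM2r ?mulr_ge0 ?cmod_ge0.
move: {2}(n - j)%N (erefl (n - j)%N) => m; elim: m j jn => [|m IH] j jn mE.
  have -> : j = n by apply/eqP; rewrite eqn_leq jn -subn_eq0 mE.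
  by rewrite subnn big_ord0 mul1r mulrC.
have jn1 : (j < n)%N by rewrite -subn_gt0 mE.
have mE' : (n - j.+1)%N = m by rewrite subnS mE.
have := IH j.+1 jn1 mE'; rewrite mE' mE big_ord_recr /=.
set Q := \prod_(i < m) _; have Q0 : 0 <= Q.
  by apply: prodr_ge0 => i _; rewrite addr_ge0 // mulr_ge0 // exprn_ge0 // ltW.
move=> IHj; have [->|bj] := eqVneq (b j) (x j).
  rewrite subrr cmod0 mulr0 !mulr_ge0 ?cmod_ge0 //.
  by rewrite addr_ge0 // mulr_ge0 // exprn_ge0 // ltW.
have [aj1 aj2] := ax j jn; have [bj1 bj2] := bx j jn.
have [Jx fx] := xorb j; have [Jx1 _] := xorb j.+1.
have [h1 h2] := H (om j) (x j) (x j.+1) (a j) (b j) _ _ Jx fx Jx1 aj2 bj2 (ap j jn1) (bp j jn1).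
have b1 : 0 < cmod (b j.+1 - x j.+1) by rewrite cmod_gt0 subr_eq0 h2.
have ab : cmod (a j - b j) <= 2 * K * q ^+ m.+1.
  have := cmod_triangle (x j) (a j) (b j); rewrite (cmodB (x j)) -mE; lra.
have fac : 1 + L * cmod (a j - b j) <= 1 + 2 * L * K * q ^+ m.+1.
  by rewrite lerD2l; have := ler_wpM2l L0 ab; lra.
rewrite -(ler_pM2r b1).
have s1 : cmod (a n - x n) * cmod (b j - x j) * cmod (b j.+1 - x j.+1) <=
   Q * cmod (b n - x n) * (cmod (a j.+1 - x j.+1) * cmod (b j - x j)).
  by have := ler_wpM2r (cmod_ge0 (b j - x j)) IHj; lra.
apply: (le_trans s1).
have s2 : cmod (a j.+1 - x j.+1) * cmod (b j - x j) <=
   (1 + 2 * L * K * q ^+ m.+1) * (cmod (b j.+1 - x j.+1) * cmod (a j - x j)).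
  by apply: (le_trans h1); rewrite ler_wpM2r // mulr_ge0 ?cmod_ge0.
have := ler_wpM2l (mulr_ge0 Q0 (cmod_ge0 (b n - x n))) s2.
by move=> /le_trans; apply; rewrite le_eqVlt; apply/orP; left; apply/eqP; ring.
Qed.

(** Comparison with the pullback of a point at the fixed distance r / 2 from
    x_n turns the exponential bound of [tracking] into one proportional to
    the distance. *)
Lemma linear_tracking : exists r B : R, [/\ 0 < r, 0 < B &
  forall om x, jorbit f om x -> forall n v, cmod (v - x n) < r ->
  exists z : nat -> C, [/\ z n = v, fpath f om z n &
    forall j, (j <= n)%N -> cmod (z j - x j) <= B * q ^+ (n - j) * cmod (v - x n)]].
Proof.
have q0 : 0 < q by case/andP: q01.
have [e [M [e0 M0 dist]]] := bounded_distortion.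
have [r /andP[r0 rRs] trk] := tracking hf Finf Rs0 K0 q01 shr e0.
exists r, (2 * M * K / r); split => // [|om x xorb n v vx].
  by rewrite divr_gt0 // !mulr_gt0.
have [z [zn zp zx]] := trk om x xorb n v vx; exists z; split => // j jn.
have [|a [an ap ax]] := trk om x xorb n (x n + (r / 2)%:C%C).
  by rewrite addrAC subrr add0r cmodR gtr0_norm; lra.
have := dist om x n a z xorb ap zp ax zx j jn.
rewrite an addrAC subrr add0r cmodR gtr0_norm ?divr_gt0 // zn.
have [a1 _] := ax j jn => h.
have : r / 2 * cmod (z j - x j) <= M * (cmod (v - x n) * (K * q ^+ (n - j))).
  by apply: (le_trans h); rewrite ler_pM2l // ler_wpM2l ?cmod_ge0.
have -> : 2 * M * K / r * q ^+ (n - j) * cmod (v - x n) =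
   (2 * (M * (cmod (v - x n) * (K * q ^+ (n - j))))) / r.
  by field; rewrite gt_eqF.
by rewrite ler_pdivlMr //; lra.
Qed.

Hypothesis perf : forall x (e : R), julia f (Some x) -> 0 < e ->
  exists v, [/\ julia f (Some v), v != x & cmod (v - x) < e].

(** By compactness perfectness is uniform at each fixed scale. *)
Lemma uniform_perfect_scale (e : R) : 0 < e -> exists2 d : R, 0 < d &
  forall x, julia f (Some x) -> exists v, [/\ julia f (Some v), d <= cmod (v - x) & cmod (v - x) < e].
Proof.
move=> e0.
have [||d d0 H] := @uniform_radius _ (julia f) (fun d (y : Chat) => forall x, y = Some x ->
   exists v, [/\ julia f (Some v), d <= cmod (v - x) & cmod (v - x) < e]) (@julia_closed R u f).
- move=> d d' y dd' H x yx; have [v [Jv dv ve]] := H x yx.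
  by exists v; split => //; exact: le_trans dv.
- move=> y Jy; have [x yx] := julia_finite Finf Jy; rewrite {y}yx in Jy *.
  have h0 : 0 < e / 2 by rewrite divr_gt0.
  have [v [Jv vx ve]] := perf Jy h0.
  have g0 : 0 < cmod (v - x) / 2 by rewrite divr_gt0 // cmod_gt0 subr_eq0.
  have [r r0 Hr] := near_some x g0; exists r, (cmod (v - x) / 2); split => // y _ /Hr[x' -> xx'] x'' [<-].
  exists v; split => //; first by have := cmod_triangle x' v x; lra.
  by have := cmod_triangle x v x'; rewrite (cmodB x x'); lra.
by exists d => // x Jx; exact: (H _ Jx x).
Qed.

(** Points of the Julia set at a fixed distance from the points x_n of the
    orbit of c are pulled back to c. The distances of these pullbacks to c
    tend to zero, and by bounded distortion consecutive ones are comparable,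
    so that none of the annuli is skipped. *)
Lemma uniformly_perfect : exists t1 M : R, [/\ 0 < t1, 1 <= M &
  forall c t, julia f (Some c) -> 0 < t <= t1 ->
  exists y, [/\ julia f (Some y), t <= cmod (y - c) & cmod (y - c) <= M * t]].
Proof.
have q0 : 0 < q by case/andP: q01.
have [e [M [e0 M0 dist]]] := bounded_distortion.
have [r /andP[r0 rRs] trk] := tracking hf Finf Rs0 K0 q01 shr e0.
have [d d0 far] := uniform_perfect_scale r0.
have [A A0 JA] := julia_bounded Finf.
have [s s0 Hs] := sdst_far A0 d0.
have [|i _|h h0 cont] := finite_min (@finite_finset _ [set: 'I_u])
   (P := fun i (h : R) => forall y y', sdst y y' < h -> sdst (f i y) (f i y') < s).
- by move=> i h h' hh' H y y' yy'; apply: H; exact: lt_le_trans hh'.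
- by have [h h0 H] := scont_unif (rational_scont (hf i)) s0; exists h.
exists d, (Num.max 1 (2 * M * r / h)); split => //; first by rewrite le_max lexx.
move=> c t Jc /andP[t0 td].
have [om [x [xorb x0]]] := jorbit_exists hf Finf Jc.
have sel n : exists v, [/\ julia f (Some v), d <= cmod (v - x n) & cmod (v - x n) < r].
  exact: far (xorb n).1.
have /(_ _)/cid-/all_sig[v vP] n := sel n.
have pull n : exists z, [/\ z n = v n, fpath f om z n &
    forall j, (j <= n)%N -> cmod (z j - x j) <= K * q ^+ (n - j) /\ cmod (z j - x j) < e].
  by have [_ _ vr] := vP n; exact: trk.
have /(_ _)/cid-/all_sig[z zP] n := pull n.
pose Y n := z n 0%N.
have JY n : julia f (Some (Y n)).
  have [zn zp _] := zP n; apply: (fpath_julia hf zp) => //.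
  by rewrite zn; have [] := vP n.
have Y0 : d <= cmod (Y 0%N - c).
  by have [z0 _ _] := zP 0%N; rewrite /Y z0 -x0; have [] := vP 0%N.
have ratio n : cmod (Y n - c) <= 2 * M * r / h * cmod (Y n.+1 - c).
  have [zn zp zx] := zP n; have [zn1 zp1 zx1] := zP n.+1.
  have zp1' : fpath f om (z n.+1) n by move=> j jn; apply: zp1; exact: ltnW.
  have := dist om x n (z n.+1) (z n) xorb zp1' zp _ zx 0%N isT.
  rewrite zn x0 -/(Y n) -/(Y n.+1) => /(_ _)/le_trans D.
  have [_ dv vr] := vP n; have [_ dv1 _] := vP n.+1.
  have low : h / 2 <= cmod (z n.+1 n - x n).
    rewrite leNgt; apply/negP => zh.
    move: dv1; rewrite leNgt => /negP; apply; apply: Hs; first exact: JA (xorb _).1.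
    rewrite -(xorb n).2 -zn1 -zp1 //; apply: cont => //.
    by rewrite (le_lt_trans (sdst_le_cmod _ _)) // cmodB; lra.
  have : h / 2 * cmod (Y n - c) <= M * (r * cmod (Y n.+1 - c)).
    apply: (le_trans (ler_wpM2r (cmod_ge0 _) low)).
    apply: D; last by rewrite ler_pM2l // ler_wpM2r ?cmod_ge0 // ltW.
    move=> j jn; have [z1 z2] := zx1 j (leqW jn); split => //.
    apply: (le_trans z1); rewrite subSn // exprS ler_wpM2l ?(ltW K0) //.
    by rewrite ger_pMl ?exprn_gt0 //; case/andP: q01 => _ /ltW.
  have -> : 2 * M * r / h * cmod (Y n.+1 - c) = 2 * (M * (r * cmod (Y n.+1 - c))) / h.
    by field; rewrite gt_eqF.
  by rewrite ler_pdivlMr //; lra.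
have [N HN] := geometric_small q01 K0 t0.
have exN : exists n, cmod (Y n - c) < t.
  exists N; have [_ _ zx] := zP N; have [z0 _] := zx 0%N isT.
  by rewrite /Y -x0 (le_lt_trans z0) // subn0 HN.
have [[|n] Yn nmin] := ex_minnP exN.
  by move: (lt_le_trans Yn (le_trans td Y0)); rewrite ltxx.
exists (Y n); split => //.
  by rewrite leNgt; apply/negP => /nmin; rewrite ltnn.
apply: (le_trans (ratio n)); apply: ler_pM; rewrite ?cmod_ge0 ?(ltW Yn) //.
- by rewrite divr_ge0 ?mulr_ge0 // ltW.
- by rewrite le_max lexx orbT.
Qed.

End Expanding.

(** * Vertices without critical points *)

Section Separation.
Context {R : realType}.
Local Notation C := R[i].
Variable S : set C.
Hypothesis finS : finite_set S.

Lemma shadow_far (D a b : R) (x z t : C) : cmod (z - x) <= a -> b <= cmod (x - t) ->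
  D + a <= b -> D <= cmod (z - t).
Proof. by have := cmod_triangle z x t; rewrite (cmodB x z); lra. Qed.

Lemma finite_separation : exists2 d : R, 0 < d &
  forall c c', S c -> S c' -> c' != c -> d <= cmod (c' - c).
Proof.
have [|c Sc|d d0 H] := finite_min finS (P := fun c (d : R) => forall c', S c' -> c' != c ->
    d <= cmod (c' - c)).
- by move=> c d d' dd' H c' Sc' cc'; apply: (le_trans dd'); exact: H.
- have [|c' Sc'|d d0 H] := finite_min finS (P := fun c' (d : R) => c' != c -> d <= cmod (c' - c)).
  + by move=> c' d d' dd' H cc'; apply: (le_trans dd'); exact: H.
  + have [->|cc'] := eqVneq c' c; first by exists 1; rewrite ?eqxx.
    by exists (cmod (c' - c)); rewrite ?cmod_gt0 ?subr_eq0.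
  by exists d => // c' Sc'; exact: H.
by exists d => // c c' Sc Sc'; exact: H.
Qed.

End Separation.

(** The scale induction. An orbit issuing from scale s around a point of the
    Julia set near S is followed until its scale, which grows geometrically,
    is comparable with its distance to S. It is then diverted to a point of
    the Julia set in an annulus around the nearby point of S, and the
    construction is resumed from there at a scale at least twice as large,
    until a fixed scale is reached. Shadowing puts the pieces together. *)
Lemma hub_expanding {R : realType} {u : nat} (f : 'I_u -> sphere R -> sphere R)
  (hf : forall i, nonconstant_rational (f i)) (Finf : fatou f None)
  (noncrit : forall i z, julia f (f i z) -> ~ crit (f i) z)
  (Rs K q : R) (Rs0 : 0 < Rs) (K0 : 0 < K) (q01 : 0 < q < 1) (shr : shrinking f Rs K q)
  (perf : forall x (e : R), julia f (Some x) -> 0 < e ->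
     exists v, [/\ julia f (Some v), v != x & cmod (v - x) < e])
  (S : set R[i]) (finS : finite_set S) (aper : aperiodic f S)
  (SJ : forall s, S s -> julia f (Some s)) :
  exists2 d : R, 0 < d & forall r D c b,
    0 < r <= d -> D <= 2 * r -> S c -> S b -> reach f S D c r b.
Proof.
have q0 : 0 < q by case/andP: q01.
(* The scale at time k is s / mu ^ k. It grows at half the exponential rate
   of the expansion, so that the shadowing errors at time j, of order q ^ (k
   - j) times the scale at time k, are small compared with the scale at time
   j unless j is close to k. *)
pose mu := Num.sqrt q; have mu0 : 0 < mu by rewrite sqrtr_gt0.
have mu2 : mu ^+ 2 = q by rewrite sqr_sqrtr // ltW.
have mu1 : mu < 1.
  by rewrite -(@ltr_pXn2r _ 2) ?nnegrE ?(ltW mu0) // mu2 expr1n; case/andP: q01.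
have qmu n : q ^+ n = mu ^+ n * mu ^+ n by rewrite -mu2 -exprM mulnC exprM expr2.
have [t1 [M [t10 M1 UP]]] := uniformly_perfect hf Finf noncrit Rs0 K0 q01 shr perf.
have [r2 [B [r20 B0 LT]]] := linear_tracking hf Finf noncrit Rs0 K0 q01 shr.
have M0 : 0 < M by lra.
have mu01 : 0 < mu < 1 by rewrite mu0.
have [N1 HN1] := geometric_small mu01 (mulr_gt0 (mulr_gt0 (ltr0Sn _ 25) M0) B0) ltr01.
have [N2 HN2] := geometric_small mu01 (ltr0Sn R 1) ltr01.
(* After J0 steps the contraction absorbs the constants M and B; returns to
   S in at most J0 steps are excluded by aperiodicity. *)
pose J0 := maxn N1 N2.
have J0a n : (J0 <= n)%N -> 26 * M * B * mu ^+ n < 1.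
  by move=> Jn; apply: HN1; exact: leq_trans (leq_maxl _ _) Jn.
have J0b n : (J0 <= n)%N -> 2 * mu ^+ n < 1.
  by move=> Jn; apply: HN2; exact: leq_trans (leq_maxr _ _) Jn.
have [de de0 AP] := no_early_return hf finS aper J0.
have [si si0 sep] := finite_separation finS.
pose smax := Num.min (Num.min (de / (26 * M * (B + 1))) (t1 / 8)) (Num.min (r2 / (26 * M)) (si / (16 * M))).
have smax0 : 0 < smax by rewrite !lt_min !divr_gt0 ?mulr_gt0 //; lra.
have sm_de : smax * (26 * M * (B + 1)) <= de.
  rewrite -ler_pdivlMr ?mulr_gt0 //; last by lra.
  by rewrite !ge_min lexx.
have sm_t1 : 8 * smax <= t1.
  have : smax <= t1 / 8 by rewrite !ge_min lexx !orbT.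
  lra.
have sm_r2 : 26 * M * smax <= r2.
  by rewrite mulrC -ler_pdivlMr ?mulr_gt0 // !ge_min lexx !orbT.
have sm_si : 16 * M * smax <= si.
  by rewrite mulrC -ler_pdivlMr ?mulr_gt0 // !ge_min lexx !orbT.
clearbody smax; have MB0 := mulr_gt0 M0 B0.
have Msm : smax <= M * smax by rewrite ler_peMl // ltW.
have MBsm : 26 * (M * B * smax) + 26 * (M * smax) <= de.
  by apply: le_trans sm_de; lra.
have MBsm0 : 0 < M * B * smax by rewrite mulr_gt0.
pose rho := Num.min (Num.min r2 (smax / B)) smax.
have rho0 : 0 < rho by rewrite !lt_min r20 smax0 divr_gt0.
have rho_r2 : rho <= r2 by rewrite !ge_min lexx.
have rho_B : B * rho <= smax.
  by rewrite mulrC -ler_pdivlMr // !ge_min lexx !orbT.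
have rho_s : rho <= smax by rewrite !ge_min lexx !orbT.
clearbody rho; have [dT dT0 targ] := reach_targets hf Finf finS aper SJ Rs0 K0 q01 shr rho0.
exists (Num.min (Num.min smax (dT / 2)) (de / 4)).
  by rewrite !lt_min smax0 !divr_gt0.
move=> r D c b /andP[r0]; rewrite !le_min => /andP[/andP[r_smax r_dT] r_de] D2r Sc Sb.
have D_dT : D <= dT by clear - D2r r_dT; lra.
suff P N : forall s y, r <= s -> smax < s * 2 ^+ N -> julia f (Some y) ->
    (exists2 c, S c & cmod (y - c) <= 8 * M * s) -> reach f S D y s b.
  have [N HN] : exists N, smax / r < 2 ^+ N :> R.
    exists (Num.bound (smax / r)); apply: lt_trans (archi_boundP _) _.
      by rewrite divr_ge0 // ltW.
    by rewrite -natrX ltr_nat ltn_expl.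
  apply: (P N); rewrite ?lexx //; [by rewrite mulrC -ltr_pdivrMr|exact: SJ|].
  by exists c => //; rewrite subrr cmod0 !mulr_ge0 // ltW.
have base s y : smax < s -> julia f (Some y) -> reach f S D y s b.
  move=> ss Jy; have [n [om [z [n0 zy zn zp far]]]] := targ y b Jy Sb.
  exists n, om, z; split => // [|j t /andP[_ jn] St].
    exact: lt_trans zy (le_lt_trans rho_s ss).
  exact: le_trans D_dT (far j t jn St).
elim: N => [|N IH] s y rs ssm Jy [c0 Sc0 yc0].
  by apply: base => //; rewrite expr0 mulr1 in ssm.
have [ss|s_sm] := ltP smax s; first exact: base.
have s0 : 0 < s by exact: lt_le_trans rs.
have [om [x [xorb x0]]] := jorbit_exists hf Finf Jy.
pose sk k := s / mu ^+ k.
have muk k : 0 < mu ^+ k by rewrite exprn_gt0.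
have sk0 k : 0 < sk k by rewrite divr_gt0.
have sk_ge k : s <= sk k.
  by rewrite ler_pdivlMr // ger_pMr // exprn_ile1 // ltW.
have sk_sub j k : (j <= k)%N -> mu ^+ (k - j) * sk k = sk j.
  move=> jk; rewrite /sk -{2}(subnK jk) exprD.
  by field; rewrite !gt_eqF.
pose hit k := (0 < k)%N && `[< exists2 t, S t & cmod (x k - t) < 4 * sk k >].
have exk : exists k, (0 < k)%N && (hit k || (smax < sk k)).
  have [n Hn] := geometric_small mu01 smax0 s0.
  exists n.+1 => /=; apply/orP; right; rewrite /sk ltr_pdivlMr //.
  by apply: Hn; exact: leqnSn.
have [k /andP[k0 kP] kmin] := ex_minnP exk.
have before j : (0 < j < k)%N -> forall t, S t -> 4 * sk j <= cmod (x j - t).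
  move=> /andP[j0 jk] t St; rewrite leNgt; apply/negP => xt.
  suff /kmin : (0 < j)%N && (hit j || (smax < sk j)) by rewrite leqNgt jk.
  rewrite j0 /= /hit j0 /=; apply/orP; left.
  by apply/asboolP; exists t.
have D3 j : D <= 3 * sk j by have := sk_ge j; clear - D2r rs s0; lra.
(* If the fixed scale smax is reached first, [targ] ends the segment; otherwise
   the orbit has come close to a vertex c1 and is diverted there. *)
have [big|small] := ltP smax (sk k).
  have [n' [om' [z' [n'0 z'x z'n zp' far']]]] := targ (x k) b (xorb k).1 Sb.
  have [z [zk zp zx]] := LT om x xorb k _ (lt_le_trans z'x rho_r2).
  have bound j : (j <= k)%N -> cmod (z j - x j) < sk j.
    move=> jk; apply: (le_lt_trans (zx j jk)).
    rewrite mulrAC; apply: (@le_lt_trans _ _ (smax * q ^+ (k - j))).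
      rewrite ler_wpM2r ?exprn_ge0 ?(ltW q0) //.
      apply: le_trans rho_B; rewrite ler_wpM2l ?(ltW B0) // ltW //.
    rewrite qmu mulrA; apply: (@lt_le_trans _ _ (sk k * mu ^+ (k - j) * mu ^+ (k - j))).
      by rewrite ltr_pM2r // ltr_pM2r.
    rewrite (mulrC (sk k)) (sk_sub j k jk) ger_pMr //.
    by rewrite exprn_ile1 ?ltW.
  apply: (reach_join k0 zp).
  - by rewrite -x0; apply: lt_le_trans (bound 0%N isT) _; rewrite /sk expr0 divr1.
  - move=> j t /andP[j0 jk] St.
    apply: (shadow_far (ltW (bound j (ltnW jk))) (before j _ t St)); first by rewrite j0.
    by have -> : 4 * sk j = 3 * sk j + sk j; [ring|rewrite lerD2r D3].
  - exists n', om', z'; split => // j t jn St.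
    exact: le_trans D_dT (far' j t jn St).
have hk : hit k by case/orP: kP => //; rewrite ltNge small.
have [c1 Sc1 xc1] : exists2 t, S t & cmod (x k - t) < 4 * sk k.
  by move: hk; rewrite /hit k0 /= => /asboolP.
have Msk : M * sk k <= M * smax by rewrite ler_wpM2l // ltW.
have Msk0 : sk k <= M * sk k by rewrite ler_peMl // ltW.
have xpath j : fpath f (fun i => om (j + i)%N) (fun i => x (j + i)%N) (k - j).
  by move=> i _; rewrite addnS; have [] := xorb (j + i)%N.
have ret j t : (j < k)%N -> (k - j <= J0)%N -> S t -> de <= cmod (x j - t).
  move=> jk kj St; rewrite leNgt; apply/negP => xt.
  have := AP _ _ _ t c1 (xpath j) _ St Sc1; rewrite subn_gt0 jk kj /= addn0 subnKC ?(ltnW jk) //.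
  move=> /(_ isT xt); clear - xc1 Msk Msk0 MBsm MBsm0 smax0 Msm; lra.
have kJ : (J0 < k)%N.
  rewrite ltnNge; apply/negP => kJ0.
  have := ret 0%N c0 k0; rewrite subn0 => /(_ kJ0 Sc0).
  have Ms : M * s <= M * smax by rewrite ler_wpM2l // ltW.
  rewrite x0; clear - yc0 Ms MBsm MBsm0 smax0 Msm; lra.
have sk2 : 2 * s <= sk k.
  rewrite ler_pdivlMr //; have := J0b k (ltnW kJ) => h.
  by rewrite mulrAC ger_pMl // ltW.
have t8 : 0 < 8 * sk k <= t1.
  by rewrite mulr_gt0 //=; apply: le_trans sm_t1; rewrite ler_pM2l.
have [y' [Jy' y'low y'up]] := UP c1 (8 * sk k) (SJ _ Sc1) t8.
have rec : reach f S D y' (sk k) b.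
  apply: IH => //; first exact: le_trans rs (sk_ge k).
    apply: lt_le_trans ssm _; rewrite exprS mulrCA mulrA ler_pM2r ?exprn_gt0 //.
  by exists c1 => //; rewrite (mulrC 8) -mulrA.
have [n' [om' [z' [n'0 z'y z'n zp' far']]]] := rec.
have y'far t : S t -> 8 * sk k <= cmod (y' - t).
  move=> St; have [->//|tc1] := eqVneq t c1.
  have := sep _ _ Sc1 St tc1; have := cmod_triangle y' t c1.
  by rewrite (cmodB t y'); clear - y'up Msk Msk0 sm_si; lra.
have z'x : cmod (z' 0%N - x k) <= 13 * M * sk k.
  have := cmod_triangle y' (z' 0%N) (x k); have := cmod_triangle c1 y' (x k).
  by rewrite (cmodB c1 (x k)); clear - z'y y'up xc1 Msk0; lra.
have [|z [zk zp zx]] := LT om x xorb k (z' 0%N); first by apply: (le_lt_trans z'x); clear - Msk sm_r2 smax0 Msm; lra.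
have bound j : (j <= k)%N -> cmod (z j - x j) <= 13 * M * B * mu ^+ (k - j) * sk j.
  move=> jk; apply: (le_trans (zx j jk)).
  rewrite -(sk_sub j k jk) qmu.
  have := ler_wpM2l (mulr_ge0 (ltW B0) (mulr_ge0 (ltW (muk (k - j)%N)) (ltW (muk (k - j)%N)))) z'x.
  by move=> /le_trans; apply; rewrite le_eqVlt; apply/orP; left; apply/eqP; ring.
have bound2 j : (j <= k)%N -> (J0 <= k - j)%N -> cmod (z j - x j) < sk j.
  move=> jk kj; apply: (le_lt_trans (bound j jk)).
  have := J0a _ kj; have := mulr_gt0 MB0 (muk (k - j)%N) => h1 h2.
  by rewrite gtr_pMl //; clear - h1 h2; lra.
apply: (reach_join k0 zp).
- rewrite -x0; apply: lt_le_trans (bound2 0%N isT _) _; first by rewrite subn0 ltnW.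
  by rewrite /sk expr0 divr1.
- move=> j t /andP[j0 jk] St; have [kj|kj] := leqP J0 (k - j).
    apply: (shadow_far (ltW (bound2 j (ltnW jk) kj)) (before j _ t St)); first by rewrite j0.
    by have -> : 4 * sk j = 3 * sk j + sk j; [ring|rewrite lerD2r D3].
  have h1 := ret j t jk (ltnW kj) St.
  have h2 : cmod (z j - x j) <= 13 * (M * B * smax).
    apply: (le_trans (bound j (ltnW jk))); rewrite -(sk_sub j k (ltnW jk)).
    have m1 : mu ^+ (k - j) <= 1 by rewrite exprn_ile1 ?ltW.
    have m2 : mu ^+ (k - j) * (mu ^+ (k - j) * sk k) <= smax.
      apply: le_trans small; rewrite mulrA ger_pMl //.
      by rewrite -[leRHS]mulr1 ler_pM // ltW.
    by have := ler_wpM2l (ltW MB0) m2; clear; lra.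
  by apply: (shadow_far h2 h1); clear - D2r r_de MBsm smax0 Msm; lra.
- exists n', om', z'; split => // j t jn St.
  have [->|j0] := posnP j; last by apply: far' => //; rewrite j0.
  apply: (shadow_far (ltW z'y) (y'far t St)).
  by apply: le_trans (lerD (D3 k) (lexx _)) _; have := sk0 k; clear; lra.
Qed.

(** * The metric of the skew product *)

Section SkewMetric.
Context {R : realType} {u : nat} {theta : {itv R & `]0, 1[}}.
Local Notation C := R[i].
Local Notation Chat := (sphere R).
Local Notation SC := (SC u theta).

Lemma SC_distE (x y : SC) : mdist x y = sc_dist x y. Proof. by []. Qed.

Lemma SC_nbhsP (x : SC) (A : set SC) :
  nbhs x A <-> exists2 e : R, 0 < e & forall y, mdist x y < e -> A y.
Proof.
split=> [/nbhs_ballP[e /= e0 eA]|[e e0 eA]].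
  by exists e => // y xy; apply: eA; rewrite ballEmdist.
by apply/nbhs_ballP; exists e => //= y; rewrite ballEmdist => /eA.
Qed.

Lemma SC_closureP (A : set SC) (x : SC) :
  closure A x <-> forall e : R, 0 < e -> exists2 y, A y & mdist x y < e.
Proof.
split=> [clA e e0|H B /SC_nbhsP[e e0 eB]].
  have [|y [Ay xy]] := clA [set y | mdist x y < e]; first by apply/SC_nbhsP; exists e.
  by exists y.
by have [y Ay xy] := H e e0; exists y; split => //; exact: eB.
Qed.

Lemma theta_gt0 : 0 < theta%:num :> R. Proof. by []. Qed.
Lemma theta_lt1 : theta%:num < 1 :> R. Proof. by []. Qed.

Lemma cmod_le_dist (x y : SC) : cmod (x.2 - y.2) <= mdist x y.
Proof. by rewrite SC_distE /sc_dist le_max lexx orbT. Qed.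

Lemma sdist_le1 (om ta : nat -> 'I_u) : sdist theta om ta <= 1.
Proof. by rewrite -(expr0 theta%:num); apply/sdist_leP. Qed.

Lemma wcat_ge (w : seq 'I_u) om n : wcat w om (size w + n) = om n.
Proof. by rewrite /wcat nth_default ?leq_addr // addKn. Qed.

Lemma wcat_inj (w : seq 'I_u) om ta : wcat w om = wcat w ta -> om = ta.
Proof. by move=> E; apply/funext => n; rewrite -(wcat_ge w) E wcat_ge. Qed.

Lemma wcat_initial (om ta : nat -> 'I_u) l :
  (forall n, ta n = om (l + n)%N) -> wcat (initial om l) ta = om.
Proof.
move=> H; apply/funext => n; rewrite /wcat; have [nl|nl] := ltnP n l.
  by rewrite nth_mkseq.
by rewrite nth_default ?size_mkseq // H subnKC.
Qed.

Lemma sdist_wcat (w : seq 'I_u) (om ta : nat -> 'I_u) : (0 < size w)%N ->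
  sdist theta (wcat w om) (wcat w ta) <= theta%:num * sdist theta om ta.
Proof.
move=> w0; rewrite {2}/sdist; case: pselect => [h|h]; last first.
  have -> : om = ta by apply/funext => n; apply/eqP; apply: contraT => hn; case: h; exists n.
  by rewrite sdistxx mulr0.
rewrite -exprS; case: ex_minnP => m _ mmin; apply/sdist_leP => k km.
have [kw|kw] := ltnP k (size w).
  by rewrite /wcat; apply: set_nth_default.
rewrite -(subnKC kw) !wcat_ge; apply/eqP; apply: contraT => /mmin; lia.
Qed.

(** An ultrafilter on the ball fixes each letter, since there are finitely
    many, and converges in the second coordinate. *)
Lemma SC_ball_compact (b : C) (r : R) : 0 <= r -> compact [set x : SC | cmod (x.2 - b) <= r].
Proof.
move=> r0; rewrite compact_ultra => F UF FB.
have [xi Hxi] : exists xi : nat -> 'I_u, forall n, F [set x | x.1 n = xi n].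
  suff /(_ _)/cid-/all_sig[xi Hxi] n : exists i, F [set x : SC | x.1 n = i] by exists xi.
  apply: contrapT => none.
  have H i : F (~` [set x : SC | x.1 n = i]).
    by have [Fi|//] := in_ultra_setVsetC [set x : SC | x.1 n = i] UF; case: none; exists i.
  have /filter_ex[x Hx] : F [set x : SC | forall i, x.1 n <> i].
    exact: filter_forall H.
  exact: (Hx (x.1 n)).
pose h (x : SC) : Chat := Some x.2.
pose K := (Some : C -> Chat) @` [set z | cmod (z - b) <= r].
have cK : compact K.
  by apply: (@subclosed_compact Chat K setT); [exact: closed_disc|exact: compact_sphere|].
have [|_ [[z zb <-] clz]] := cK (h @ F) _.
  by rewrite nbhs_filterE /fmap /=; apply: filterS FB => x xb; exists x.2.
have near_z e : 0 < e -> F [set x : SC | cmod (x.2 - z) < e].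
  move=> e0; have [//|FN] := in_ultra_setVsetC [set x : SC | cmod (x.2 - z) < e] UF.
  have [d d0 Hd] := near_some z e0.
  have [||_ [[x /= xe <-] /Hd[w [xw] wz]]] := clz (h @` (~` [set x : SC | cmod (x.2 - z) < e])) [set y | sdst (Some z) y < d].
  - by rewrite nbhs_filterE /fmap /=; apply: filterS FN => x xe; exists x.
  - by apply/snbhsP; exists d.
  by case: xe; rewrite /= xw.
exists ((xi, z) : SC); split => // A /SC_nbhsP[e e0 eA].
have th1 : `|theta%:num| < 1 :> R by rewrite gtr0_norm ?theta_lt1 ?theta_gt0.
have [N HN] : exists N, theta%:num ^+ N < e :> R.
  have /cvgrPdist_lt /(_ _ e0) [N _ HN] := cvg_expr th1; exists N.
  by have := HN N (leqnn N); rewrite /= sub0r normrN ger0_norm ?exprn_ge0.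
have FN : F [set x : SC | forall i : 'I_N, x.1 i = xi i].
  by apply: filter_forall => i; exact: Hxi.
apply: filterS (filterI FN (near_z e e0)) => x [/= xN xz]; apply: eA.
rewrite SC_distE /sc_dist gt_max /= cmodB xz andbT; apply: le_lt_trans HN.
by apply/sdist_leP => k kN; rewrite (xN (Ordinal kN)).
Qed.

End SkewMetric.

(** * Holomorphic maps along segments *)

Section Segment.
Context {R : realType}.
Local Notation C := R[i].
Local Notation Chat := (sphere R).

Lemma real_induction (P : R -> Prop) : P 0 ->
  (forall t, 0 <= t < 1 -> (forall s, 0 <= s <= t -> P s) ->
     exists2 d : R, 0 < d & forall s, t <= s < t + d -> P s) ->
  (forall t, 0 < t <= 1 -> (forall s, 0 <= s < t -> P s) -> P t) ->
  forall t, 0 <= t <= 1 -> P t.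
Proof.
move=> P0 step lim.
pose E := [set t : R | 0 <= t <= 1 /\ forall s, 0 <= s <= t -> P s].
have E0 : E 0.
  by split=> [|s /andP[s0 s0']]; rewrite ?lexx ?ler01 // (@le_anti _ _ s 0) // s0 s0'.
have hsE : has_sup E by split; [exists 0|exists 1 => t [/andP[]]].
pose T := sup E; have T0 : 0 <= T by apply: (sup_upper_bound hsE).
have T1 : T <= 1 by apply: (ge_sup (ex_intro _ 0 E0)) => t [/andP[]].
have below s : 0 <= s < T -> P s.
  move=> /andP[s0 sT]; have Ts0 : 0 < T - s by rewrite subr_gt0.
  have [t [_ tP] st] := sup_adherent Ts0 hsE.
  by apply: tP; rewrite s0 /= ltW //; move: st; rewrite -/T; lra.
have PT s : 0 <= s <= T -> P s.
  move=> /andP[s0]; rewrite le_eqVlt => /orP[/eqP ->|sT]; last by apply: below; rewrite s0.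
  by have [->|Tn0] := eqVneq T 0; last by apply: lim => //; rewrite lt_def Tn0 T0.
have TE : T = 1.
  apply/eqP; rewrite eq_le T1 leNgt; apply/negP => T1'.
  have [|d d0 Hd] := step T _ PT; first by rewrite T0.
  pose t := Num.min 1 (T + d / 2).
  have tT : T < t by rewrite lt_min T1' ltrDl divr_gt0.
  have : E t.
    split=> [|s /andP[s0 st]].
      by rewrite ge_min lexx /= (le_trans T0) // ltW.
    have [sT|sT] := leP s T; first by apply: PT; rewrite s0.
    apply: Hd; rewrite (ltW sT) /=; move: st; rewrite le_min => /andP[_]; lra.
  by move=> /(sup_upper_bound hsE); rewrite leNgt tT.
by move=> t t01; apply: PT; rewrite TE.
Qed.

(** A map to the sphere, holomorphic with derivative at most L wherever it
    is finite, stays bounded along a segment issuing from a finite value,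
    hence finite. Where it is first infinite, continuity on the sphere would
    be violated. *)
Lemma segment_lipschitz (h : C -> Chat) (v0 v1 : C) (L : R) : 0 <= L ->
  (forall t : R, 0 <= t <= 1 -> let v := v0 + (t%:C)%C * (v1 - v0) in
     (forall e : R, 0 < e -> exists2 d : R, 0 < d & forall v', cmod (v' - v) < d -> sdst (h v) (h v') < e) /\
     (h v <> None -> exists2 a, has_cderiv (fin \o h) v a & cmod a <= L)) ->
  h v0 <> None -> h v1 <> None /\ cmod (fin (h v1) - fin (h v0)) <= L * cmod (v1 - v0).
Proof.
move=> L0 H h0; pose p (t : R) : C := v0 + (t%:C)%C * (v1 - v0).
pose D := cmod (v1 - v0); have D0 : 0 <= D by exact: cmod_ge0.
have pp s t : cmod (p s - p t) = `|s - t| * D.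
  have -> : p s - p t = ((s - t)%:C)%C * (v1 - v0) by rewrite /p rmorphB; ring.
  by rewrite cmodM cmodR.
have p0 : p 0 = v0 by rewrite /p mul0r addr0.
have p1 : p 1 = v1 by rewrite /p mul1r addrC subrK.
have key (e : R) : 0 < e -> forall t, 0 <= t <= 1 -> h (p t) <> None /\
    cmod (fin (h (p t)) - fin (h v0)) <= (L + e) * (t * D).
  move=> e0; have Le : 0 <= L + e by lra.
  apply: real_induction => [|t /andP[t0 t1] Ht|t /andP[t0 t1] Ht].
  - by rewrite p0 subrr cmod0 mul0r mulr0.
  - have t01 : 0 <= t <= 1 by rewrite t0 ltW.
    have [|ht bt] := Ht t; first by rewrite t0 lexx.
    have [hc hd] := H t t01; rewrite -/(p t) in hc hd.
    have [a ha aL] := hd ht; have [d d0 Hd] := ha e e0.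
    have [z hz] : exists z, h (p t) = Some z by case: (h (p t)) ht => // z _; exists z.
    have [r r0 Hr] := near_some z ltr01; rewrite hz in hc.
    have [d' d'0 Hd'] := hc r r0.
    exists (Num.min d d' / (D + 1)); first by rewrite divr_gt0 ?lt_min ?d0 //; lra.
    move=> s /andP[ts sd].
    have sp : cmod (p s - p t) < Num.min d d'.
      rewrite pp ger0_norm ?subr_ge0 //.
      have : (s - t) * (D + 1) < Num.min d d' by rewrite -ltr_pdivlMr; lra.
      by apply: le_lt_trans; rewrite ler_wpM2l //; lra.
    move: sp; rewrite lt_min => /andP[/Hd sp1 /Hd'/Hr[w hw _]]; split; first by rewrite hw.
    have lip : cmod (fin (h (p s)) - fin (h (p t))) <= (L + e) * cmod (p s - p t).
      have -> : fin (h (p s)) - fin (h (p t)) =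
        (fin (h (p s)) - fin (h (p t)) - a * (p s - p t)) + a * (p s - p t) by ring.
      apply: (le_trans (cmodD _ _)); rewrite mulrDl addrC cmodM.
      by apply: lerD; [rewrite ler_wpM2r ?cmod_ge0|exact: sp1].
    apply: (le_trans (cmod_triangle (fin (h (p t))) _ _)).
    apply: (le_trans (lerD lip bt)); rewrite pp ger0_norm ?subr_ge0 //.
    by rewrite le_eqVlt; apply/orP; left; apply/eqP; ring.
  - have t01 : 0 <= t <= 1 by rewrite t1 ltW.
    have [hc hd] := H t t01; rewrite -/(p t) in hc hd.
    have approx (d : R) : 0 < d -> exists s, [/\ 0 <= s < t & cmod (p s - p t) < d].
      move=> d0; exists (Num.max 0 (t - d / 2 / (D + 1))).
      have D1 : 0 < D + 1 by lra.
      have q0 : 0 < d / 2 / (D + 1) by rewrite !divr_gt0.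
      have s1 : Num.max 0 (t - d / 2 / (D + 1)) < t by rewrite gt_max t0 gtrBl q0.
      split; first by rewrite le_max lexx.
      rewrite pp distrC gtr0_norm ?subr_gt0 //.
      have s2 : t - Num.max 0 (t - d / 2 / (D + 1)) <= d / 2 / (D + 1).
        by rewrite lerBlDr -lerBlDl le_max lexx orbT.
      apply: (le_lt_trans (ler_wpM2r D0 s2)).
      have -> : d / 2 / (D + 1) * D = (d / 2 * D) / (D + 1) by rewrite mulrAC.
      by rewrite ltr_pdivrMr //; nra.
    pose A := cmod (fin (h v0)) + (L + e) * D.
    have bdd s : 0 <= s < t -> cmod (fin (h (p s))) <= A.
      move=> st; have [_ b] := Ht s st; move: st => /andP[s0 st].
      have := cmod_lowerB (fin (h (p s))) (fin (h v0)).
      have : (L + e) * (s * D) <= (L + e) * D.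
        by rewrite ler_wpM2l // ler_piMl //; lra.
      by rewrite /A; lra.
    have A0 : 0 <= A by rewrite addr_ge0 ?cmod_ge0 ?mulr_ge0.
    have A1 : 0 < A ^+ 2 + 1 by rewrite ltr_wpDl // sqr_ge0.
    have ht : h (p t) <> None.
      have iA : 0 < (A ^+ 2 + 1)^-1 by rewrite invr_gt0.
      have [d d0 Hd] := hc _ iA; have [s [st /Hd hs]] := approx d d0.
      have [hsn _] := Ht s st; have As := bdd s st.
      case E : (h (p s)) hsn As hs => [z|//] _ /= As; rewrite sdstC => /(sdst_near As (lexx _)).
      by move=> [w -> _].
    split => //; have [a ha _] := hd ht.
    apply/ler_addgt0Pr => e1 e10.
    have [d d0 Hd] := has_cderiv_lip ha.
    have c0 : 0 < cmod a + 1 by rewrite ltr_wpDl ?cmod_ge0.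
    have m0 : 0 < Num.min d (e1 / (cmod a + 1)) by rewrite lt_min d0 divr_gt0.
    have [s [st]] := approx _ m0; rewrite lt_min ltr_pdivlMr // => /andP[/Hd s1 s2].
    have [_ b] := Ht s st; move: st => /andP[s0 st].
    have b2 : (L + e) * (s * D) <= (L + e) * (t * D).
      by rewrite ler_wpM2l // ler_wpM2r // ltW.
    have := cmod_triangle (fin (h (p s))) (fin (h (p t))) (fin (h v0)).
    rewrite (cmodB (fin (h (p t))) (fin (h (p s)))) => tr.
    apply: (le_trans tr); rewrite addrC lerD //; first exact: le_trans b b2.
    by apply: (le_trans s1); rewrite mulrC ltW.
have t1 : 0 <= (1 : R) <= 1 by rewrite ler01 lexx.
split; first by have [] := key 1 ltr01 1 t1; rewrite p1.
apply/ler_addgt0Pr => e e0; have e1 : 0 < e / (D + 1) by rewrite divr_gt0 //; lra.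
have [_] := key _ e1 1 t1; rewrite p1 mul1r => /le_trans; apply.
rewrite mulrDl lerD2l mulrAC ler_pdivrMr; last by lra.
by rewrite ler_wpM2l ?(ltW e0) //; lra.
Qed.

End Segment.

(** * Edges as first returns *)

Section Edges.
Context {R : realType} {u : nat} {theta : {itv R & `]0, 1[}}.
Local Notation C := R[i].
Local Notation Chat := (sphere R).
Local Notation SC := (SC u theta).
Variable f : 'I_u -> Chat -> Chat.
Hypothesis hf : forall i, nonconstant_rational (f i).

Lemma iter_skew n (om : nat -> 'I_u) (z : Chat) :
  iter n (skew f) (om, z) = (fun k => om (n + k)%N, fword f (initial om n) z).
Proof.
elim: n => [|n IH] //; have iS : initial om n.+1 = rcons (initial om n) (om n) by exact: mkseqS.
rewrite iterS IH iS fword_rcons /skew /= addn0; congr pair.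
by apply/funext => k; rewrite /shift addSnnS.
Qed.

Lemma emb_inj (x y : SC) : emb x = emb y -> x = y.
Proof. by case: x y => [a b] [c d] [-> ->]. Qed.

Lemma mapE (tau : hib R u) (x y : SC) : hib_lift tau x = emb y -> hib_map tau x = y.
Proof. by case: y => a b [] e1 e2; rewrite /hib_map e1 e2. Qed.

Variables (rR : R) (S : set C).
Hypotheses (rR0 : 0 < rR) (SP : forall s, S s -> ~ enbhd (PCV f) (8 * rR) s).

(** The skew product removes the first letter of the word of a branch. *)
Lemma HIB_drop b k (tau : hib R u) : S b -> HIB f rR b tau -> (k <= size (hib_word tau))%N ->
  exists rho, [/\ HIB f rR b rho, hib_word rho = drop k (hib_word tau) &
    forall x : SC, B2 b (4 * rR) x.2 -> iter k (skew f) (hib_lift tau x) = hib_lift rho x].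
Proof.
move=> Sb; elim: k tau => [|k IH] tau Ht ks; first by exists tau; rewrite drop0.
case: tau Ht ks => b' [//|i w] h Ht /= ks.
have bb : b' = b by have [] := Ht.
rewrite bb in Ht; have Hr := HIB_behead hf rR0 (SP Sb) Ht.
have [rho [H1 H2 H3]] := IH _ Hr ks; exists rho; split => // x xb.
by rewrite -H3 // -iterS iterSr; congr (iter k _ _); rewrite /hib_lift /skew /= ifT.
Qed.

Lemma lift_inj b (tau : hib R u) (x y : SC) : HIB f rR b tau -> B2 b (4 * rR) x.2 ->
  B2 b (4 * rR) y.2 -> hib_lift tau x = hib_lift tau y -> x = y.
Proof.
move=> [_ _ inv _] xb yb [/wcat_inj e1 e2].
by case: x y xb yb e1 e2 => [a v] [c w] /= /inv + /inv + -> e2; rewrite e2 => -> [->].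
Qed.

Lemma B2_double s v : B2 s (2 * rR) v -> B2 s (4 * rR) v.
Proof. by move=> /lt_trans; apply; rewrite ltr_pM2r // ltr_nat. Qed.

Variable U : C -> set SC.
Hypothesis nice : nice_family f rR S U.

Let U_open s : S s -> open (U s).
Proof. by move=> Ss; have [H _ _ _] := nice; exact: H. Qed.

Let U_sub4 s (x : SC) : S s -> U s x -> B2 s (4 * rR) x.2.
Proof.
by move=> Ss Ux; apply: B2_double; have [_ _ H _] := nice; exact: H.
Qed.

Lemma nice_disjoint a b x : S a -> S b -> U a x -> U b x -> a = b.
Proof.
move=> Sa Sb ax bx; apply: contrapT => ab; have [_ H _ _] := nice.
by have : (U a `&` U b) x by []; rewrite H.
Qed.

Lemma nice_dichotomy a b (rho : hib R u) x y : S a -> S b -> HIB f rR b rho -> U b x -> U a y ->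
  hib_lift rho x = emb y -> hib_lift rho @` U b `<=` emb @` U a.
Proof.
move=> Sa Sb Hr bx ay xy; have [_ _ _ H] := nice.
have [E|//] := H a b rho Sa Sb Hr.
have : (emb @` U a `&` hib_lift rho @` U b) (emb y) by split; [exists y|exists x].
by rewrite E.
Qed.

(** A first return to U, read backwards, is an edge. The branch through y
    exists on the disc around b and maps U b into U c by niceness. Were it
    to meet U at an intermediate time, then by niceness again so would the
    orbit of y. *)
Lemma edge_of_orbit c b l (y y' : SC) : S c -> S b -> U c y -> U b y' -> (0 < l)%N ->
  iter l (skew f) (emb y) = emb y' ->
  (forall k, (0 < k < l)%N -> ~ (emb @` nice_union S U) (iter k (skew f) (emb y))) ->
  exists tau, [/\ D_U f rR S U tau, hib_base tau = b, ini_rel S U tau c &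
    hib_lift tau y' = emb y].
Proof.
move=> Sc Sb cy by' l0 yy' free; rewrite iter_skew in yy'; case: yy' => e1 e2.
have y'b := U_sub4 Sb by'.
have [tau [Ht tw ty]] := HIB_exists hf rR0 (SP Sb) y'b e2.
have tyy : hib_lift tau y' = emb y.
  rewrite /hib_lift ty tw /emb; congr pair.
  by apply: wcat_initial => n; rewrite -e1.
have tb : hib_base tau = b by have [] := Ht.
have tsub := nice_dichotomy Sc Sb Ht by' cy tyy.
exists tau; split => //; last by split => //; rewrite tb.
have tl : size (hib_word tau) = l by rewrite tw size_mkseq.
have l0' : (0 < size (hib_word tau))%N by rewrite tl.
have [rho [Hr rw rE]] := HIB_drop Sb Ht l0'.
have rl : size (hib_word rho) = l.-1 by rewrite rw size_drop tl subn1.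
exists l, b; split => //; split; first by [].
  by exists (emb y); split; [exists y'|exists y => //; exists c].
exists rho => //; split; first by [].
move=> k kl; apply/seteqP; split => // _ [[_ [x bx <-] <-] [v [s Ss sv] vE]].
have kl' : (k <= size (hib_word rho))%N by rewrite rl ltnW.
have [rho' [Hr' _ r'E]] := HIB_drop Sb Hr kl'.
apply: (free k.+1); first by move: kl; lia.
rewrite r'E in vE; last exact: U_sub4.
have sub := nice_dichotomy Ss Sb Hr' bx sv (esym vE).
have [|t st tE] := sub (hib_lift rho' y'); first by exists y'.
by exists t; [exists s|rewrite tE -r'E // -rE // -iterSr tyy].
Qed.

Lemma edgeP tau : D_U f rR S U tau -> [/\ S (hib_base tau), HIB f rR (hib_base tau) tau,
  (0 < size (hib_word tau))%N & exists a, ini_rel S U tau a].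
Proof.
move=> [n [s [n0 Ss [[Ht tn] [_ [[x sx <-] [y [a Sa ay] xy]]] _]]]].
have tb : hib_base tau = s by have [] := Ht.
rewrite tb tn; split => //; exists a; split => //; rewrite tb.
exact: (nice_dichotomy Sa Ss Ht sx ay (esym xy)).
Qed.

Variables (kappa r : R).
Hypotheses (hu : (0 < u)%N) (k12 : 1 < kappa < 2) (r0 : 0 < r <= rR).
Hypotheses (nA : nice_A S U kappa r) (nB : nice_B f rR S U).

Lemma U_center b xi : S b -> U b ((xi, b) : SC).
Proof.
move=> Sb; have [H _] := nA Sb; apply: H; apply: B2_center.
by case/andP: r0.
Qed.

Definition centre (b : C) : SC := (fun=> Ordinal hu, b).

Lemma ini_rel_unique tau a a' : D_U f rR S U tau -> ini_rel S U tau a ->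
  ini_rel S U tau a' -> a = a'.
Proof.
move=> /edgeP[St _ _ _] [Sa sub] [Sa' sub'].
have tc : (hib_lift tau @` U (hib_base tau)) (hib_lift tau (centre (hib_base tau))).
  by exists (centre (hib_base tau)) => //; exact: U_center.
have [x ax xE] := sub _ tc; have [x' ax' x'E] := sub' _ tc.
by apply: (nice_disjoint Sa Sa' ax); rewrite (emb_inj (etrans xE (esym x'E))).
Qed.

Lemma iniP tau : D_U f rR S U tau -> ini_rel S U tau (ini S U tau).
Proof. by move=> /edgeP[_ _ _ [a ta]]; rewrite /ini; apply: (xgetPex 0); exists a. Qed.

Lemma ini_eq tau a : D_U f rR S U tau -> ini_rel S U tau a -> ini S U tau = a.
Proof. by move=> Dt ta; apply: (ini_rel_unique Dt) => //; exact: iniP. Qed.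

Lemma edge_center_finite tau : D_U f rR S U tau -> hib_inv tau (hib_base tau) <> None.
Proof.
move=> Dt; have [St _ _ _] := edgeP Dt; have [_ sub] := iniP Dt.
have [|x _ xE] := sub (hib_lift tau (centre (hib_base tau))).
  by exists (centre (hib_base tau)) => //; exact: U_center.
by have /= <- := congr1 snd xE.
Qed.

(** (B) bounds the derivative, so [segment_lipschitz] excludes poles as soon
    as the branch is finite at one point. *)
Lemma edge_lipschitz_from tau v0 v1 : D_U f rR S U tau -> B2 (hib_base tau) (2 * rR) v0 ->
  B2 (hib_base tau) (2 * rR) v1 -> hib_inv tau v0 <> None ->
  hib_inv tau v1 <> None /\ cmod (fin (hib_inv tau v1) - fin (hib_inv tau v0)) <= 4^-1 * cmod (v1 - v0).
Proof.
move=> Dt v0b v1b; have [St Ht t0 _] := edgeP Dt.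
have [_ [inv cont] _] := (HIBP hf rR0 (SP St) tau).1 Ht.
have [Si sub] := iniP Dt.
apply: segment_lipschitz; first by rewrite invr_ge0.
move=> t /andP[t0' t1] v.
have vb : B2 (hib_base tau) (2 * rR) v.
  rewrite /B2 /=; set b := hib_base tau in v0b v1b *.
  have -> : v - b = (t%:C)%C * (v1 - b) + ((1 - t)%:C)%C * (v0 - b).
    by rewrite /v rmorphB rmorph1; ring.
  apply: (le_lt_trans (cmodD _ _)); rewrite !cmodM !cmodR ger0_norm // ger0_norm ?subr_ge0 //.
  pose M := Num.max (cmod (v1 - b)) (cmod (v0 - b)).
  have Mb : M < 2 * rR by rewrite gt_max; apply/andP; split.
  apply: le_lt_trans Mb; rewrite [leRHS](_ : M = t * M + (1 - t) * M); last by ring.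
  by rewrite lerD // ler_wpM2l ?subr_ge0 // le_max lexx ?orbT.
have vb4 := B2_double vb.
split; first by move=> e e0; exact: cont.
move=> hv; have [_ holo _ _] := Ht; have [_ der] := holo v vb4.
exists (derive1 (fun w : C^o => fin (hib_inv tau w) : C^o) v).
  have hE : hib_inv tau v = Some (fin (hib_inv tau v)) by case: (hib_inv tau v) hv.
  rewrite hE /coord in der.
  exact: (@derivable_has_cderiv _ (fun w => fin (hib_inv tau w)) v der).
exact: (nB Si St Ht t0 sub vb).
Qed.

Lemma edge_finite tau v : D_U f rR S U tau -> B2 (hib_base tau) (2 * rR) v ->
  hib_inv tau v = Some (fin (hib_inv tau v)).
Proof.
move=> Dt vb; have [|+ _] := edge_lipschitz_from Dt _ vb (edge_center_finite Dt).
  by apply: B2_center; rewrite mulr_gt0.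
by case: (hib_inv tau v).
Qed.

Lemma edge_quarter tau v0 v1 : D_U f rR S U tau -> B2 (hib_base tau) (2 * rR) v0 ->
  B2 (hib_base tau) (2 * rR) v1 ->
  cmod (fin (hib_inv tau v1) - fin (hib_inv tau v0)) <= 4^-1 * cmod (v1 - v0).
Proof.
move=> Dt v0b v1b; apply: (edge_lipschitz_from Dt v0b v1b _).2.
by rewrite edge_finite.
Qed.

Lemma closure_U_ball s x : S s -> closure (U s) x -> cmod (x.2 - s) <= kappa * r.
Proof.
move=> Ss /SC_closureP cx; apply/ler_addgt0Pr => e e0; have [y sy xy] := cx e e0.
have [_ H] := nA Ss; have := H y sy; have := cmod_le_dist x y.
by have := cmod_triangle y.2 x.2 s; rewrite /B2 /=; lra.
Qed.

Lemma closure_U_B2 s x : S s -> closure (U s) x -> B2 s (2 * rR) x.2.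
Proof.
move=> Ss /(closure_U_ball Ss); rewrite /B2 /=; move: r0 k12 => /andP[r1 r2] /andP[k1 k2].
by move=> /le_lt_trans; apply; nra.
Qed.

Lemma edge_emb tau x : D_U f rR S U tau -> closure (U (hib_base tau)) x ->
  hib_lift tau x = emb (hib_map tau x).
Proof.
move=> Dt cx; have [St _ _ _] := edgeP Dt.
by rewrite /hib_lift /emb /hib_map /= -(edge_finite Dt (closure_U_B2 St cx)).
Qed.

Definition edge_ratio : R := Num.max 4^-1 theta%:num.

Lemma edge_ratio_lt1 : 0 <= edge_ratio < 1.
Proof. by rewrite le_max invr_ge0 ler0n /= gt_max theta_lt1 andbT; lra. Qed.

Lemma edge_contraction tau x y : D_U f rR S U tau -> closure (U (hib_base tau)) x ->
  closure (U (hib_base tau)) y ->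
  mdist (hib_map tau x) (hib_map tau y) <= edge_ratio * mdist x y.
Proof.
move=> Dt cx cy; have [St _ t0 _] := edgeP Dt.
have q1 : 4^-1 <= edge_ratio by rewrite le_max lexx.
have q2 : theta%:num <= edge_ratio by rewrite le_max lexx orbT.
have /andP[q0 _] := edge_ratio_lt1.
rewrite !SC_distE /sc_dist ge_max /=; apply/andP; split.
  apply: (le_trans (sdist_wcat _ _ t0)).
  by apply: ler_pM => //; [exact: sdist_ge0|rewrite le_max lexx].
apply: (le_trans (edge_quarter Dt (closure_U_B2 St cy) (closure_U_B2 St cx))).
by apply: ler_pM; rewrite ?cmod_ge0 ?invr_ge0 // le_max lexx orbT.
Qed.

Lemma edge_maps_U tau x : D_U f rR S U tau -> U (hib_base tau) x ->
  U (ini S U tau) (hib_map tau x).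
Proof.
move=> Dt bx; have [Si sub] := iniP Dt.
have [|y iy yE] := sub (hib_lift tau x); first by exists x.
by rewrite (mapE (esym yE)).
Qed.

Lemma edge_maps_closure tau x : D_U f rR S U tau -> closure (U (hib_base tau)) x ->
  closure (U (ini S U tau)) (hib_map tau x).
Proof.
move=> Dt cx; apply/SC_closureP => e e0; have [y sy xy] := (SC_closureP _ _).1 cx e e0.
exists (hib_map tau y); first exact: edge_maps_U.
have /andP[q0 q1] := edge_ratio_lt1.
apply: (le_lt_trans (edge_contraction Dt cx (subset_closure sy))).
apply: le_lt_trans xy; have := mdist_ge0 x y; nra.
Qed.

Lemma edge_inj tau : D_U f rR S U tau -> set_inj (closure (U (hib_base tau))) (hib_map tau : SC -> SC).
Proof.
move=> Dt x y /set_mem cx /set_mem cy E; have [St Ht _ _] := edgeP Dt.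
apply: (lift_inj Ht); last by rewrite !edge_emb // E.
- exact: B2_double (closure_U_B2 St cx).
- exact: B2_double (closure_U_B2 St cy).
Qed.

Lemma closure_U_compact s : S s -> compact (closure (U s)).
Proof.
move=> Ss; apply: (subclosed_compact _ (@SC_ball_compact _ _ _ s (kappa * r) _)).
- exact: closed_closure.
- by move: r0 k12 => /andP[? ?] /andP[? ?]; rewrite mulr_ge0; lra.
- by move=> x; exact: closure_U_ball.
Qed.

Lemma edges_countable : finite_set S -> countable (D_U f rR S U).
Proof.
move=> finS; apply: (@sub_countable _ _ _ (\bigcup_(s in S) HIB f rR s)).
  by apply: subset_card_le => tau /edgeP[St Ht _ _]; exists (hib_base tau).
apply: bigcup_countable; first exact: finite_set_countable.
by move=> s Ss; exact: (HIB_countable hf rR0 (SP Ss)).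
Qed.

Lemma edges_graph_directed (A : hib R u -> hib R u -> bool) : finite_set S ->
  (forall tau om, D_U f rR S U tau -> D_U f rR S U om ->
     A tau om -> hib_base tau = ini S U om) ->
  graph_directed_system (system f rR S U A).
Proof.
move=> finS HA; split=> /=.
- by split=> //; exact: edges_countable.
- by move=> e De; have [? _ _ _] := edgeP De; have [? _] := iniP De.
- exact: closure_U_compact.
- move=> e De; split; last exact: edge_inj.
  by move=> _ [x cx <-]; exact: edge_maps_closure.
- split; last exact: HA.
  have /andP[q0 q1] := edge_ratio_lt1; exists edge_ratio; split => // e De x y.
  by move=> /set_mem cx /set_mem cy; exact: edge_contraction.
Qed.

(** * The limit set *)

Lemma initial_wcat (w : seq 'I_u) xi n : initial (wcat w xi) (size w + n) = w ++ initial xi n.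
Proof.
apply: (@eq_from_nth _ (xi 0%N)); first by rewrite size_cat !size_mkseq.
move=> i; rewrite size_mkseq => il; rewrite nth_mkseq // nth_cat.
have [iw|iw] := ltnP i (size w); first by rewrite /wcat; apply: set_nth_default.
by rewrite nth_mkseq /wcat ?nth_default //; lia.
Qed.

(** As in [julia_backward1], normality is pushed forward by the open map
    f_w. *)
Lemma julia_fiber_wcat w xi z : julia_fiber f xi (fword f w z) -> julia_fiber f (wcat w xi) z.
Proof.
apply: contra_not => -[V [oV Vz nV]].
exists (fword f w @` V); split; last 1 first.
- apply: normal_push nV => //; first exact: fword_unif_open.
  move=> _ [n _ <-]; exists (size w + n)%N => //.
  by rewrite -addnS initial_wcat fword_cat.
- by apply: open_push => //; exact: fword_unif_open.
- by exists z.
Qed.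

Definition in_julia_fiber (x : SC) := julia_fiber f x.1 (Some x.2).

Lemma edge_julia_fiber tau x : D_U f rR S U tau -> closure (U (hib_base tau)) x ->
  in_julia_fiber x -> in_julia_fiber (hib_map tau x).
Proof.
move=> Dt cx Jx; have [St [_ _ inv _] _ _] := edgeP Dt.
have xb := closure_U_B2 St cx.
rewrite /in_julia_fiber /= -edge_finite //; apply: julia_fiber_wcat.
by rewrite inv //; exact: B2_double.
Qed.

Section Composition.
Variable A : hib R u -> hib R u -> bool.
Local Notation Sys := (system f rR S U A).
Variable om : nat -> hib R u.
Hypotheses (omD : forall k, D_U f rR S U (om k))
  (chain : forall k, hib_base (om k) = ini S U (om k.+1)).

Lemma comp_contraction n x y : closure (U (ini S U (om n))) x ->
  closure (U (ini S U (om n))) y ->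
  mdist (gds_comp Sys om n x) (gds_comp Sys om n y) <= edge_ratio ^+ n * mdist x y.
Proof.
have /andP[q0 _] := edge_ratio_lt1.
elim: n x y => [|n IH] x y; first by rewrite expr0 mul1r.
rewrite -chain => cx cy /=.
apply: (le_trans (IH _ _ (edge_maps_closure (omD n) cx) (edge_maps_closure (omD n) cy))).
by rewrite exprSr -mulrA ler_wpM2l ?exprn_ge0 //; exact: edge_contraction.
Qed.

Lemma comp_julia_fiber n x : closure (U (ini S U (om n))) x -> in_julia_fiber x ->
  in_julia_fiber (gds_comp Sys om n x).
Proof.
elim: n x => [|n IH] x //; rewrite -chain => cx Jx /=.
by apply: IH; [exact: edge_maps_closure|exact: edge_julia_fiber].
Qed.

Lemma comp_small e : 0 < e -> exists n, forall x y, closure (U (hib_base (om n))) x ->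
  closure (U (hib_base (om n))) y ->
  mdist (gds_comp Sys om n.+1 x) (gds_comp Sys om n.+1 y) < e.
Proof.
move=> e0; have /andP[q0 q1] := edge_ratio_lt1.
pose M := 1 + 2 * (kappa * r).
have M0 : 0 < M by move: r0 k12 => /andP[? ?] /andP[? ?]; rewrite /M; nra.
have ae : `|edge_ratio| < 1 by rewrite ger0_norm.
have eM : 0 < e / M by rewrite divr_gt0.
have /cvgrPdist_lt /(_ _ eM) [n _ Hn] := cvg_expr ae; exists n => x y cx cy.
have := Hn n.+1 (leqnSn n); rewrite /= sub0r normrN ger0_norm ?exprn_ge0 //.
rewrite ltr_pdivlMr //; apply: le_lt_trans.
rewrite !chain in cx cy; apply: (le_trans (comp_contraction cx cy)).
have [Si _] := iniP (omD n.+1).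
rewrite ler_wpM2l ?exprn_ge0 // SC_distE /sc_dist ge_max; apply/andP; split.
  apply: (le_trans (sdist_le1 _ _)); rewrite /M lerDl.
  by move: r0 k12 => /andP[? ?] /andP[? ?]; nra.
have := cmod_triangle (ini S U (om n.+1)) x.2 y.2.
have := closure_U_ball Si cx; have := closure_U_ball Si cy.
by rewrite (cmodB y.2) /M; lra.
Qed.

End Composition.

Hypotheses (SJ : forall s, S s -> julia f (Some s))
  (Jfiber : forall v, julia f (Some v) -> exists xi, julia_fiber f xi (Some v))
  (perf : forall x (e : R), julia f (Some x) -> 0 < e ->
     exists v, [/\ julia f (Some v), v != x & cmod (v - x) < e]).

(** A point of the limit set is a limit of images of vertices. With a
    suitable itinerary a vertex is in a fibre Julia set, and edges pull
    these sets back. *)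
Lemma limit_set_julia (A : hib R u -> hib R u -> bool) :
  (forall tau om, D_U f rR S U tau -> D_U f rR S U om ->
     A tau om -> hib_base tau = ini S U om) ->
  gds_limit_set (system f rR S U A) `<=` julia_skew f.
Proof.
move=> HA x [om [/= omD omA xE]].
have chain k : hib_base (om k) = ini S U (om k.+1) by apply: HA.
apply/SC_closureP => e e0; have [n Hn] := comp_small A omD chain e0.
have [St _ _ _] := edgeP (omD n); have [xi Jxi] := Jfiber (SJ St).
have cp : closure (U (hib_base (om n))) ((xi, hib_base (om n)) : SC).
  by apply: subset_closure; exact: U_center.
have : [set x] x by []; rewrite -xE => /(_ n I)[y cy yx].
exists (gds_comp (system f rR S U A) om n.+1 (xi, hib_base (om n))).
  by apply: comp_julia_fiber => //; rewrite -chain.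
by rewrite -{1}yx; exact: Hn.
Qed.

Lemma julia_avoid s (Z : seq C) e : julia f (Some s) -> 0 < e ->
  exists v, [/\ julia f (Some v), v \notin Z & cmod (v - s) < e].
Proof.
move=> Js e0.
have fZ : finite_set [set z | z \in Z /\ z != s].
  by apply: (@sub_finite_set _ _ [set` Z]) => [z []//|]; exact: finite_seq.
have [||d d0 Hd] := finite_min fZ (P := fun z d => d <= cmod (z - s)).
- by move=> z a b ba; apply: le_trans.
- by move=> z [_ zs]; exists (cmod (z - s)) => //; rewrite cmod_gt0 subr_eq0.
have m0 : 0 < Num.min d e by rewrite lt_min d0.
have [v [Jv vs]] := perf Js m0; rewrite lt_min => /andP[vd ve].
exists v; split => //; apply/negP => vZ.
by have := Hd v (conj vZ vs); rewrite leNgt vd.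
Qed.

Definition returning (y : SC) := forall k, exists2 k', (k < k')%N &
  (emb @` nice_union S U) (iter k' (skew f) (emb y)).

(** Near s there are infinitely many points of the Julia set in U, whereas
    an orbit which leaves U for ever comes close to finitely many of them
    only. *)
Lemma trans_returning x : nice_union S U x -> trans f x -> returning x.
Proof.
move=> [s Ss sx] [_ dense] k; apply: contrapT => nret.
pose Z := [seq fin (iter j (skew f) (emb x)).2 | j <- iota 0 k.+1].
have rr : 0 < r by case/andP: r0.
have [v [Jv vZ vs]] := julia_avoid Z (SJ Ss) rr.
have [xi Jxi] := Jfiber Jv; pose p : SC := (xi, v).
have Up : U s p by have [H _] := nA Ss; exact: H.
have [||d d0 Hd] := finite_min (finite_seq Z) (P := fun z d => d <= cmod (z - v)).
- by move=> z a b ba; apply: le_trans.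
- move=> z /= zZ; exists (cmod (z - v)) => //; rewrite cmod_gt0 subr_eq0.
  by apply: contraNneq vZ => <-.
have clp : closure [set y : SC | exists n, emb y = iter n (skew f) (emb x)] p.
  by apply: dense; apply: subset_closure.
have [|y [[n yn] [Uy yv]]] := clp (U s `&` [set y | mdist p y < d]).
  apply: filterI; first exact: open_nbhs_nbhs (conj (U_open Ss) Up).
  by apply/SC_nbhsP; exists d.
have [nk|kn] := leqP n k; last first.
  by apply: nret; exists n => //; rewrite -yn; exists y => //; exists s.
have yZ : y.2 \in Z.
  apply/mapP; exists n; first by rewrite mem_iota.
  by rewrite -yn.
have := cmod_le_dist p y; rewrite /= cmodB => /le_lt_trans /(_ yv).
by rewrite ltNge Hd.
Qed.

Lemma returning_edge c y : S c -> U c y -> returning y -> exists tau b y',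
  [/\ D_U f rR S U tau, hib_base tau = b, ini S U tau = c, hib_map tau y' = y &
      [/\ S b, U b y' & returning y']].
Proof.
move=> Sc cy ret.
have ex : exists l, (0 < l)%N && `[< (emb @` nice_union S U) (iter l (skew f) (emb y)) >].
  by have [l l0 H] := ret 0%N; exists l; rewrite l0; apply/asboolP.
pose l := ex_minn ex.
have [/andP[l0 /asboolP[y' [b Sb by'] y'E]] lmin] : (0 < l)%N && `[< (emb @` nice_union S U) (iter l (skew f) (emb y)) >] /\
    forall k, (0 < k)%N && `[< (emb @` nice_union S U) (iter k (skew f) (emb y)) >] -> (l <= k)%N.
  by rewrite /l; case: ex_minnP.
have [|tau [Dt tb tc tE]] := edge_of_orbit Sc Sb cy by' l0 (esym y'E).
  move=> k /andP[k0 kl] /asboolP H; have := lmin k; rewrite k0 H => /(_ isT).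
  by rewrite leqNgt kl.
exists tau, b, y'; split => //; first exact: ini_eq.
  exact: mapE.
split => // k; have [k' kk' H] := ret (k + l)%N.
exists (k' - l)%N; first by rewrite ltn_subRL addnC.
by rewrite y'E -iterD subnK // (leq_trans _ (ltnW kk')) // leq_addl.
Qed.

(** The successive returns of the orbit to U form a chain of edges, and
    their compositions shrink to x. *)
Lemma trans_limit_set (A : hib R u -> hib R u -> bool) :
  (forall tau om, D_U f rR S U tau -> D_U f rR S U om ->
     hib_base tau = ini S U om -> A tau om) ->
  nice_union S U `&` trans f `<=` gds_limit_set (system f rR S U A).
Proof.
move=> HA x [Ux tx]; have ret := trans_returning Ux tx; have [s Ss sx] := Ux.
pose good (p : SC * C) := [/\ S p.2, U p.2 p.1 & returning p.1].
have [F HF] : exists F : SC * C -> hib R u * (SC * C), forall p, good p ->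
    [/\ D_U f rR S U (F p).1, hib_base (F p).1 = (F p).2.2, ini S U (F p).1 = p.2,
        hib_map (F p).1 (F p).2.1 = p.1 & good (F p).2].
  pose Q (p : SC * C) (q : hib R u * (SC * C)) := good p ->
    [/\ D_U f rR S U q.1, hib_base q.1 = q.2.2, ini S U q.1 = p.2,
        hib_map q.1 q.2.1 = p.1 & good q.2].
  suff H p : exists q, Q p q by have [F HF] := boolp.choice H; exists F.
  have [gp|nG] := pselect (good p); last by exists (Hib 0 [::] (fun=> None), p).
  have [Sc cy ry] := gp.
  by have [tau [b [y' [H1 H2 H3 H4 H5]]]] := returning_edge Sc cy ry; exists (tau, (y', b)).
pose P n := iter n (fun p => (F p).2) (x, s).
have Pg n : good (P n) by elim: n => [//|n IH]; rewrite /P iterS; have [] := HF _ IH.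
pose om n := (F (P n)).1.
have omD n : D_U f rR S U (om n) by have [] := HF _ (Pg n).
have omt n : hib_base (om n) = (P n.+1).2 by have [_ + _ _ _] := HF _ (Pg n).
have omi n : ini S U (om n) = (P n).2 by have [_ _ + _ _] := HF _ (Pg n).
have omE n : hib_map (om n) (P n.+1).1 = (P n).1 by have [_ _ _ + _] := HF _ (Pg n).
have chain n : hib_base (om n) = ini S U (om n.+1) by rewrite omt omi.
have cE n : gds_comp (system f rR S U A) om n (P n).1 = x.
  by elim: n => [//|n IH]; rewrite -[LHS]/(gds_comp _ om n (hib_map (om n) (P n.+1).1)) omE.
have cP n : closure (U (hib_base (om n))) (P n.+1).1.
  by apply: subset_closure; rewrite omt; have [] := Pg n.+1.
exists om; split => //=; first by move=> k; apply: HA.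
apply/seteqP; split=> [y yc|_ -> n _]; last by exists (P n.+1).1; [exact: cP|exact: cE n.+1].
apply: contrapT => yx; have d0 : 0 < mdist x y by rewrite mdist_gt0; apply/eqP => xy; apply: yx.
have [n Hn] := comp_small A omD chain d0; have [z cz zy] := yc n I.
have := Hn _ _ (cP n) cz; rewrite (cE n.+1).
have -> : gds_comp (system f rR S U A) om n.+1 z = y by exact: zy.
by rewrite ltxx.
Qed.

(** * Primitivity *)

Fixpoint edge_path a (w : seq (hib R u)) b : Prop :=
  if w is e :: w' then [/\ D_U f rR S U e, ini S U e = a & edge_path (hib_base e) w' b]
  else a = b.

Lemma edge_path_cat a b c w w' : edge_path a w b -> edge_path b w' c ->
  edge_path a (w ++ w') c.
Proof.
elim: w a => [|e w IH] a /=; first by move=> ->.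
by move=> [De ie wb] bc; split => //; exact: IH.
Qed.

(** The orbit is cut at its visits to U. *)
Lemma orbit_edge_path l a b (y y' : SC) : S a -> S b -> U a y -> U b y' ->
  iter l (skew f) (emb y) = emb y' -> exists w, edge_path a w b.
Proof.
elim/ltn_ind: l a y => l IH a y Sa Sb ay by' yy'.
have [l0|l0] := posnP l.
  rewrite l0 /= in yy'; rewrite (emb_inj yy') in ay.
  by exists [::]; exact: (nice_disjoint Sa Sb ay).
have ex : exists k, (0 < k)%N && `[< (emb @` nice_union S U) (iter k (skew f) (emb y)) >].
  exists l; rewrite l0; apply/asboolP; rewrite yy'; exists y' => //.
  by exists b.
pose k := ex_minn ex.
have [/andP[k0 /asboolP[y1 [c Sc cy1] y1E]] kmin] : (0 < k)%N && `[< (emb @` nice_union S U) (iter k (skew f) (emb y)) >] /\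
    forall j, (0 < j)%N && `[< (emb @` nice_union S U) (iter j (skew f) (emb y)) >] -> (k <= j)%N.
  by rewrite /k; case: ex_minnP.
have kl : (k <= l)%N.
  apply: kmin; rewrite l0; apply/asboolP; rewrite yy'; exists y' => //.
  by exists b.
have [|tau [Dt tb tc tE]] := edge_of_orbit Sa Sc ay cy1 k0 (esym y1E).
  move=> j /andP[j0 jk] /asboolP H; have := kmin j; rewrite j0 H => /(_ isT).
  by rewrite leqNgt jk.
have [||w wP] := IH (l - k)%N _ c y1 Sc Sb cy1 by'.
- by rewrite ltn_subrL k0 l0.
- by rewrite y1E -iterD subnK.
exists (tau :: w); split => //; first exact: ini_eq.
by rewrite tb.
Qed.

Hypothesis trans : forall x b e, julia f (Some x) -> julia f (Some b) ->
  0 < e -> exists w z, [/\ w <> [::], cmod (z - x) < e & fword f w (Some z) = Some b].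

Lemma edges_irreducible a b : S a -> S b -> exists w, edge_path a w b.
Proof.
move=> Sa Sb; have rr : 0 < r by case/andP: r0.
have [w [z [_ za zb]]] := trans (SJ Sa) (SJ Sb) rr.
pose xi : nat -> 'I_u := fun=> Ordinal hu.
apply: (@orbit_edge_path (size w) a b ((wcat w xi, z) : SC) ((xi, b) : SC)) => //.
- by have [H _] := nA Sa; exact: H.
- exact: U_center.
have iw : initial (wcat w xi) (size w) = w.
  by have := initial_wcat w xi 0; rewrite addn0 cats0.
rewrite iter_skew iw zb; congr pair.
by apply/funext => k; exact: wcat_ge.
Qed.

(** By (A), points at distance at least kappa * r from S are outside U, so
    the end of the segment is the first return. *)
Lemma reach_edge c b : S c -> S b -> reach f S (kappa * r) c r b ->
  exists tau, [/\ D_U f rR S U tau, ini S U tau = c & hib_base tau = b].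
Proof.
move=> Sc Sb [n [om [z [n0 zc zb zp far]]]].
have orb k : (k <= n)%N -> iter k (skew f) (om, Some (z 0%N)) =
    (fun j => om (k + j)%N, Some (z k)).
  by move=> kn; rewrite iter_skew -seg0 (fpath_word zp).
have [||||tau [Dt tb tc _]] := @edge_of_orbit c b n ((om, z 0%N) : SC)
    ((fun j => om (n + j)%N, b) : SC) Sc Sb _ _ n0 _ _.
- by have [H _] := nA Sc; exact: H.
- exact: U_center.
- by rewrite orb // zb.
- move=> k kn [v [s Ss sv]]; rewrite orb; last by case/andP: kn => _ /ltnW.
  move=> [_ vz]; have [_ H] := nA Ss; have := H v sv.
  by rewrite /B2 /= vz ltNge (far k s kn Ss).
by exists tau; split => //; exact: ini_eq.
Qed.

Lemma edge_path_admissible (A : hib R u -> hib R u -> bool) e w e' :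
  (forall tau om, D_U f rR S U tau -> D_U f rR S U om ->
     hib_base tau = ini S U om -> A tau om) ->
  D_U f rR S U e -> D_U f rR S U e' -> edge_path (hib_base e) w (ini S U e') ->
  gds_admissible (system f rR S U A) (e :: rcons w e').
Proof.
move=> HA De De' we'.
suff [H1 H2] : all (fun e => `[< D_U f rR S U e >]) (rcons w e') /\ path A e (rcons w e').
  by split => //=; rewrite H1 andbT; apply/asboolP.
elim: w e De we' => [|d w IH] e De /=.
  by move=> E; split; rewrite andbT; [apply/asboolP|exact: HA].
move=> [Dd de wp]; have [H1 H2] := IH d Dd wp; rewrite H1 H2 !andbT; split.
  exact/asboolP.
by apply: HA => //; rewrite de.
Qed.

(** Paths to the hub c are padded by loops at c to one common length, and
    continued by the edge from c to the required vertex. *)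
Lemma edges_finitely_primitive (A : hib R u -> hib R u -> bool) : finite_set S ->
  (forall tau om, D_U f rR S U tau -> D_U f rR S U om ->
     hib_base tau = ini S U om -> A tau om) ->
  (S !=set0 -> exists2 c, S c & forall b, S b -> reach f S (kappa * r) c r b) ->
  finitely_primitive (system f rR S U A).
Proof.
move=> finS HA hub.
have [S0|S0] := pselect (S !=set0); last first.
  exists set0, 0%N; split => // e e' De; have [Se _ _ _] := edgeP De.
  by case: S0; exists (hib_base e).
have [c Sc cb] := hub S0.
have [W HW] : exists W : C -> seq (hib R u), forall a, S a -> edge_path a (W a) c.
  suff H a : exists w, S a -> edge_path a w c by have [W HW] := boolp.choice H; exists W.
  have [Sa|nS] := pselect (S a); last by exists [::].
  by have [w wP] := edges_irreducible Sa Sc; exists w.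
have [E HE] : exists E : C -> hib R u, forall b, S b ->
    [/\ D_U f rR S U (E b), ini S U (E b) = c & hib_base (E b) = b].
  suff H b : exists e, S b -> [/\ D_U f rR S U e, ini S U e = c & hib_base e = b].
    by have [E HE] := boolp.choice H; exists E.
  have [Sb|nS] := pselect (S b); last by exists (Hib 0 [::] (fun=> None)).
  by have [e eP] := reach_edge Sc Sb (cb b Sb); exists e.
have [N HN] : exists N, forall a, S a -> (size (W a) <= N)%N.
  have [s sE] := (finite_seqP _).1 finS.
  exists (\max_(a <- s) size (W a))%N => a; rewrite sE /= => sa.
  exact: leq_bigmax_seq.
have loops k : edge_path c (nseq k (E c)) c.
  by elim: k => //= k IH; have [Dc ic bc] := HE c Sc; rewrite bc; split.
pose word a b := W a ++ nseq (N - size (W a)) (E c) ++ [:: E b].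
have wordP a b : S a -> S b -> edge_path a (word a b) b.
  move=> Sa Sb; apply: (edge_path_cat (HW a Sa)); apply: (edge_path_cat (loops _)).
  by have [Db ib bb] := HE b Sb.
have adm e e' : D_U f rR S U e -> D_U f rR S U e' ->
    gds_admissible (system f rR S U A) (e :: rcons (word (hib_base e) (ini S U e')) e').
  move=> De De'; apply: edge_path_admissible => //; apply: wordP.
    by have [] := edgeP De.
  by have [] := iniP De'.
exists [set word p.1 p.2 | p in S `*` S], N.+1; split.
- by apply: finite_image; exact: finite_setX.
- move=> _ [[a b] /= [Sa Sb] <-]; split.
    by rewrite /word !size_cat size_nseq /= addn1 addnS subnKC // HN.
  have [Da _ ba] := HE a Sa.
  have [v [Dv iv _]] : exists tau, [/\ D_U f rR S U tau, ini S U tau = b & true].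
    have [[|e w] /= wP] := edges_irreducible Sb Sc; last by exists e; case: wP.
    by exists (E c); have [? ? _] := HE c Sc; rewrite wP.
  have [] := adm _ _ Da Dv; rewrite ba iv /=.
  rewrite all_rcons rcons_path => /andP[_ /andP[_ H1]] /andP[H2 _].
  by split => //; exact: path_sorted H2.
- move=> e e' De De'; exists (word (hib_base e) (ini S U e')); last exact: adm.
  exists (hib_base e, ini S U e') => //; split => /=.
    by have [] := edgeP De.
  by have [] := iniP De'.
Qed.

End Edges.

(** * The graph directed system of a nice family *)

Section Hub.
Context {R : realType} {u : nat}.
Local Notation C := R[i].
Local Notation Chat := (sphere R).
Variable f : 'I_u -> Chat -> Chat.
Hypothesis hf : forall i, nonconstant_rational (f i).
Hypothesis Finf : fatou f None.
Variables Rs K q : R.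
Hypotheses (Rs0 : 0 < Rs) (K0 : 0 < K) (q01 : 0 < q < 1) (shr : shrinking f Rs K q).
Hypothesis perf : forall x (e : R), julia f (Some x) -> 0 < e ->
  exists v, [/\ julia f (Some v), v != x & cmod (v - x) < e].

(** A critical vertex is a hub if there is one; otherwise every vertex is. *)
Lemma hub_exists (rR : R) (S : set C) : 0 < rR -> vertex_set f rR S -> S !=set0 ->
  exists2 d : R, 0 < d & forall r kappa, 0 < r <= rR -> r <= d -> 1 < kappa < 2 ->
    exists2 c, S c & forall b, S b -> reach f S (kappa * r) c r b.
Proof.
move=> rR0 [finS aper critS SP] [s0 Ss0].
have SJ s : S s -> julia f (Some s) by move=> /SP[].
have [[c0 cc]|none] := pselect (crit_star f !=set0).
  have [c Sc cE] := critS _ cc; rewrite -{}cE in cc.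
  have [|d d0 Hd] := hub_critical hf Finf finS aper SJ Rs0 K0 q01 shr rR0 Sc _ cc.
    by move=> s /SP[].
  exists (d / 2); first by rewrite divr_gt0.
  move=> r kappa /andP[r0 rr] rd /andP[k1 k2]; exists c => // b Sb.
  apply: Hd => //.
  - apply: (@le_trans _ _ (2 * r)); first by rewrite ler_pM2r // ltW.
    lra.
  - apply: (@le_trans _ _ (2 * r)); first by rewrite ler_pM2r // ltW.
    lra.
have noncrit i z : julia f (f i z) -> ~ crit (f i) z.
  by move=> Jz ci; apply: none; exists z; exists i.
have [d d0 Hd] := hub_expanding hf Finf noncrit Rs0 K0 q01 shr perf finS aper SJ.
exists d => // r kappa /andP[r0 rr] rd /andP[k1 k2]; exists s0 => // b Sb.
by apply: Hd => //; [rewrite r0|rewrite ler_pM2r // ltW].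
Qed.

End Hub.

Theorem theorem1p6 (R : realType) (u : nat) (hu : (1 <= u)%N)
    (theta : {itv R & `]0, 1[}) (f : 'I_u -> sphere R -> sphere R)
    (hf : forall i, nonconstant_rational (f i)) (hG : TNR f)
    (Rs : R) (hRs : Rstar f Rs) (rR : R) (hrR : 0 < rR < Rs)
    (kappa : R) (hkappa : 1 < kappa < 2)
    (S : set R[i]) (hS : vertex_set f rR S) :
  exists2 r0 : R, 0 < r0 &
  forall r : R, 0 < r <= rR -> r <= r0 ->
  forall U : R[i] -> set (SC u theta),
    nice_family f rR S U -> nice_A S U kappa r -> nice_B f rR S U ->
  exists A : hib R u -> hib R u -> bool,
  let Sys := system f rR S U A in
  [/\ (forall tau, D_U f rR S U tau ->
         (exists! a, ini_rel S U tau a) /\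
         (forall x : SC u theta, closure (U (hib_base tau)) x ->
            hib_lift tau x = emb (hib_map tau x))),
      graph_directed_system Sys,
      (forall tau om, D_U f rR S U tau -> D_U f rR S U om ->
         (A tau om <-> hib_base tau = ini S U om)),
      gds_limit_set Sys `<=` julia_skew f /\
      nice_union S U `&` trans f `<=` gds_limit_set Sys &
      finitely_primitive Sys].
Proof.
have [[deg2 _ Finf] _ critPCV] := hG.
have rR0 : 0 < rR by case/andP: hrR.
have [K [q [Rs0 K0 q01 shr]]] := Rstar_shrinking hRs.
have perf x e (Jx : julia f (Some x)) (e0 : 0 < e) :=
  julia_perfect hf Finf Rs0 K0 q01 shr deg2 critPCV Jx e0.
have [finS aper critS SP] := hS.
have SJ s : S s -> julia f (Some s) by move=> /SP[].
have SPCV s : S s -> ~ enbhd (PCV f) (8 * rR) s by move=> /SP[].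
have Jfiber v : julia f (Some v) -> exists xi, julia_fiber f xi (Some v).
  move=> /(jorbit_exists hf Finf)[om [x [xorb <-]]]; exists om.
  exact: (jorbit_fiber hf Finf Rs0 K0 q01 shr xorb).
have [r0 r00 hub] : exists2 r0 : R, 0 < r0 & forall r, 0 < r <= rR -> r <= r0 ->
    S !=set0 -> exists2 c, S c & forall b, S b -> reach f S (kappa * r) c r b.
  have [S0|S0] := pselect (S !=set0); last by exists 1.
  have [d d0 Hd] := hub_exists hf Finf Rs0 K0 q01 shr perf rR0 hS S0.
  by exists d => // r rr rd _; exact: Hd.
exists r0 => // r rr rr0 U nice nA nB.
exists (fun tau om => `[< hib_base tau = ini S U om >]).
have AP tau om : `[< hib_base tau = ini S U om >] <-> hib_base tau = ini S U om.
  by split=> /asboolP.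
split.
- move=> tau Dt; split; last first.
    by move=> x; exact: (edge_emb hf rR0 SPCV nice hu hkappa rr nA nB).
  exists (ini S U tau); split; first exact: (iniP nice).
  by move=> a ta; apply: (ini_rel_unique nice hu rr nA Dt) => //; exact: (iniP nice).
- by apply: (edges_graph_directed hf rR0 SPCV nice hu hkappa rr nA nB) => // ? ? _ _ /AP.
- by move=> tau om _ _; exact: AP.
- split.
    by apply: (limit_set_julia hf rR0 SPCV nice hu hkappa rr nA nB) => // ? ? _ _ /AP.
  by apply: (trans_limit_set hf rR0 SPCV nice hu hkappa rr nA nB) => // ? ? _ _ /AP.
- apply: (edges_finitely_primitive hf rR0 SPCV nice hu hkappa rr nA SJ) => //.
  + exact: (julia_transitive hf Finf Rs0 K0 q01 shr).
  + by move=> ? ? _ _ /AP.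
  + exact: hub.
Qed.
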